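(* Let $\tau>0$ and $\xi>0$. Suppose that the following hold. (1) $\phi$ is smooth, $\int_{\mathcal X} e^{-\phi(x)}\,dx=1$, and for any time $\tau>0$ there is a constant $C^{\mathrm{Lions}}_\tau>0$ such that for all $g\in \mathrm L^2(\mathrm U_\tau\otimes\mu)$ $$\Big\|g-\iint_{[0,\tau]\times\mathcal X} g\,d\mathrm U_\tau\,d\mu\Big\|^2_{\mathrm L^2(\mathrm U_\tau\otimes\mu)}\le C^{\mathrm{Lions}}_\tau\,\|\nabla_{t,x}g\|^2_{\mathrm H^{-1}(\mathrm U_\tau\otimes\mu)}.$$ (2) $\psi$ is smooth, $\int_{\mathcal V}e^{-\psi(v)}\,dv=1$, $\int_{\mathcal V}|\nabla_v\psi|^4\,d\gamma+\int_{\mathcal V}|\nabla_v^2\psi|^2\,d\gamma<+\infty$, $\limsup_{R\to\infty}\int_{\mathcal V\setminus B(0,R)}|\nabla\psi|^{-2}\,d\gamma=0$, and the symmetric positive matrix $\mathscr M=\int_{\mathcal V}\nabla_v\psi\otimes\nabla_v\psi\,d\gamma$ is definite. (3) The Lie algebra generated by $\nabla_v$ and $\nabla_v\psi\cdot\nabla_x-\nabla_x\phi\cdot\nabla_v$ is of dimension $2d$ at all points $(x,v)\in\mathcal X\times\mathcal V$. (4) There is a constant $L_\phi\in\mathbb R_+$ such that $\|z\,\nabla_x\phi\|_{\mathrm L^2(\mu)}\le L_\phi\|z\|_{\mathrm H^1(\mu)}$ for all $z\in\mathrm H^1(\mu)$. (5) There is $c_\psi>0$ such that $\|g\|_{\mathrm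 L^2(\gamma)}\le c_\psi^{-1/2}\|\nabla_vg\|_{\mathrm L^2(\gamma)}$ for all $g\in\mathrm H^1(\gamma)\cap\mathrm L^2_0(\gamma)$. Let $\bar\lambda=\frac{1}{1+C^{\mathrm{Lions}}_\tau K_{\mathrm{avg}}}\left(\frac1{\xi c_\psi}+\xi\right)^{-1}$, with $K_{\mathrm{avg}}$ the averaging constant defined in the context. Then there is a constant $\lambda\ge\bar\lambda>0$, for which the time-averaged estimate $\mathscr H_\tau(t)\le e^{-2\lambda t}\mathscr H_\tau(0)$, $t\ge 0$, holds for all solutions, and with this same $\lambda$ all solutions $h$ to (VOU) with initial condition $h_0\in\mathrm L^2_0(\Theta)$ satisfy $$\forall t\ge0,\qquad \|h(t,\cdot,\cdot)\|^2_{\mathrm L^2(\Theta)}\le e^{\lambda\tau}\,e^{-\lambda t}\,\|h_0\|^2_{\mathrm L^2(\Theta)}.$$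
   Context: $\mathcal X$ is the position space and $\mathcal V$ the velocity space, both of dimension $d$; typical choices are $\mathcal X=\mathbb R^d$ or $\mathcal X=(L\mathbb T)^d$ with $L>0$ and $\mathbb T=\mathbb R/\mathbb Z$, and $\mathcal V=\mathbb R^d$ or $\mathcal V=\mathbb T^d$. Given $\phi:\mathcal X\to\mathbb R$ and $\psi:\mathcal V\to\mathbb R$, set $\mu(dx)=e^{-\phi(x)}dx$, $\gamma(dv)=e^{-\psi(v)}dv$, $\Theta(dx\,dv)=\mu(dx)\,\gamma(dv)$ (probability measures). A subscript $0$, as in $\mathrm L^2_0(\Theta)$ or $\mathrm L^2_0(\gamma)$, denotes the subspace of functions with average $0$ for the indicated measure. $\mathrm U_\tau(dt)=\tau^{-1}\mathbf 1_{[0,\tau]}(t)\,dt$. $\mathrm H^1_{\mathrm{DC}}(\mathrm U_\tau\otimes\mu)=\{z\in\mathrm H^1(\mathrm U_\tau\otimes\mu): z(0,\cdot)=z(\tau,\cdot)=0\}$, and $\mathrm H^{-1}(\mathrm U_\tau\otimes\mu)$ is its dual with the dual norm (for vector-valued functions, that of the dual of $\mathrm H^1_{\mathrm{DC}}(\mathrm U_\tau\otimes\mu)^{d+1}$). $\mathrm H^{-1}(\gamma)$ is the dual of $\mathrm H^1(\gamma)$. Equation (VOU), with $\xi>0$, is $$\partial_th+\nabla_v\psi\cdot\nabla_xh-\nabla_x\phi\cdot\nabla_vh=-\xi\,\nabla_v^\star\nabla_vh,\qquad h(0,\cdot,\cdot)=h_0\in\mathrm L^2(\Theta),$$ where $\star$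 denotes adjoints in $\mathrm L^2(\Theta)$, so $-\nabla_v^\star\nabla_v=\Delta_v-\nabla_v\psi\cdot\nabla_v$. Solutions live in $\mathrm L^\infty(0,\infty;\mathrm L^2(\Theta))$, have $\nabla_vh\in\mathrm L^2(0,\infty;\mathrm L^2(\Theta))$, and satisfy the energy identity $\frac{d}{dt}\|h(t)\|^2_{\mathrm L^2(\Theta)}=-2\xi\|\nabla_vh(t)\|^2_{\mathrm L^2(\Theta)}$. For a solution $h$, $\mathscr H_\tau(t)=\int_t^{t+\tau}\|h(s,\cdot,\cdot)\|^2_{\mathrm L^2(\Theta)}\,ds$. Let $T=\nabla_v\psi\cdot\nabla_x-\nabla_x\phi\cdot\nabla_v$, $\Pi h=\int_{\mathcal V}h(\cdot,\cdot,v)\,\gamma(dv)$, and $\mathrm H^1_{\mathrm{kin}}=\{h\in\mathrm L^2(\mathrm U_\tau\otimes\mu,\mathrm H^1(\gamma)):(\partial_t+T)h\in\mathrm L^2(\mathrm U_\tau\otimes\mu,\mathrm H^{-1}(\gamma))\}$. $K_{\mathrm{avg}}\in\mathbb R_+$ is a constant (which exists under hypotheses (1), (2), (4)) such that for all $h\in\mathrm H^1_{\mathrm{kin}}$ $$\|\nabla_{t,x}\Pi h\|^2_{\mathrm H^{-1}(\mathrm U_\tau\otimes\mu)}\le K_{\mathrm{avg}}\left(\|(\mathrm{Id}-\Pi)h\|^2_{\mathrm L^2(\mathrm U_\tau\otimes\Theta)}+\|(\partial_t+T)h\|^2_{\mathrm L^2(\mathrm U_\tau\otimes\mu,\mathrm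 H^{-1}(\gamma))}\right).$$
   Formalization: The time-averaged estimate is stated only for solutions with initial condition of average 0 (h_0 in L^2_0(Θ)), not for all solutions: the constant solution h = 1, or any solution of nonzero average, does not decay, so the estimate fails for it. *)

(* Defs.v *)
From HB Require Import structures.
From mathcomp Require Import all_boot all_order all_algebra.
From mathcomp Require Import all_classical all_reals all_analysis measurable_realfun.

Set Implicit Arguments.
Unset Strict Implicit.
Unset Printing Implicit Defensive.

Import Order.TTheory GRing.Theory Num.Theory.
Import numFieldTopology.Exports numFieldNormedType.Exports.

Local Open Scope classical_set_scope.
Local Open Scope ring_scope.

Definition rV_display : measure_display. Proof. exact: default_measure_display. Qed.

(* The sigma-algebra generated by the coordinates, i.e. the Borel one. *)
Section rV_measurable.
Context {R : realType} (n : nat).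

Let coor (i : 'I_n) (x : 'rV[R]_n) : R := x ord0 i.

Let rV0 : g_sigma_preimage coor set0. Proof. exact: sigma_algebra0. Qed.

Let rVC A : g_sigma_preimage coor A -> g_sigma_preimage coor (~` A).
Proof. exact: sigma_algebraC. Qed.

Let rV_bigcup (F : _^nat) : (forall i, g_sigma_preimage coor (F i)) ->
  g_sigma_preimage coor (\bigcup_i (F i)).
Proof. exact: sigma_algebra_bigcup. Qed.

HB.instance Definition _ := @isMeasurable.Build rV_display
  'rV[R]_n (g_sigma_preimage coor) rV0 rVC rV_bigcup.

Lemma measurable_coord (i : 'I_n) :
  measurable_fun [set: 'rV[R]_n] (fun x : 'rV[R]_n => x ord0 i).
Proof.
move=> _ Y mY; rewrite setTI; apply: sub_sigma_algebra => /=.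
rewrite -bigcup_seq/=; exists i => /=; first by rewrite mem_index_enum.
by exists Y => //; rewrite setTI.
Qed.

Lemma measurable_fun_rV d (T : measurableType d) (f : T -> 'rV[R]_n) :
  (forall i, measurable_fun [set: T] (fun x => f x ord0 i)) ->
  measurable_fun [set: T] f.
Proof.
move=> mf _ A mA; rewrite setTI.
suff : g_sigma_preimage coor `<=` [set A | measurable (f @^-1` A)] by exact.
apply: smallest_sub => [|B].
  split => /= [|B|F].
  - by rewrite preimage_set0; exact: measurable0.
  - by rewrite setTD preimage_setC; exact: measurableC.
  - by move=> mF; rewrite preimage_bigcup; exact: bigcup_measurable.
rewrite -bigcup_seq => -[i _ [C mC <-]] /=.
by rewrite setTI; have := mf i measurableT C mC; rewrite setTI.
Qed.

Lemma continuous_measurable_rV (f : 'rV[R]_n -> R) :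
  continuous f -> measurable_fun [set: 'rV[R]_n] f.
Proof.
move=> cf.
pose q (k : nat) (x : 'rV[R]_n) : 'rV[int]_n :=
  \row_i Num.floor (x ord0 i * k.+1%:R).
pose r (k : nat) (z : 'rV[int]_n) : 'rV[R]_n :=
  \row_i ((z ord0 i)%:~R / k.+1%:R).
apply: (@measurable_fun_cvg _ _ _ _ (fun k x => f (r k (q k x)))) => [k|x _].
  move=> _ B mB; rewrite setTI.
  have -> : (fun x => f (r k (q k x))) @^-1` B =
      \bigcup_z (if f (r k z) \in B then q k @^-1` [set z] else set0).
    apply/seteqP; split => [x/= Bx|x [z _ /=]].
      by exists (q k x) => //; rewrite mem_set.
    by case: ifPn => // /set_mem Bz; rewrite /= => ->.
  apply: countable_bigcupT_measurable => // z; case: ifPn => // _.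
  have -> : q k @^-1` [set z] = \bigcap_(i in [set: 'I_n])
      ((fun x : 'rV[R]_n => x ord0 i) @^-1`
         `[(z ord0 i)%:~R / k.+1%:R, (z ord0 i + 1)%:~R / k.+1%:R[%classic).
    apply/seteqP; split => [x/= <- i _ /=|x zx].
      by rewrite mxE in_itv/= ler_pdivrMr// ltr_pdivlMr// floor_itv.
    apply/rowP => i; rewrite mxE; apply: floor_def.
    by have := zx i I; rewrite /= in_itv/= ler_pdivrMr// ltr_pdivlMr.
  apply: fin_bigcap_measurable => // i _.
  by rewrite -[X in measurable X]setTI; exact: measurable_coord.
apply: continuous_cvg; first exact: cf.
apply/cvg_ballP => _/posnumP[e]; near=> k; split => // a i.
rewrite !mxE ord1 /ball/= ltr_norml.
have /andP[h1 h2] := floor_itv (x ord0 i * k.+1%:R).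
rewrite -(ler_pM2r (_ : 0 < k.+1%:R^-1)) ?mulfK ?gt_eqF ?invr_gt0 // in h1.
rewrite -(ltr_pM2r (_ : 0 < k.+1%:R^-1)) ?mulfK ?gt_eqF ?invr_gt0 // in h2.
have ke : k.+1%:R^-1 < e%:num by near: k; exact: near_infty_natSinv_lt.
rewrite intrD mulrDl mulr1z mul1r in h2.
apply/andP; split.
  by apply: (@lt_le_trans _ _ 0); rewrite ?oppr_lt0// subr_ge0.
by rewrite ltrBlDl (lt_trans h2)// ltrD2l.
Unshelve. all: by end_near. Qed.

End rV_measurable.

Section lebesgue_rV.
Context {R : realType}.

Definition rV_cons n (p : measurableTypeR R * 'rV[R]_n) : 'rV[R]_n.+1 :=
  row_mx (const_mx p.1 : 'rV_1) p.2.

Lemma rV_consl n (p : measurableTypeR R * 'rV[R]_n) (j : 'I_1) :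
  rV_cons p ord0 (lshift n j) = p.1.
Proof.
by apply: etrans (row_mxEl (const_mx p.1) p.2 ord0 j) _; rewrite mxE.
Qed.

Lemma rV_consr n (p : measurableTypeR R * 'rV[R]_n) (j : 'I_n) :
  rV_cons p ord0 (rshift 1 j) = p.2 ord0 j.
Proof. exact: row_mxEr. Qed.

Lemma measurable_rV_cons n : measurable_fun [set: measurableTypeR R * 'rV[R]_n] (@rV_cons n).
Proof.
apply: measurable_fun_rV => i; case: (splitP (i : 'I_(1 + n))) => j ij.
  rewrite (_ : (fun _ => _) = fst) //; apply/funext => x.
  have -> : i = lshift n j by apply/ord_inj.
  exact: rV_consl.
rewrite (_ : (fun _ => _) = (fun x : 'rV[R]_n => x ord0 j) \o snd).
  by apply: measurableT_comp => //; exact: measurable_coord.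
apply/funext => x /=.
have -> : i = rshift 1 j by apply/ord_inj.
exact: rV_consr.
Qed.

Lemma measurable_rV_uncons n : measurable_fun [set: 'rV[R]_n.+1]
  (fun x : 'rV[R]_n.+1 => (x ord0 ord0, \row_i x ord0 (lift ord0 i)) : measurableTypeR R * 'rV[R]_n).
Proof.
apply/measurable_fun_pairP; split; first exact: measurable_coord.
apply: measurable_fun_rV => i /=.
rewrite (_ : (fun _ => _) = (fun x : 'rV[R]_n.+1 => x ord0 (lift ord0 i))).
  exact: measurable_coord.
by apply/funext => x; rewrite /= mxE.
Qed.

Section step.
Context n (m : {sigma_finite_measure set 'rV[R]_n -> \bar R}).

Definition lebesgue_step : set 'rV[R]_n.+1 -> \bar R :=
  pushforward (lebesgue_measure \x m)%E (@rV_cons n).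

Let mpreim A : measurable A -> measurable (@rV_cons n @^-1` A).
Proof.
by move=> mA; rewrite -[X in measurable X]setTI; exact: measurable_rV_cons.
Qed.

Let step0 : lebesgue_step set0 = 0%E.
Proof. by rewrite /lebesgue_step /pushforward preimage_set0 measure0. Qed.

Let step_ge0 A : (0 <= lebesgue_step A)%E.
Proof. by rewrite /lebesgue_step /pushforward; exact: measure_ge0. Qed.

Let step_sigma_additive : semi_sigma_additive lebesgue_step.
Proof.
move=> F mF tF mUF; rewrite /lebesgue_step /pushforward preimage_bigcup.
apply: measure_semi_sigma_additive.
- by move=> k; exact: mpreim.
- apply/trivIsetP => /= i j _ _ ij; rewrite -preimage_setI.
  by move/trivIsetP : tF => /(_ _ _ _ _ ij) ->//; rewrite preimage_set0.
- by rewrite -preimage_bigcup; exact: mpreim.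
Qed.

HB.instance Definition _ := isMeasure.Build _ _ _ lebesgue_step
  step0 step_ge0 step_sigma_additive.

Let step_sigma_finite : sigma_finite setT lebesgue_step.
Proof.
have /sigma_finiteP[F [TF ndF Foo]] :=
  sigma_finiteT (lebesgue_measure : {sigma_finite_measure set (measurableTypeR R) -> \bar R}).
have /sigma_finiteP[G [TG ndG Goo]] := sigma_finiteT m.
pose g (x : 'rV[R]_n.+1) : measurableTypeR R * 'rV[R]_n :=
  (x ord0 ord0, \row_i x ord0 (lift ord0 i)).
have consK : cancel (@rV_cons n) g.
  move=> [t x]; congr pair.
    rewrite -[RHS](rV_consl (t, x) ord0) /=.
    by congr (rV_cons _ _ _); apply/ord_inj.
  apply/rowP => i; rewrite mxE.
  rewrite -[RHS](rV_consr (t, x) i) /=.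
  by congr (rV_cons _ _ _); apply/ord_inj.
exists (fun k => g @^-1` (F k `*` G k)).
  rewrite -preimage_bigcup -[LHS](preimage_setT g); congr (_ @^-1` _).
  rewrite -setXTT TF TG predeqE => -[x y]; split.
    move=> [/= [i _ Fix] [k _ Gky]]; exists (maxn i k) => //; split.
    - by move: x Fix; exact/subsetPset/ndF/leq_maxl.
    - by move: y Gky; exact/subsetPset/ndG/leq_maxr.
  by move=> [i _ []/= ? ?]; split; exists i.
move=> k; have [mF Fk] := Foo k; have [mG Gk] := Goo k; split.
  rewrite -[X in measurable X]setTI; apply: measurable_rV_uncons => //.
  exact: measurableX.
rewrite /lebesgue_step /pushforward -comp_preimage.
rewrite (_ : g \o _ = id); last by apply/funext => x; exact: consK.
by rewrite preimage_id product_measure1E// lte_mul_pinfty// ge0_fin_numE.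
Qed.

HB.instance Definition _ := Measure_isSigmaFinite.Build _ _ _ lebesgue_step
  step_sigma_finite.

End step.

(* Lebesgue measure on R^n, by R^(n+1) = R x R^n *)
Fixpoint lebesgue_rV n : {sigma_finite_measure set 'rV[R]_n -> \bar R} :=
  match n with
  | 0 => (\d_(0 : 'rV[R]_0) : {sigma_finite_measure set 'rV[R]_0 -> \bar R})
  | n'.+1 => lebesgue_step (lebesgue_rV n')
  end.

End lebesgue_rV.

Section calculus.
Context {R : realType}.

Fixpoint Ck (E : normedModType R) (k : nat) (f : E -> R) : Prop :=
  match k with
  | 0 => continuous f
  | k'.+1 => (forall x, differentiable f x) /\ forall v, Ck k' ('D_v f)
  end.

Definition smooth (E : normedModType R) (f : E -> R) := forall k, Ck k f.

Context {d : nat}.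
Implicit Types x y : 'rV[R]_d.

Definition e_ (i : 'I_d) : 'rV[R]_d := delta_mx ord0 i.

Definition dot x y : R := \sum_i x ord0 i * y ord0 i.

(* the norm of the library on ['rV_d] is the sup norm *)
Definition enorm x : R := Num.sqrt (dot x x).

Definition grad (f : 'rV[R]_d -> R) x : 'rV[R]_d := \row_i 'D_(e_ i) f x.

Definition hess (f : 'rV[R]_d -> R) x : 'M[R]_d :=
  \matrix_(i, j) 'D_(e_ j) ('D_(e_ i) f) x.

Definition frobenius (A : 'M[R]_d) : R :=
  Num.sqrt (\sum_i \sum_j A i j ^+ 2).

End calculus.

(* [Euclidean] is R^d and [Torus L] is (L T)^d. A function on the torus is an
   [L]-periodic function on R^d, or, when only its almost everywhere class
   matters, its restriction to the fundamental cell [0, L[^d. *)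
Variant geometry (R : realType) := Euclidean | Torus of {posnum R}.
Arguments Euclidean {R}.

Section spaces.
Context {R : realType} {d : nat}.
Implicit Type S : geometry R.

Definition cell S : set 'rV[R]_d :=
  match S with
  | Euclidean => setT
  | Torus L => [set x | forall i, 0 <= x ord0 i < L%:num]
  end.

Definition periodic S (f : 'rV[R]_d -> R) : Prop :=
  match S with
  | Euclidean => True
  | Torus L => forall x i, f (x + L%:num *: e_ i) = f x
  end.

Record potential S := Potential {
  pot :> 'rV[R]_d -> R;
  pot_smooth : smooth pot;
  pot_periodic : periodic S pot;
  pot_mass : (\int[lebesgue_rV d]_(x in cell S) (expR (- pot x))%:E = 1)%E
}.

Lemma measurable_cell S : measurable (cell S).
Proof.
case: S => [|L]; first exact: measurableT.
have -> : cell (Torus L) = \bigcap_(i in [set: 'I_d])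
    ((fun x : 'rV[R]_d => x ord0 i) @^-1` `[0, L%:num[%classic).
  apply/seteqP; split => [x cx i _|x cx i]; first by rewrite /= in_itv/= cx.
  by have := cx i I; rewrite /= in_itv.
apply: fin_bigcap_measurable => // i _.
by rewrite -[X in measurable X]setTI; exact: measurable_coord.
Qed.

(* mu(dx) = e^(- phi(x)) dx *)
Section gibbs.
Context {S : geometry R} (phi : potential S).

Definition gibbs : set 'rV[R]_d -> \bar R := fun A =>
  (\int[lebesgue_rV d]_(x in A `&` cell S) (expR (- phi x))%:E)%E.

Let measurable_weight : measurable_fun [set: 'rV[R]_d]
  (fun x => (expR (- phi x))%:E).
Proof.
apply/measurable_EFinP; apply: measurableT_comp => //.
apply: measurableT_comp => //.
exact: continuous_measurable_rV (@pot_smooth _ phi 0%N).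
Qed.

Let gibbs0 : gibbs set0 = 0%E.
Proof. by rewrite /gibbs set0I integral_set0. Qed.

Let gibbs_ge0 A : (0 <= gibbs A)%E.
Proof. by apply: integral_ge0 => x _; rewrite lee_fin expR_ge0. Qed.

Let gibbs_sigma_additive : semi_sigma_additive gibbs.
Proof.
move=> /= F mF tF mUF; rewrite /gibbs; apply: cvg_toP.
  apply: ereal_nondecreasing_is_cvgn => m n mn.
  apply: lee_sum_nneg_natr => // k _ _.
  by apply: integral_ge0 => x _; rewrite lee_fin expR_ge0.
rewrite setI_bigcupl ge0_integral_bigcup//=.
- by move=> k; apply: measurableI => //; exact: measurable_cell.
- by apply: measurable_funTS; exact: measurable_weight.
- by apply: trivIset_setIr.
Qed.

HB.instance Definition _ := isMeasure.Build _ _ _ gibbs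
  gibbs0 gibbs_ge0 gibbs_sigma_additive.

Let gibbs_setT : gibbs setT = 1%E.
Proof. by rewrite /gibbs setTI; exact: pot_mass. Qed.

HB.instance Definition _ := Measure_isProbability.Build _ _ R gibbs gibbs_setT.

End gibbs.
End spaces.
Arguments potential {R} d S.

Section L2.
Context {R : realType} {disp} {T : measurableType disp}.
Context (m : {measure set T -> \bar R}).

Definition L2norm (f : T -> R) : \bar R := Lnorm m 2%:E (EFin \o f).

Definition L2normv n (F : T -> 'rV[R]_n) : \bar R := L2norm (enorm \o F).

Definition L2v n (F : T -> 'rV[R]_n) : Prop :=
  forall i, (fun z => F z ord0 i) \in Lfun m 2%:E.

(* H^1 built over L^2(m) and a weak derivative relation [W u G], read "G is the
   distributional gradient of u". The gradient is unique up to null sets and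
   [wgrad] picks a representative. *)
Section H1.
Context {n : nat} (W : (T -> R) -> (T -> 'rV[R]_n) -> Prop).

Definition is_wgrad (u : T -> R) (G : T -> 'rV[R]_n) : Prop :=
  [/\ u \in Lfun m 2%:E, L2v G & W u G].

Definition H1 (u : T -> R) : Prop := exists G, is_wgrad u G.

Definition wgrad (u : T -> R) : T -> 'rV[R]_n :=
  xget (fun=> 0) [set G | is_wgrad u G].

Definition H1norm (u : T -> R) : \bar R :=
  sqrte (L2norm u ^+ 2 + L2normv (wgrad u) ^+ 2)%E.

Definition H1dual (F : (T -> R) -> R) : Prop :=
  (forall a u w, H1 u -> H1 w -> F (fun x => a * u x + w x) = a * F u + F w) /\
  exists C : R, forall u, H1 u -> (`|F u|%:E <= C%:E * H1norm u)%E.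

Definition H1dual_norm (F : (T -> R) -> R) : \bar R :=
  ereal_sup [set `|F u|%:E | u in [set u | H1 u /\ (H1norm u <= 1)%E]].

End H1.
End L2.

Section space_sobolev.
Context {R : realType} {d : nat}.

(* C_c^infty(S); on the torus there is no support condition, the cell being
   bounded. *)
Definition test (S : geometry R) (theta : 'rV[R]_d -> R) : Prop :=
  [/\ smooth theta, periodic S theta &
      exists M : R, forall x, cell S x -> M < enorm x -> theta x = 0].

Definition weak_grad (S : geometry R) (u : 'rV[R]_d -> R)
    (G : 'rV[R]_d -> 'rV[R]_d) : Prop :=
  forall theta, test S theta -> forall i,
    \int[lebesgue_rV d]_(x in cell S) (u x * grad theta x ord0 i) =
    - (\int[lebesgue_rV d]_(x in cell S) (G x ord0 i * theta x)).

Context {S : geometry R} (phi : potential d S).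

Definition H1x := H1 (gibbs phi) (weak_grad S).
Definition wgradx := wgrad (gibbs phi) (weak_grad S).
Definition H1normx := H1norm (gibbs phi) (weak_grad S).

Definition poincare (c : R) : Prop :=
  forall g, H1x g -> \int[gibbs phi]_x g x = 0 ->
    (L2norm (gibbs phi) g <=
     (c `^ (- 2^-1))%:E * L2normv (gibbs phi) (wgradx g))%E.

Definition drift_bound (L : R) : Prop :=
  forall z, H1x z ->
    (L2norm (gibbs phi) (fun x => (z x * enorm (grad phi x))%R) <=
     L%:E * H1normx z)%E.

(* The inverse is taken in [\bar R], where 0^-1 = +oo. *)
Definition velocity_assumption : Prop :=
  [/\ ((\int[gibbs phi]_v (enorm (grad phi v) ^+ 4)%:E) +
       (\int[gibbs phi]_v (frobenius (hess phi v) ^+ 2)%:E) < +oo)%E,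
      limf_esup (fun r : R => \int[gibbs phi]_(v in [set v | (r <= enorm v)%R])
         ((enorm (grad phi v))%:E^-1 ^+ 2))%E +oo%R = 0%E &
      forall w : 'rV[R]_d, w != 0 ->
        let M := \matrix_(i, j)
          \int[gibbs phi]_v (grad phi v ord0 i * grad phi v ord0 j) in
        0 < (w *m M *m w^T) ord0 ord0].

End space_sobolev.

Section time_space.
Context {R : realType} {d : nat} {tau : R} (htau : 0 < tau).
Context {S : geometry R} (phi : potential d S).

(* U_tau (x) mu; U_tau is the uniform law on [0, tau] *)
Definition Umu : probability (measurableTypeR R * 'rV[R]_d)%type R :=
  (uniform_prob htau \x gibbs phi)%E.

(* index 0 is time, the d others are space *)
Definition tx_dir (k : 'I_(1 + d)) : R * 'rV[R]_d :=
  match fintype.split k with inl _ => (1, 0) | inr i => (0, e_ i) end.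

Definition test_tx (theta : R * 'rV[R]_d -> R) : Prop :=
  [/\ smooth theta, forall t, periodic S (fun x => theta (t, x)),
      exists2 eps : R, 0 < eps &
        forall t x, (t < eps) || (tau - eps < t) -> theta (t, x) = 0 &
      exists M : R, forall t x, cell S x -> M < enorm x -> theta (t, x) = 0].

Definition weak_grad_tx (u : R * 'rV[R]_d -> R)
    (G : R * 'rV[R]_d -> 'rV[R]_(1 + d)) : Prop :=
  forall theta, test_tx theta -> forall k,
    \int[(lebesgue_measure \x lebesgue_rV d)%E]_(z in `]0, tau[ `*` cell S)
      (u z * 'D_(tx_dir k) theta z) =
    - (\int[(lebesgue_measure \x lebesgue_rV d)%E]_(z in `]0, tau[ `*` cell S)
      (G z ord0 k * theta z)).

Definition H1tx := H1 Umu weak_grad_tx.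
Definition wgrad_tx := wgrad Umu weak_grad_tx.
Definition H1norm_tx := H1norm Umu weak_grad_tx.

(* The traces are those of the representative in C([0, tau]; L^2(mu)). *)
Definition H1DC (z : R * 'rV[R]_d -> R) : Prop :=
  H1tx z /\ exists y : R * 'rV[R]_d -> R,
    [/\ {ae Umu, forall p, y p = z p},
        forall t, 0 <= t <= tau -> (fun x => y (t, x)) \in Lfun (gibbs phi) 2%:E,
        forall s, 0 <= s <= tau ->
          L2norm (gibbs phi) (fun x => y (t, x) - y (s, x))
            @[t --> within `[0, tau] (nbhs s)] --> 0%E,
        {ae gibbs phi, forall x, y (0, x) = 0} &
        {ae gibbs phi, forall x, y (tau, x) = 0}].

(* dual norm on ((H^1_DC)^(d+1))' *)
Definition Hm1norm_tx (F : (R * 'rV[R]_d -> 'rV[R]_(1 + d)) -> R) : \bar R :=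
  ereal_sup [set `|F Z|%:E | Z in [set Z : R * 'rV[R]_d -> 'rV[R]_(1 + d) |
    (forall k, H1DC (fun p => Z p ord0 k)) /\
    (\sum_k H1norm_tx (fun p => Z p ord0 k) ^+ 2 <= 1)%E]].

(* nabla_{t,x} g as a functional, through the adjoint in L^2(U_tau (x) mu):
   d_t^* z = - d_t z and d_{x_i}^* z = - d_{x_i} z + (d_i phi) z. *)
Definition grad_tx (g : R * 'rV[R]_d -> R)
    (Z : R * 'rV[R]_d -> 'rV[R]_(1 + d)) : R :=
  \int[Umu]_p (g p * (dot (grad phi p.2) (rsubmx (Z p)) -
                      \sum_k wgrad_tx (fun q => Z q ord0 k) p ord0 k)).

Definition lions (C : R) : Prop :=
  forall g : R * 'rV[R]_d -> R, g \in Lfun Umu 2%:E ->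
    (L2norm Umu (fun p => (g p - (\int[Umu]_q g q))%R) ^+ 2 <=
     C%:E * Hm1norm_tx (grad_tx g) ^+ 2)%E.

End time_space.

Section lie.
Context {R : realType} {d : nat}.
Let phase := ('rV[R]_d * 'rV[R]_d)%type.

Definition lie_bracket (A B : phase -> phase) (z : phase) : phase :=
  'D_(A z) B z - 'D_(B z) A z.

Inductive lie_algebra (gen : set (phase -> phase)) : (phase -> phase) -> Prop :=
| lie_gen A : gen A -> lie_algebra gen A
| lie_lin a A B : lie_algebra gen A -> lie_algebra gen B ->
    lie_algebra gen (fun z => a *: A z + B z)
| lie_brk A B : lie_algebra gen A -> lie_algebra gen B ->
    lie_algebra gen (lie_bracket A B).

(* The evaluations at [z] span a space of dimension 2d, the dimension of the
   whole tangent space. *)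
Definition hormander (phi psi : 'rV[R]_d -> R) : Prop :=
  let gen := [set A : phase -> phase |
    (exists i, A = fun=> (0, e_ i)) \/
    A = fun z => (grad psi z.2, - grad phi z.1)] in
  forall z, exists A : 'I_(d + d) -> phase -> phase,
    (forall k, lie_algebra gen (A k)) /\
    \rank (\matrix_k row_mx (A k z).1 (A k z).2) = (d + d)%N.

End lie.

Section kinetic.
Context {R : realType} {d : nat} {SX SV : geometry R}.
Context (phi : potential d SX) (psi : potential d SV).
Implicit Types h theta : R * ('rV[R]_d * 'rV[R]_d) -> R.

Definition gibbsXV : probability ('rV[R]_d * 'rV[R]_d)%type R :=
  (gibbs phi \x gibbs psi)%E.

Definition slice U (f : R * ('rV[R]_d * 'rV[R]_d) -> U) (p : R * 'rV[R]_d) :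
  'rV[R]_d -> U := fun v => f (p.1, (p.2, v)).

Definition grad_x theta z : 'rV[R]_d := \row_i 'D_(0, (e_ i, 0)) theta z.
Definition grad_v theta z : 'rV[R]_d := \row_i 'D_(0, (0, e_ i)) theta z.

(* (d_t + T) theta *)
Definition transport theta z : R :=
  'D_(1, (0, 0)) theta z + dot (grad psi z.2.2) (grad_x theta z)
  - dot (grad phi z.2.1) (grad_v theta z).

Definition test_txv theta : Prop :=
  [/\ smooth theta,
      forall t v, periodic SX (fun x => theta (t, (x, v))),
      forall t x, periodic SV (fun v => theta (t, (x, v))) &
      exists M : R, forall t x v, cell SX x -> cell SV v ->
        [|| M < `|t|, M < enorm x | M < enorm v] -> theta (t, (x, v)) = 0].

Definition avg h (p : R * 'rV[R]_d) : R := \int[gibbs psi]_v slice h p v.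

Section averaging.
Context {tau : R} (htau : 0 < tau).

Definition UgibbsXV : probability
    (measurableTypeR R * ('rV[R]_d * 'rV[R]_d))%type R :=
  (uniform_prob htau \x gibbsXV)%E.

(* h \in L^2(U_tau (x) mu, H^1(gamma)) *)
Definition L2H1 h : Prop :=
  h \in Lfun UgibbsXV 2%:E /\
  exists2 G : R * ('rV[R]_d * 'rV[R]_d) -> 'rV[R]_d, L2v UgibbsXV G &
    {ae Umu htau phi, forall p,
      is_wgrad (gibbs psi) (weak_grad SV) (slice h p) (slice G p)}.

(* [F] is an element of L^2(U_tau (x) mu, H^{-1}(gamma)); since H^1(gamma) is
   separable, weak and strong measurability coincide. *)
Definition L2Hm1_sqnorm (F : R * 'rV[R]_d -> ('rV[R]_d -> R) -> R) : \bar R :=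
  (\int[Umu htau phi]_p
     H1dual_norm (gibbs psi) (weak_grad SV) (F p) ^+ 2)%E.

Definition L2Hm1 (F : R * 'rV[R]_d -> ('rV[R]_d -> R) -> R) : Prop :=
  [/\ {ae Umu htau phi, forall p, H1dual (gibbs psi) (weak_grad SV) (F p)},
      forall u, H1x psi u ->
        measurable_fun [set: measurableTypeR R * 'rV[R]_d] (fun p => F p u) &
      (L2Hm1_sqnorm F < +oo)%E].

(* (d_t + T) h = F as distributions on (0, tau) x X x V. The test functions are
   paired in L^2(U_tau (x) mu (x) gamma), in which T is antisymmetric. *)
Definition transport_eq h
    (F : R * 'rV[R]_d -> ('rV[R]_d -> R) -> R) : Prop :=
  forall theta, test_txv theta ->
    (exists2 eps : R, 0 < eps &
       forall t y, (t < eps) || (tau - eps < t) -> theta (t, y) = 0) ->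
    - (\int[UgibbsXV]_z (h z * transport theta z)) =
    \int[Umu htau phi]_p (F p (slice theta p)).

(* h \in H^1_kin, with F = (d_t + T) h *)
Definition H1kin h (F : R * 'rV[R]_d -> ('rV[R]_d -> R) -> R) : Prop :=
  [/\ L2H1 h, L2Hm1 F & transport_eq h F].

Definition averaging (K : R) : Prop :=
  forall h F, H1kin h F ->
    (Hm1norm_tx htau phi (grad_tx htau phi (avg h)) ^+ 2 <=
     K%:E * (L2norm UgibbsXV (fun z => (h z - avg h (z.1, z.2.1))%R) ^+ 2 +
             L2Hm1_sqnorm F))%E.

End averaging.

Section VOU.
Context (xi : R).

Definition at_ h (t : R) : 'rV[R]_d * 'rV[R]_d -> R := fun y => h (t, y).

(* [vou_weak] is the distributional form of
     (d_t + T) h = - xi nabla_v^* nabla_v h,   h(0, .) = h0,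
   tested in L^2(mu (x) gamma); [G] is the velocity gradient of [h], which is a
   representative defined at every time t >= 0, for which the energy
   identity holds in integrated form. *)
Record VOU_with (h0 : 'rV[R]_d * 'rV[R]_d -> R) h
    (G : R * ('rV[R]_d * 'rV[R]_d) -> 'rV[R]_d) : Prop := {
  vou_measurable : measurable_fun
    [set: measurableTypeR R * ('rV[R]_d * 'rV[R]_d)] h;
  vou_bounded : exists M : R, forall t, 0 <= t ->
    (L2norm gibbsXV (at_ h t) <= M%:E)%E;
  vou_grad_measurable : forall i, measurable_fun
    [set: measurableTypeR R * ('rV[R]_d * 'rV[R]_d)] (fun z => G z ord0 i);
  vou_grad : {ae (lebesgue_measure \x gibbs phi)%E, forall p, 0 <= p.1 ->
    is_wgrad (gibbs psi) (weak_grad SV) (slice h p) (slice G p)};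
  vou_grad_L2 : (\int[lebesgue_measure \x gibbsXV]_(z in `[0%R, +oo[ `*` setT)
    (enorm (G z) ^+ 2)%:E < +oo)%E;
  vou_weak : forall theta, test_txv theta ->
    (\int[(lebesgue_measure \x gibbsXV)%E]_(z in `[0%R, +oo[ `*` setT)
      (h z * transport theta z - xi * dot (G z) (grad_v theta z))) +
    (\int[gibbsXV]_y (h0 y * theta (0, y))) = 0;
  vou_initial : {ae gibbsXV, forall y, h (0, y) = h0 y};
  vou_energy : forall s t, 0 <= s -> s <= t ->
    (L2norm gibbsXV (at_ h t) ^+ 2 +
     (2 * xi)%:E * \int[lebesgue_measure]_(r in `[s, t])
       L2normv gibbsXV (fun y => G (r, y)) ^+ 2 =
     L2norm gibbsXV (at_ h s) ^+ 2)%E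
}.

Definition VOU_solution (h0 : 'rV[R]_d * 'rV[R]_d -> R) h : Prop := exists G, VOU_with h0 h G.

Definition Hcal (tau : R) h (t : R) : \bar R :=
  (\int[lebesgue_measure]_(s in `[t, (t + tau)%R]) L2norm gibbsXV (at_ h s) ^+ 2)%E.

End VOU.
End kinetic.

(* Main.v *)
Require Import Defs.
From HB Require Import structures.
From mathcomp Require Import all_boot all_order all_algebra.
From mathcomp Require Import all_classical all_reals all_analysis measurable_realfun.
From mathcomp Require Import ring lra.

Set Implicit Arguments.
Unset Strict Implicit.
Unset Printing Implicit Defensive.

Import Order.TTheory GRing.Theory Num.Theory.
Import numFieldTopology.Exports numFieldNormedType.Exports.

Local Open Scope classical_set_scope.
Local Open Scope ring_scope.

(* Write N(t) = |h(t)|^2 in L^2(Theta) and H(t) for its integral over [t, t + tau].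
   On the window [t, t + tau], h splits orthogonally into (Id - Pi) h, which the
   Poincare inequality in velocity bounds by nabla_v h, and Pi h. Testing (VOU)
   with cutoffs of the constant function shows that Pi h has average zero (mass
   conservation), so the Lions inequality followed by the averaging inequality
   bounds it by (Id - Pi) h and by (d_t + T) h = - xi nabla_v^* nabla_v h, whose
   H^-1(gamma) norm is at most xi |nabla_v h|. With the energy identity this gives
     2 lambda H(t) <= N(t) - N(t + tau)
   for lambda = lambda_bar. Integrated over [t, t + d], it becomes
   H(t + d) (1 + 2 lambda d) <= H(t), hence H decays like e^(- 2 lambda t), and the
   pointwise bound follows from tau N(t) <= H(t - tau), N being nonincreasing. *)

(** Origin of the constant: with [g = |nabla_v h|^2], [A = |(Id - Pi) h|^2] and [B = |Pi h|^2], one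
    has [A <= g / c_psi] and [B <= C K (A + xi^2 g)], so [A + B <= (1 + C K) (1 / c_psi + xi^2) g].
    The energy identity contributes [2 xi g], and the quotient of the two factors is [2 lambda_bar].
    Most of the work lies in meeting the definitions. Weak gradients are representatives taken by
    choice, so their uniqueness almost everywhere is derived from test functions, and functions of
    [(t, x)] built from them are integrated without measurability. Test functions are needed on R^d
    and on the torus alike; they are made from [exp (- 1 / y)] and from the sine. Since a constant
    is not admissible in the weak equation, mass conservation is a limit along cutoffs whose error
    terms are controlled by [nabla phi] and [nabla psi] in L^2; these bounds come from the drift
    bound at [z = 1] and from the fourth moment. Finally, the Lions and averaging inequalities live
    on [[0, tau]], so every window is translated there together with the weak equation. *)

(** * Stability of [Ck] under algebra, composition and antiderivatives *)

Section smoothness.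
Context {R : realType}.
Implicit Types E F : normedModType R.

Lemma Ck_weaken E k (f : E -> R) : Ck k.+1 f -> Ck k f.
Proof.
elim: k f => [|k IH] f [df Df]; first by move=> x; exact: differentiable_continuous.
by split => // v; apply: IH; exact: Df.
Qed.

Lemma Ck_cst E k (c : R) : Ck k (fun _ : E => c).
Proof.
elim: k c => [|k IH] c; first by move=> x; exact: cvg_cst.
split=> [x|v]; first exact: differentiable_cst.
rewrite (_ : 'D_v _ = fun=> 0); first exact: IH.
by apply/funext => x; rewrite derive_cst.
Qed.

Lemma CkD E k (f g : E -> R) : Ck k f -> Ck k g -> Ck k (fun x => f x + g x).
Proof.
elim: k f g => [|k IH] f g.
  by move=> cf cg x; apply: cvgD; [exact: cf|exact: cg].
move=> [df Df] [dg Dg]; split=> [x|v]; first by apply: differentiableD.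
rewrite (_ : 'D_v _ = fun x => 'D_v f x + 'D_v g x).
  by apply: IH; [exact: Df|exact: Dg].
by apply/funext => x; apply: deriveD; exact: diff_derivable.
Qed.

Lemma CkM E k (f g : E -> R) : Ck k f -> Ck k g -> Ck k (fun x => f x * g x).
Proof.
elim: k f g => [|k IH] f g.
  by move=> cf cg x; apply: cvgM; [exact: cf|exact: cg].
move=> hf hg; have [df Df] := hf; have [dg Dg] := hg.
split=> [x|v]; first by apply: differentiableM.
rewrite (_ : 'D_v _ = fun x => f x * 'D_v g x + g x * 'D_v f x).
  by apply: CkD; apply: IH; [exact: Ck_weaken|exact: Dg|exact: Ck_weaken|exact: Df].
by apply/funext => x; rewrite deriveM; [|exact: diff_derivable..].
Qed.

Lemma CkN E k (f : E -> R) : Ck k f -> Ck k (fun x => - f x).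
Proof.
move=> hf; rewrite (_ : (fun _ => _) = fun x => (-1) * f x).
  by apply: CkM => //; exact: Ck_cst.
by apply/funext => x; rewrite mulN1r.
Qed.

Lemma Ck_prod E k (I : Type) (r : seq I) (f : I -> E -> R) :
  (forall i, Ck k (f i)) -> Ck k (fun x => \prod_(i <- r) f i x).
Proof.
move=> hf; elim: r => [|i r IH].
  rewrite (_ : (fun _ => _) = fun=> 1); first exact: Ck_cst.
  by apply/funext => x; rewrite big_nil.
rewrite (_ : (fun _ => _) = fun x => f i x * \prod_(j <- r) f j x).
  exact: CkM.
by apply/funext => x; rewrite big_cons.
Qed.

Lemma derive_comp_R E (g : R -> R) (f : E -> R) x v :
  differentiable f x -> differentiable g (f x) ->
  'D_v (g \o f) x = 'D_1 g (f x) * 'D_v f x.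
Proof.
move=> df dg; rewrite !deriveE//; last exact: differentiable_comp.
rewrite diff_comp//= -[in LHS](mulr1 ('d f x v)) -['d f x v * 1]/('d f x v *: (1 : R)).
by rewrite linearZ /= mulrC.
Qed.

Lemma Ck_comp E k (g : R -> R) (f : E -> R) : Ck k g -> Ck k f -> Ck k (g \o f).
Proof.
elim: k g f => [|k IH] g f.
  by move=> cg cf x; apply: continuous_comp; [exact: cf|exact: cg].
move=> [dg Dg] hf; have [df Df] := hf.
split=> [x|v]; first exact: differentiable_comp.
rewrite (_ : 'D_v _ = fun x => ('D_1 g \o f) x * 'D_v f x).
  by apply: CkM; [apply: IH; [exact: Dg|exact: Ck_weaken]|exact: Df].
by apply/funext => x; exact: derive_comp_R.
Qed.

Lemma derive_precomp E F (A L : E -> F) (f : F -> R) x v :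
  is_diff x A L -> differentiable f (A x) ->
  'D_v (f \o A) x = 'D_(L v) f (A x).
Proof.
move=> [dA dAL] df; rewrite !deriveE//; last exact: differentiable_comp.
by rewrite diff_comp//= dAL.
Qed.

(** [L] does not depend on [x], so ['D_v (f \o A)] is again of the form [g \o A], with
    [g = 'D_(L v) f], and the induction closes. It covers affine maps: coordinates, slices,
    translations, dilations. *)
Lemma Ck_precomp E F k (A L : E -> F) (f : F -> R) :
  (forall x, is_diff x A L) -> Ck k f -> Ck k (f \o A).
Proof.
move=> dA; elim: k f => [|k IH] f.
  move=> cf x; apply: continuous_comp; last exact: cf.
  by apply: differentiable_continuous; have [] := dA x.
move=> [df Df]; split=> [x|v].
  by apply: differentiable_comp => //; have [] := dA x.
rewrite (_ : 'D_v _ = 'D_(L v) f \o A); first by apply: IH; exact: Df.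
by apply/funext => x; exact: derive_precomp.
Qed.

Lemma is_diff_coord d (i : 'I_d) (x : 'rV[R]_d) :
  is_diff x (fun x => x ord0 i) (fun x => x ord0 i).
Proof.
have dc : differentiable (fun x : 'rV[R]_d => x ord0 i) x.
  exact: differentiable_coord.
apply: DiffDef => //.
have lin : linear (fun x : 'rV[R]_d => x ord0 i) by move=> a u w; rewrite !mxE.
pose lc := GRing.isLinear.Build _ _ _ _ _ lin.
pose f : {linear 'rV[R]_d -> R} := HB.pack (fun x : 'rV[R]_d => x ord0 i) lc.
apply/funext => v; rewrite -[fun x : 'rV[R]_d => x ord0 i]/(f : _ -> _).
rewrite diff_lin//; exact: coord_continuous.
Qed.

(** Reduces the smoothness of [sin], [cos], [expR] and [flatk] to a relation between each function
    and its derivative, by induction on [k]. The derivative in direction [v] is [v] times the one in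
    direction 1. *)
Lemma Ck_antiderivative k (f g : R -> R) :
  (forall y, is_derive y (1 : R) f (g y)) -> Ck k g -> Ck k.+1 f.
Proof.
move=> fg Cg.
have df y : differentiable f y by apply/derivable1_diffP; have [] := fg y.
split=> // v; rewrite (_ : 'D_v _ = fun y => v * g y).
  by apply: CkM => //; exact: Ck_cst.
apply/funext => y; have dy := fg y.
rewrite deriveE// -[v in LHS]mulr1 -[v * 1]/(v *: (1 : R)) linearZ /= -deriveE//.
by rewrite derive_val.
Qed.

Lemma smooth_continuous E (f : E -> R) : smooth f -> continuous f.
Proof. by move=> /(_ 0%N). Qed.

Lemma smooth_differentiable E (f : E -> R) x : smooth f -> differentiable f x.
Proof. by move=> /(_ 1%N)[]. Qed.

Lemma smooth_derive E (f : E -> R) v : smooth f -> smooth ('D_v f).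
Proof. by move=> sf k; have [_ /(_ v)] := sf k.+1. Qed.

End smoothness.

(** * The flat function [exp (- 1 / y)] *)

Section flat_function.
Context {R : realType}.

(* The family is stable under derivation, and a member with [k = 0] tends to 1
   at infinity. *)
Definition flatk (k : nat) (y : R) : R := if 0 < y then y^-1 ^+ k * expR (- y^-1) else 0.

(** The term of order [k + 2] of the exponential series at [1 / y] bounds [expR (1 / y)] from below.
    The quadratic bound makes the difference quotient at 0 vanish. *)
Lemma flatk_le k (y : R) : `|flatk k y| <= (k.+2)`!%:R * y ^+ 2.
Proof.
rewrite /flatk; case: ifPn => [y0|_]; last first.
  by rewrite normr0 mulr_ge0// sqr_ge0.
rewrite ger0_norm; last by rewrite mulr_ge0 ?expR_ge0// exprn_ge0// invr_ge0 ltW.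
have y'0 : 0 <= y^-1 by rewrite invr_ge0 ltW.
have h := @expR_ge1Dxn R (y^-1) k.+1 y'0.
have {}h : y^-1 ^+ k.+2 / (k.+2)`!%:R <= expR y^-1 by rewrite (le_trans _ h)// lerDr.
rewrite expRN ler_pdivrMr ?expR_gt0//.
rewrite ler_pdivrMr ?ltr0n ?fact_gt0// in h.
rewrite -mulrA mulrC -mulrA.
have -> : y^-1 ^+ k = y ^+ 2 * y^-1 ^+ k.+2.
  by rewrite -[k.+2]addn2 exprD mulrCA -exprMn mulfV ?gt_eqF// expr1n mulr1.
by rewrite ler_wpM2l// sqr_ge0.
Qed.

(** For [y > 0] this is the product rule, for [y < 0] everything is locally 0, and at 0 both sides
    vanish by [flatk_le]. *)
Lemma is_derive_flatk k (y : R) :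
  is_derive y (1 : R) (flatk k) (- k%:R * flatk k.+1 y + flatk k.+2 y).
Proof.
have [y0|y0|->] := ltgtP y 0.
- have -> : - k%:R * flatk k.+1 y + flatk k.+2 y = 0.
    by rewrite /flatk ltNge (ltW y0) /= mulr0 addr0.
  apply: (@near_eq_is_derive _ _ _ (cst 0)); rewrite ?oner_eq0//.
  near=> z; rewrite /flatk ltNge (_ : z <= 0)//= ltW//.
  by near: z; exact: lt_nbhsl.
- pose f (z : R) := z^-1 ^+ k * expR (- z^-1).
  apply: (@near_eq_is_derive _ _ _ f); rewrite ?oner_eq0//.
    near=> z; rewrite /flatk (_ : 0 < z)//.
    by near: z; exact: lt_nbhsr.
  have y0' : y != 0 by rewrite gt_eqF.
  have dinv : is_derive y (1 : R) (fun z : R => z^-1) (- y ^- 2).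
    apply: DeriveDef; first by apply: derivableV => //; exact: derivable_id.
    by rewrite deriveV// derive_id -[LHS]/(_ * _) mulr1.
  rewrite /flatk y0.
  have dexp : is_derive y (1 : R) (fun z : R => expR (- z^-1)) (expR (- y^-1) * y ^- 2).
    have dN : is_derive y (1 : R) (fun z : R => - z^-1) (- - y ^- 2) by exact: is_deriveN.
    rewrite -[y ^- 2]opprK.
    exact: (@is_derive1_comp _ expR (fun z : R => - z^-1) _ _ _ (is_derive_expR _) dN).
  have dpow : is_derive y (1 : R) (fun z : R => z^-1 ^+ k) (- k%:R * y^-1 ^+ k.+1).
    have dX := is_deriveX k dinv.
    rewrite exprfctE in dX; apply: (is_derive_eq dX).
    case: (k) => [|j] /=; first by rewrite oppr0 !mul0r scale0r.
    by rewrite -[LHS]/(_ * _) mulrN mulNr -exprVn -mulrA -exprD addn2.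
  have dM := is_deriveM dpow dexp; apply: (is_derive_eq dM).
  rewrite -!exprVn -![_ *: _]/(_ * _) !exprS; ring.
- have f0 : forall j, flatk j 0 = 0 by move=> j; rewrite /flatk ltxx.
  rewrite !f0 mulr0 addr0.
  have cv : (fun h : R => h^-1 *: ((flatk k \o shift 0) (h *: 1) - flatk k 0)) @ 0^' --> (0 : R).
    apply/norm_cvg0P.
    apply: (@squeeze_cvgr _ _ _ _ (fun=> 0) (fun h => (k.+2)`!%:R * `|h|)).
    - near=> h; rewrite normr_ge0 /= f0 subr0 addr0.
      rewrite -[h *: 1]/(h * 1) -[_ *: _]/(_ * _) mulr1 normrM.
      have h0 : h != 0 by near: h; exact: nbhs_dnbhs_neq.
      rewrite normfV ler_pdivrMl ?normr_gt0// mulrCA -expr2 -normrX [X in _ <= _ * X]ger0_norm ?sqr_ge0//.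
      exact: flatk_le.
    - exact: cvg_cst.
    - rewrite -[X in _ --> X](mulr0 (k.+2)`!%:R); apply: cvgMr.
      by apply/norm_cvg0P => A A0; exact: nbhs_dnbhs.
  by apply: DeriveDef; [apply/cvg_ex; exists 0|exact: cvg_lim].
Unshelve. all: by end_near. Qed.

Lemma smooth_flatk k : smooth (flatk k).
Proof.
move=> n; elim: n k => [|n IH] k.
  move=> y; apply: differentiable_continuous; apply/derivable1_diffP.
  by have [] := is_derive_flatk k y.
apply: (Ck_antiderivative (is_derive_flatk k)).
by do !(apply: CkM || apply: CkD || exact: Ck_cst); exact: IH.
Qed.

Lemma flatk0_itv y : 0 <= flatk 0 y <= 1.
Proof.
rewrite /flatk; case: ifPn => [y0|_]; last by rewrite lexx ler01.
by rewrite expr0 mul1r expR_ge0 /= -expR0 ler_expR lerNl oppr0 invr_ge0 ltW.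
Qed.

Lemma flatk0_le0 y : y <= 0 -> flatk 0 y = 0.
Proof. by move=> y0; rewrite /flatk ltNge y0. Qed.

(** The linear lower bound, which each cutoff below supplies, forces [(u n)^-1] to 0. *)
Lemma cvg_flatk0 (u : nat -> R) (c : R) : 0 < c ->
  (\forall n \near \oo, c * n%:R <= u n) -> flatk 0 (u n) @[n --> \oo] --> (1 : R).
Proof.
move=> c0 hu.
suff : (u n)^-1 @[n --> \oo] --> (0 : R).
  move=> h; have : expR (- (u n)^-1) @[n --> \oo] --> (1 : R).
    rewrite -[X in _ --> X](@expR0 R) -oppr0.
    apply: (@continuous_cvg _ _ _ _ _ _ expR); first exact: continuous_expR.
    exact: cvgN.
  apply: cvg_trans; apply: near_eq_cvg; near=> n.
  rewrite /flatk expr0 mul1r (_ : 0 < u n)//.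
  have : c * n%:R <= u n by near: n.
  apply: lt_le_trans; rewrite mulr_gt0// ltr0n; near: n; exact: nbhs_infty_gt.
apply: (@squeeze_cvgr _ _ _ _ (fun=> 0) (fun n => c^-1 * (n%:R)^-1)).
- near=> n.
  have n0 : 0 < n%:R :> R by rewrite ltr0n; near: n; exact: nbhs_infty_gt.
  have un : c * n%:R <= u n by near: n.
  have cn : 0 < c * n%:R by rewrite mulr_gt0.
  rewrite invr_ge0 (le_trans (ltW cn) un) /= -invfM lef_pV2 ?posrE//.
  exact: lt_le_trans un.
- exact: cvg_cst.
- rewrite -[X in _ --> X](mulr0 c^-1); apply: cvgMr.
  apply/gtr0_cvgV0; last exact: cvgr_idn.
  by near=> n; rewrite ltr0n; near: n; exact: nbhs_infty_gt.
Unshelve. all: by end_near. Qed.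

End flat_function.

(** * Smooth approximation of half-lines, on the line and on the circle *)

Section window.
Context {R : realType}.

Lemma smooth_sin_cos : smooth (@sin R) /\ smooth (@cos R).
Proof.
suff H k : Ck k (@sin R) /\ Ck k (@cos R) by split => k; have [] := H k.
elim: k => [|k [Cs Cc]].
  by split => x; [exact: continuous_sin|exact: continuous_cos].
split; first by apply: (@Ck_antiderivative _ _ _ cos).
by apply: (@Ck_antiderivative _ _ _ (fun y => - sin y)) => //; exact: CkN.
Qed.

Lemma smooth_affine (a b : R) : smooth (fun y : R => a * y + b).
Proof.
move=> k; apply: CkD; last exact: Ck_cst.
apply: CkM; first exact: Ck_cst.
apply: Ck_weaken; apply: (@Ck_antiderivative _ k id (fun=> 1)); last exact: Ck_cst.
Qed.

(** The factors of a product test function; [test_window_prod] assembles them over the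
    coordinates. *)
Variant window_spec (S : geometry R) (w : R -> R) : Prop :=
  WindowSpec of smooth w & (forall y, 0 <= w y <= 1) &
    match S with
    | Euclidean => exists M, forall y, M < `|y| -> w y = 0
    | Torus L => forall y, w (y + L%:num) = w y
    end.

Definition cell1 (S : geometry R) : set R :=
  match S with
  | Euclidean => setT
  | Torus L => [set y | 0 <= y < L%:num]
  end.

Definition halfline (c y : R) : R := if y < c then 1 else 0.

Lemma cvg_window_Euclidean (c : R) : exists2 w : nat -> R -> R,
  forall n, window_spec Euclidean (w n) &
  forall y, w n y @[n --> \oo] --> halfline c y.
Proof.
(* The second factor vanishes for [y <= - n], which bounds the support from below, and tends to 1 at
   each fixed [y]. *)
exists (fun n y => flatk 0 (n.+1%:R * (c - y)) * flatk 0 (n.+1%:R * (y + n%:R))).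
  move=> n; split.
  - move=> k; apply: CkM.
      rewrite (_ : (fun _ => _) = flatk 0 \o (fun y => - n.+1%:R * y + n.+1%:R * c)).
        by apply: Ck_comp; [exact: smooth_flatk|exact: smooth_affine].
      by apply/funext => y /=; congr flatk; ring.
    rewrite (_ : (fun _ => _) = flatk 0 \o (fun y => n.+1%:R * y + n.+1%:R * n%:R)).
      by apply: Ck_comp; [exact: smooth_flatk|exact: smooth_affine].
    by apply/funext => y /=; congr flatk; ring.
  - move=> y; have /andP[a0 a1] := flatk0_itv (n.+1%:R * (c - y)).
    have /andP[b0 b1] := flatk0_itv (n.+1%:R * (y + n%:R)).
    by rewrite mulr_ge0// mulr_ile1.
  - exists (Num.max c n%:R) => y; rewrite gt_max => /andP[yc yn].
    have [y0|y0] := leP 0 y.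
      rewrite ger0_norm// in yc.
      by rewrite flatk0_le0 ?mul0r// pmulr_rle0// subr_le0 ltW.
    rewrite ltr0_norm// in yn.
    rewrite [X in _ * X]flatk0_le0 ?mulr0// pmulr_rle0//.
    by rewrite -lerBrDr sub0r lerNr ltW.
move=> y; rewrite /halfline; case: ifPn => [yc|]; last first.
  rewrite -leNgt => cy; apply: (@cvg_trans _ (0 @[n --> \oo])); last exact: cvg_cst.
  apply: near_eq_cvg; apply: nearW => n.
  by rewrite [flatk _ _]flatk0_le0 ?mul0r// pmulr_rle0// subr_le0.
rewrite -[X in _ --> X]mulr1; apply: cvgM.
  apply: (@cvg_flatk0 _ _ (c - y)); first by rewrite subr_gt0.
  by apply: nearW => n; rewrite mulrC ler_wpM2r ?subr_ge0 1?ltW// ltr_nat.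
apply: (@cvg_flatk0 _ _ 1) => //.
near=> n; rewrite mul1r -[leLHS]mulr1 ler_pM//; first by rewrite ler_nat.
rewrite -lerBlDl; near: n; exact: nbhs_infty_ger.
Unshelve. all: by end_near. Qed.

(** Each of the two sines [a n] and [b] changes sign under [y + L], so their product is
    [L]-periodic. On [[0, c[] it is eventually positive and on [[c, L[] eventually nonpositive, so
    [flatk 0] of a large multiple of it tends to the indicator. *)
Lemma cvg_window_Torus (L : {posnum R}) (c : R) : exists2 w : nat -> R -> R,
  forall n, window_spec (Torus L) (w n) &
  forall y, 0 <= y < L%:num -> w n y @[n --> \oo] --> halfline c y.
Proof.
(* If [c <= 0] the half-line misses the cell, and if [c >= L] it contains it: the constants 0 and 1
   serve. *)
have [c0|c0] := leP c 0.
  exists (fun _ _ => 0) => [n|y /andP[y0 _]].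
    by split => // [k|y]; [exact: Ck_cst|rewrite lexx ler01].
  by rewrite /halfline ltNge (le_trans c0 y0) /=; exact: cvg_cst.
have [cL|cL] := leP L%:num c.
  exists (fun _ _ => 1) => [n|y /andP[_ yL]].
    by split => // [k|y]; [exact: Ck_cst|rewrite lexx ler01].
  by rewrite /halfline (lt_le_trans yL cL) /=; exact: cvg_cst.
pose L' := L%:num; have L0 : 0 < L' by rewrite /L'.
pose e (n : nat) : R := pi / n.+2%:R.
have e0 n : 0 < e n by rewrite divr_gt0// pi_gt0.
have epi n : e n < pi by rewrite ltr_pdivrMr// ltr_pMr ?pi_gt0// ltr1n.
have se n : 0 < sin (e n) by apply: sin_gt0_pi; rewrite e0 epi.
pose a (n : nat) y := sin (pi / L' * y + e n).
pose b y := sin (- (pi / L') * y + pi / L' * c).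
(* [q n * a n 0 = n.+1%:R]: at [y = 0] only the shift [e n] keeps [a n] positive, and this factor
   compensates for [sin (e n)] tending to 0. *)
pose q n := n.+1%:R * (sin (e n))^-1.
have q0 n : 0 < q n by rewrite mulr_gt0// invr_gt0.
have cve : e n @[n --> \oo] --> (0 : R).
  rewrite -[X in _ --> X](mulr0 pi); apply: cvgMr.
  apply/gtr0_cvgV0; first by near=> n; rewrite ltr0n.
  apply/cvgryPge => A; near=> n.
  have An : A <= n%:R by near: n; exact: nbhs_infty_ger.
  by rewrite (le_trans An)// ler_nat -addn2 leq_addr.
exists (fun n y => flatk 0 (q n * (a n y * b y))) => [n|y /andP[y0 yL]].
  split=> [k|y|y].
  - rewrite -[fun y => _]/(flatk 0 \o (fun y => q n * (a n y * b y))).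
    apply: Ck_comp; first exact: smooth_flatk.
    apply: CkM; first exact: Ck_cst.
    have [ss _] := smooth_sin_cos.
    by apply: CkM; apply: (Ck_comp (ss k)); exact: smooth_affine.
  - exact: flatk0_itv.
  - congr (flatk 0 (_ * _)); rewrite /a /b -/L'.
    have -> : pi / L' * (y + L') + e n = pi / L' * y + e n + pi.
      by field; rewrite gt_eqF.
    have -> : - (pi / L') * (y + L') + pi / L' * c =
        - (pi / L') * y + pi / L' * c - pi by field; rewrite gt_eqF.
    set x := _ + pi / L' * c.
    by rewrite sinDpi -[in RHS](subrK pi x) sinDpi mulrN mulNr.
have piL : 0 < pi / L' by rewrite divr_gt0// pi_gt0.
rewrite /halfline; case: ifPn => [yc|]; last first.
  rewrite -leNgt => cy; apply: (@cvg_trans _ (0 @[n --> \oo])); last exact: cvg_cst.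
  apply: near_eq_cvg; near=> n.
  rewrite [flatk _ _]flatk0_le0// pmulr_rle0//.
  apply: mulr_ge0_le0.
    apply: sin_ge0_pi; apply/andP; split.
      by apply: addr_ge0; [apply: mulr_ge0 => //|]; exact: ltW.
    rewrite -lerBrDl (_ : pi - _ = pi / L' * (L' - y)); last first.
      by field; rewrite gt_eqF.
    apply/ltW; near: n; apply: (cvgr_lt _ cve).
    by rewrite mulr_gt0// subr_gt0.
  rewrite /b -oppr_ge0 -sinN; apply: sin_ge0_pi.
  have -> : - (- (pi / L') * y + pi / L' * c) = pi / L' * (y - c) by ring.
  rewrite mulr_ge0 ?subr_ge0//= ?(ltW piL)// mulrAC ler_pdivrMr// ler_pM2l ?pi_gt0//.
  by rewrite lerBlDr ltW// (lt_le_trans yL)// lerDl ltW.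
have b0 : 0 < b y.
  rewrite /b (_ : _ + _ = pi / L' * (c - y)); last by ring.
  apply: sin_gt0_pi; rewrite mulr_gt0 ?subr_gt0//= mulrAC ltr_pdivrMr//.
  by rewrite ltr_pM2l ?pi_gt0// ltrBlDr (lt_le_trans cL)// lerDl.
have [y1|y1] := eqVneq y 0.
  apply: (@cvg_flatk0 _ _ (b y)) => //; apply: nearW => n.
  rewrite /a y1 mulr0 add0r mulrA /q mulfVK ?gt_eqF// mulrC.
  by rewrite y1 in b0; rewrite ler_wpM2r ?(ltW b0)// ler_nat.
have {}y0 : 0 < y by rewrite lt_neqAle eq_sym y1.
have sy : 0 < sin (pi / L' * y).
  apply: sin_gt0_pi; rewrite mulr_gt0//= mulrAC ltr_pdivrMr//.
  by rewrite ltr_pM2l ?pi_gt0.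
apply: (@cvg_flatk0 _ _ (sin (pi / L' * y) / 2 * b y)).
  by rewrite mulr_gt0// divr_gt0.
have cva : a n y @[n --> \oo] --> sin (pi / L' * y).
  apply: (@continuous_cvg _ _ _ _ _ _ sin); first exact: continuous_sin.
  by rewrite -[X in _ --> X]addr0; apply: cvgD => //; exact: cvg_cst.
near=> n; rewrite mulrAC [leRHS]mulrA ler_wpM2r ?(ltW b0)//.
have an : sin (pi / L' * y) / 2 <= a n y.
  apply/ltW; near: n; apply: (cvgr_gt _ cva).
  by rewrite ltr_pdivrMr// ltr_pMr// ltr1n.
rewrite mulrC; apply: ler_pM => //; first by rewrite divr_ge0// ltW.
apply: (@le_trans _ _ n.+1%:R); first by rewrite ler_nat.
by rewrite /q ler_peMr// invf_ge1// sin_le1.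
Unshelve. all: by end_near. Qed.

Lemma cvg_window (S : geometry R) (c : R) : exists2 w : nat -> R -> R,
  forall n, window_spec S (w n) &
  forall y, cell1 S y -> w n y @[n --> \oo] --> halfline c y.
Proof.
case: S => [|L]; last exact: cvg_window_Torus.
by have [w ws wc] := cvg_window_Euclidean c; exists w.
Qed.

End window.

(** * Euclidean inner product and norm *)

Section euclidean.
Context {R : realType} {d : nat}.
Implicit Types x y : 'rV[R]_d.

Lemma dotC x y : dot x y = dot y x.
Proof. by apply: eq_bigr => i _; rewrite mulrC. Qed.

Lemma dot_ge0 x : 0 <= dot x x.
Proof. by apply: sumr_ge0 => i _; rewrite -expr2 sqr_ge0. Qed.

Lemma dotDl x x' y : dot (x + x') y = dot x y + dot x' y.
Proof. by rewrite -big_split /=; apply: eq_bigr => i _; rewrite mxE mulrDl. Qed.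

Lemma dotZl a x y : dot (a *: x) y = a * dot x y.
Proof. by rewrite mulr_sumr; apply: eq_bigr => i _; rewrite mxE mulrA. Qed.

Lemma dotDr x y y' : dot x (y + y') = dot x y + dot x y'.
Proof. by rewrite !(dotC x) dotDl. Qed.

Lemma dotZr a x y : dot x (a *: y) = a * dot x y.
Proof. by rewrite !(dotC x) dotZl. Qed.

Lemma dot0r x : dot x 0 = 0.
Proof. by rewrite /dot big1// => i _; rewrite mxE mulr0. Qed.

Lemma enorm_ge0 x : 0 <= enorm x.
Proof. exact: sqrtr_ge0. Qed.

Lemma enorm_sqr x : enorm x ^+ 2 = dot x x.
Proof. by rewrite sqr_sqrtr// dot_ge0. Qed.

Lemma coord_sqr_le_dot x i : x ord0 i ^+ 2 <= dot x x.
Proof.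
rewrite /dot (bigD1 i)//= -expr2 lerDl.
by apply: sumr_ge0 => j _; rewrite -expr2 sqr_ge0.
Qed.

Lemma coord_le_enorm x i : `|x ord0 i| <= enorm x.
Proof. by rewrite -sqrtr_sqr ler_wsqrtr// coord_sqr_le_dot. Qed.

Lemma dot_sqr_le x y : dot x y ^+ 2 <= dot x x * dot y y.
Proof.
have [y0|y0] := eqVneq (dot y y) 0.
  rewrite (_ : dot x y = 0) ?y0 ?mulr0 ?expr0n//.
  rewrite /dot big1// => i _; suff -> : y ord0 i = 0 by rewrite mulr0.
  apply/eqP; rewrite -sqrf_eq0 eq_le sqr_ge0 andbT -y0; exact: coord_sqr_le_dot.
have yp : 0 < dot y y by rewrite lt_neqAle eq_sym y0 dot_ge0.
(* Expand the square of [|y|^2 x - <x, y> y]. *)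
have := dot_ge0 (dot y y *: x + (- dot x y) *: y).
rewrite dotDl !dotDr !dotZl !dotZr (dotC y x).
rewrite [X in 0 <= X](_ : _ = dot y y * (dot x x * dot y y - dot x y ^+ 2)).
  by rewrite pmulr_rge0// subr_ge0.
ring.
Qed.

Lemma dot_le_enorm x y : `|dot x y| <= enorm x * enorm y.
Proof.
rewrite -sqrtr_sqr /enorm -sqrtrM ?dot_ge0//.
by rewrite ler_wsqrtr// dot_sqr_le.
Qed.

Lemma enorm_le_cube (M : R) x : (forall i, `|x ord0 i| <= M) ->
  enorm x <= Num.sqrt (d%:R * M ^+ 2).
Proof.
move=> xM; rewrite ler_wsqrtr// /dot.
rewrite [leRHS](_ : _ = \sum_(i < d) M ^+ 2); last first.
  by rewrite sumr_const card_ord mulr_natl.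
apply: ler_sum => i _; rewrite -expr2 -ler_sqrt ?sqr_ge0// !sqrtr_sqr.
by rewrite (le_trans (xM i))// ler_norm.
Qed.

Lemma continuous_dot (T : topologicalType) (f g : T -> 'rV[R]_d) :
  (forall i, continuous (fun z => f z ord0 i)) ->
  (forall i, continuous (fun z => g z ord0 i)) ->
  continuous (fun z => dot (f z) (g z)).
Proof.
move=> cf cg z; rewrite /dot.
elim: (index_enum _) => [|i r IH].
  by under eq_fun do rewrite big_nil; exact: cvg_cst.
under eq_fun do rewrite big_cons; apply: cvgD => //.
by apply: cvgM; [exact: cf|exact: cg].
Qed.

Lemma continuous_enorm (T : topologicalType) (f : T -> 'rV[R]_d) :
  (forall i, continuous (fun z => f z ord0 i)) ->
  continuous (fun z => enorm (f z)).
Proof.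
move=> cf z; rewrite /enorm; apply: (@continuous_cvg _ _ _ _ _ _ Num.sqrt).
  exact: sqrt_continuous.
exact: continuous_dot.
Qed.

End euclidean.

(** * Supports of test functions and of their derivatives *)

Section vanishing_derivative.
Context {R : realType}.

(** Vanishing is assumed to the right only, because the cell of the torus is half-open: from one of
    its points, small positive steps stay inside, negative ones may leave it. *)
Lemma derive_right0 (E : normedModType R) (f : E -> R) (x v : E) :
  derivable f x v -> f x = 0 ->
  (\forall h \near (0 : R)^'+, f (h *: v + x) = 0) -> 'D_v f x = 0.
Proof.
move=> df fx0 f0.
have cv : (fun h => h^-1 *: (f (h *: v + x) - f x)) @ (0 : R)^'+ --> 'D_v f x.
  move=> A /df /nbhs_ballP[_ /posnumP[e] eA].
  by exists e%:num => //= y ye /gt_eqF/negbT y0; exact: eA.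
have cv0 : (fun h => h^-1 *: (f (h *: v + x) - f x)) @ (0 : R)^'+ --> (0 : R).
  apply: (@cvg_trans _ (0 @[h --> (0:R)^'+])); last exact: cvg_cst.
  by apply: near_eq_cvg; near=> h; rewrite fx0 (near f0)// subr0 scaler0.
exact: (cvg_unique _ cv cv0).
Unshelve. all: by end_near. Qed.

Context {d : nat} (S : geometry R).

Lemma cell_add_e (x : 'rV[R]_d) (i : 'I_d) : cell S x ->
  \forall h \near (0 : R)^'+, cell S (h *: e_ i + x).
Proof.
case: S => [|L]; first by move=> _; exact: nearW.
move=> cx; have /andP[_ xiL] := cx i; near=> h.
have hL : h < L%:num - x ord0 i by near: h; apply: nbhs_right_lt; rewrite subr_gt0.
move=> j; rewrite !mxE eqxx /=.
have h0 : 0 < h by near: h; exact: nbhs_right_gt.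
have /andP[xj0 xjL] := cx j.
case: eqVneq => [ij|_] /=; last by rewrite mulr0 add0r xj0.
rewrite mulr1 (addr_ge0 (ltW h0))//= -ltrBrDr.
by rewrite ij.
Unshelve. all: by end_near. Qed.

Lemma enorm_add_near (M : R) (x b : 'rV[R]_d) : M < enorm x ->
  \forall h \near (0 : R)^'+, M < enorm (h *: b + x).
Proof.
move=> Mx.
have c : continuous (fun h : R => enorm (h *: b + x)).
  apply: continuous_enorm => j h.
  rewrite (_ : (fun z : R => _) = fun z : R => z * b ord0 j + x ord0 j).
    by apply: cvgD; [apply: cvgM; [exact: cvg_id|]|]; exact: cvg_cst.
  by apply/funext => z; rewrite !mxE.
have : enorm (h *: b + x) @[h --> (0 : R)] --> enorm x.
  by rewrite -[X in _ --> enorm X]add0r -[X in _ --> enorm (X + _)](scale0r b); exact: c.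
by move=> /cvg_at_right_filter/cvgr_gt/(_ _ Mx).
Qed.

End vanishing_derivative.

Section compactness.
Context {R : realType} {d : nat}.

Definition cube (M : R) : set 'rV[R]_d := [set x | forall i, `|x ord0 i| <= M].

Lemma compact_cube (M : R) : compact (cube M).
Proof.
rewrite (_ : cube M = [set x | forall i, `[- M, M]%classic (x ord0 i)]).
  by apply: (@rV_compact R d (fun=> `[- M, M]%classic)) => i; exact: segment_compact.
by apply/seteqP; split => x /= h i; have := h i; rewrite /= in_itv/= ler_norml.
Qed.

Lemma enorm_cube (M : R) x : enorm x <= M -> cube M x.
Proof. by move=> xM i; rewrite (le_trans (coord_le_enorm x i)). Qed.

Lemma continuous_compact_bounded (T : topologicalType) (K : set T) (f : T -> R) :
  compact K -> continuous f -> exists2 C, 0 <= C & forall z, K z -> `|f z| <= C.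
Proof.
move=> cK cf; have [->|/set0P K0] := eqVneq K set0; first by exists 0.
have cnf : {within K, continuous (fun z => `|f z|)}.
  apply: continuous_subspaceT => z; exact: (cvg_norm (cf z)).
have [c _ hc] := compact_EVT_max K0 cK cnf.
by exists `|f c| => // z Kz; apply: hc; rewrite inE.
Qed.

End compactness.

Section test_functions.
Context {R : realType} {d : nat} (S : geometry R).
Implicit Types theta f : 'rV[R]_d -> R.

Lemma smooth_coord_comp (w : R -> R) (i : 'I_d) : smooth w ->
  smooth (fun x : 'rV[R]_d => w (x ord0 i)).
Proof.
move=> sw k.
apply: (@Ck_precomp _ _ _ k (fun x : 'rV[R]_d => x ord0 i) (fun x => x ord0 i) w) => //.
by move=> x; exact: is_diff_coord.
Qed.

Lemma test_window_prod (w : 'I_d -> R -> R) : (forall i, window_spec S (w i)) ->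
  test S (fun x => \prod_i w i (x ord0 i)).
Proof.
move=> ws.
have sm : smooth (fun x : 'rV[R]_d => \prod_i w i (x ord0 i)).
  move=> k; apply: Ck_prod => i; apply: smooth_coord_comp; by have [] := ws i.
split=> //.
- case: S ws => [//|L] ws x i; apply: eq_bigr => j _.
  rewrite !mxE eqxx /=; case: eqVneq => [->|_]; last by rewrite mulr0 addr0.
  by rewrite mulr1; have [_ _ ->] := ws i.
case: S ws => [|L] ws.
  have [M hM] : exists M, forall i y, M < `|y| -> w i y = 0.
    have /choice[m hm] : forall i, exists M, forall y, M < `|y| -> w i y = 0.
      by move=> i; have [] := ws i.
    exists (\big[Num.max/0]_i m i) => i y h; apply: hm.
    by rewrite (le_lt_trans _ h)// le_bigmax.
  exists (Num.sqrt (d%:R * M ^+ 2)) => x _ Mx.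
  have [/forallP xM|] := boolP [forall i, `|x ord0 i| <= M].
    by have := enorm_le_cube xM; rewrite leNgt Mx.
  move=> /forallPn[i]; rewrite -ltNge => /hM xi.
  by rewrite (bigD1 i)//= xi mul0r.
(* The torus cell lies within this radius, beyond which the support condition is vacuous. *)
exists (Num.sqrt (d%:R * L%:num ^+ 2)) => x cx.
rewrite ltNge enorm_le_cube// => i; have /andP[y0 yL] := cx i.
by rewrite ger0_norm// ltW.
Qed.

Lemma testM theta f : test S theta -> smooth f -> Defs.periodic S f ->
  test S (fun x => theta x * f x).
Proof.
move=> [st pt [M tM]] sf pf; split.
- by move=> k; exact: CkM.
- by case: S pt pf {tM} => // L pt pf x i; rewrite pt pf.
- by exists M => x cx Mx; rewrite tM// mul0r.
Qed.

Lemma test_derive0 theta (M : R) : smooth theta ->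
  (forall x, cell S x -> M < enorm x -> theta x = 0) ->
  forall x i, cell S x -> M < enorm x -> 'D_(e_ i) theta x = 0.
Proof.
move=> st tM x i cx Mx; apply: derive_right0.
- by apply: diff_derivable; exact: smooth_differentiable.
- exact: tM.
- near=> h; apply: tM; near: h; [exact: cell_add_e|exact: enorm_add_near].
Unshelve. all: by end_near. Qed.

Lemma bounded_on_cell (f : 'rV[R]_d -> R) (M : R) : continuous f ->
  (forall x, cell S x -> M < enorm x -> f x = 0) ->
  exists2 C, 0 <= C & forall x, cell S x -> `|f x| <= C.
Proof.
move=> cf fM; have [C C0 hC] := continuous_compact_bounded (@compact_cube R d M) cf.
exists C => // x cx; have [xM|Mx] := leP (enorm x) M.
  by apply: hC; exact: enorm_cube.
by rewrite fM// normr0.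
Qed.

End test_functions.

(** * Boxes, and the integral of a derivative over a box *)

Section coordinates.
Context {R : realType}.

Lemma rV_cons0 n (p : measurableTypeR R * 'rV[R]_n) : rV_cons p ord0 ord0 = p.1.
Proof. by rewrite -[RHS](rV_consl p ord0); congr (rV_cons _ _ _); apply/ord_inj. Qed.

Lemma rV_consS n (p : measurableTypeR R * 'rV[R]_n) (i : 'I_n) :
  rV_cons p ord0 (lift ord0 i) = p.2 ord0 i.
Proof. by rewrite -[RHS](rV_consr p i); congr (rV_cons _ _ _); apply/ord_inj. Qed.

Lemma rV_cons_eq n (p : measurableTypeR R * 'rV[R]_n) (x : 'rV[R]_n.+1) :
  x ord0 ord0 = p.1 -> (forall i, x ord0 (lift ord0 i) = p.2 ord0 i) -> rV_cons p = x.
Proof.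
move=> x0 xS; apply/rowP => j; case: (unliftP ord0 j) => [i ->|->].
  by rewrite rV_consS xS.
by rewrite rV_cons0 x0.
Qed.

Lemma e_coord n (i j : 'I_n) : (e_ i : 'rV[R]_n) ord0 j = (j == i)%:R.
Proof. by rewrite mxE eqxx. Qed.

Lemma continuous_rV n (T : topologicalType) (f : T -> 'rV[R]_n) :
  (forall i, continuous (fun z => f z ord0 i)) -> continuous f.
Proof.
move=> cf z; apply/cvg_ballP => e e0.
have /filter_forall : forall i, \forall u \near z, ball (f z ord0 i) e (f u ord0 i).
  by move=> i; have /cvg_ballP/(_ _ e0) := cf i z.
by apply: filterS => u h; split=> // a i; rewrite ord1; exact: h.
Qed.

Definition box n (a b : R) : set 'rV[R]_n := [set x | forall i, a <= x ord0 i < b].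
Arguments box : clear implicits.

Lemma measurable_box n a b : measurable (box n a b).
Proof.
rewrite (_ : box n a b = \bigcap_(i in [set: 'I_n])
    ((fun x : 'rV[R]_n => x ord0 i) @^-1` `[a, b[%classic)); last first.
  apply/seteqP; split => [x cx i _|x cx i]; first by rewrite /= in_itv/= cx.
  by have := cx i I; rewrite /= in_itv.
apply: fin_bigcap_measurable => // i _.
by rewrite -[X in measurable X]setTI; exact: measurable_coord.
Qed.

Lemma rV_cons_box n a b : @rV_cons R n @^-1` (box n.+1 a b) = `[a, b[%classic `*` box n a b.
Proof.
apply/seteqP; split => [p h|p [h1 h2] j] /=.
  split => [|i]; first by have := h ord0; rewrite rV_cons0 /= in_itv.
  by have := h (lift ord0 i); rewrite rV_consS.
move: h1; rewrite /= in_itv /= => h1.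
by case: (unliftP ord0 j) => [i ->|->]; rewrite ?rV_consS ?rV_cons0.
Qed.

Lemma lebesgue_box_lty n a b : (lebesgue_rV n (box n a b) < +oo)%E.
Proof.
elim: n => [|n IH].
  by rewrite /= /dirac indicE; case: (_ \in _); rewrite ltry.
change ((lebesgue_measure \x lebesgue_rV n)%E (@rV_cons R n @^-1` box n.+1 a b) < +oo)%E.
rewrite rV_cons_box.
rewrite product_measure1E//; last exact: measurable_box.
apply: lte_mul_pinfty => //; rewrite /= lebesgue_measure_itv /=.
  by case: ifP => // _; rewrite -EFinB.
Qed.

End coordinates.
Arguments box {R} n a b.

Section bounded_integrable.
Context {R : realType} {disp} {T : measurableType disp}.

Lemma bounded_integrable (m : {measure set T -> \bar R}) (D : set T) (f : T -> R) (C : R) :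
  measurable D -> (m D < +oo)%E -> measurable_fun D f ->
  (forall x, D x -> `|f x| <= C) -> m.-integrable D (EFin \o f).
Proof.
move=> mD mDoo mf fC; apply: measurable_bounded_integrable => //.
by exists C; split => [|y Cy x Dx /=]; rewrite ?num_real// (le_trans (fC _ Dx))// ltW.
Qed.

End bounded_integrable.

Section integral_derivative.
Context {R : realType}.

(** The two difference quotients coincide, [A] mapping lines in direction [v] to lines in direction
    [u]. *)
Lemma derive_line (E F : normedModType R) (A : F -> E) (w : E -> R) (y v : F) (u : E) :
  (forall h : R, A (h *: v + y) = h *: u + A y) ->
  derivable w (A y) u -> derivable (w \o A) y v /\ 'D_v (w \o A) y = 'D_u w (A y).
Proof.
move=> hA dw.
have E1 : (fun h => h^-1 *: (((w \o A) \o shift y) (h *: v) - (w \o A) y)) =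
    (fun h => h^-1 *: ((w \o shift (A y)) (h *: u) - w (A y))).
  by apply/funext => h /=; rewrite hA.
by split; [rewrite /derivable E1|rewrite /derive E1].
Qed.

Lemma box_bounded n (a b : R) (g : 'rV[R]_n -> R) : continuous g ->
  exists2 C, 0 <= C & forall x, box n a b x -> `|g x| <= C.
Proof.
move=> cg; pose M := Num.max `|a| `|b|.
have [C C0 hC] := continuous_compact_bounded (@compact_cube R n M) cg.
exists C => // x bx; apply: hC => j; have /andP[ax xb] := bx j.
rewrite ler_norml; apply/andP; split.
  rewrite lerNl (@le_trans _ _ `|a|)// ?le_max ?lexx//.
  by rewrite (@le_trans _ _ (- a)) ?lerN2// -normrN ler_norm.
by rewrite (le_trans (ltW xb))// (le_trans (ler_norm b))// le_max lexx orbT.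
Qed.

Lemma box_integrable n (a b : R) (g : 'rV[R]_n -> R) : continuous g ->
  (lebesgue_rV n).-integrable (box n a b) (EFin \o g).
Proof.
move=> cg; have [C _ gC] := box_bounded a b cg.
apply: (@bounded_integrable _ _ _ _ _ _ C) => //; first exact: measurable_box.
  exact: lebesgue_box_lty.
by apply: measurable_funTS; exact: continuous_measurable_rV.
Qed.

(** Fubini and induction on the dimension. If [i] is not the first coordinate, freeze the first one
    and apply the induction hypothesis; if it is, freeze the others and use the fundamental theorem
    of calculus. Requiring equal values on opposite faces covers both periodic functions and
    functions vanishing near the faces. *)
Lemma integral_box_derive n (w : 'rV[R]_n -> R) (i : 'I_n) (a b : R) : a < b ->
  continuous w -> (forall x, derivable w x (e_ i)) -> continuous ('D_(e_ i) w) ->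
  (forall x : 'rV[R]_n, x ord0 i = a -> w (x + (b - a) *: e_ i) = w x) ->
  (\int[lebesgue_rV n]_(x in box n a b) ('D_(e_ i) w x)%:E = 0)%E.
Proof.
move=> ab; elim: n w i => [w []//|n IH] w i cw dw cDw per.
set g : 'rV[R]_n.+1 -> R := 'D_(e_ i) w.
have mg : measurable_fun setT g by exact: continuous_measurable_rV.
have [C _ gC] := box_bounded a b cDw.
pose B := `[a, b[%classic `*` box n a b : set (measurableTypeR R * 'rV[R]_n).
have mB : measurable B by apply: measurableX => //; exact: measurable_box.
have mgc : measurable_fun setT (g \o @rV_cons R n).
  by apply: measurableT_comp => //; exact: measurable_rV_cons.
pose m := (lebesgue_measure \x lebesgue_rV n : {measure set (measurableTypeR R * 'rV[R]_n) -> \bar R})%E.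
have iB : m.-integrable B (EFin \o (g \o @rV_cons R n)).
  apply: (@bounded_integrable _ _ _ _ _ _ C) => //.
  - by rewrite /B -rV_cons_box; exact: (@lebesgue_box_lty R n.+1 a b).
  - exact: measurable_funTS.
  - by rewrite /B -rV_cons_box => p Bp; exact: gC.
change (\int[pushforward m (@rV_cons R n)]_(x in box n.+1 a b) (EFin \o g) x = 0)%E.
rewrite integral_pushforward; [|exact: measurable_rV_cons|exact/measurable_EFinP| |exact: measurable_box]; last first.
  by rewrite rV_cons_box.
rewrite rV_cons_box integral_mkcond.
have iB' := (integrable_mkcond _ mB).1 iB.
have Bpatch x y : ((EFin \o (g \o @rV_cons R n)) \_ B) (x, y) =
    (if y \in box n a b then ((fun x => (g (rV_cons (x, y)))%:E) \_ `[a, b[) x else 0)%E.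
  rewrite !patchE in_setX /= andbC; case: ifP => /=.
    by move=> /andP[-> ->].
  by case: ifP => //= _ ->.
have [j ij|i0] := unliftP ord0 i.
- rewrite -integral12_prod_meas1//; apply: integral0_eq => x _.
  rewrite /fubini_F.
  under eq_integral do rewrite Bpatch patchE.
  have [xab|xab] := boolP (x \in `[a, b[%classic); last first.
    by apply: integral0_eq => y _; case: ifP.
  rewrite (_ : (fun y => _) = (fun y => (g (rV_cons (x, y)))%:E) \_ (box n a b)); last first.
    by apply/funext => y; rewrite patchE.
  rewrite -integral_mkcond.
  pose A (y : 'rV[R]_n) : 'rV[R]_n.+1 := rV_cons (x : measurableTypeR R, y).
  have cA : continuous A.
    apply: continuous_rV => k; case: (unliftP ord0 k) => [k' ->|->].
      by under eq_fun do rewrite rV_consS /=; exact: coord_continuous.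
    by under eq_fun do rewrite rV_cons0 /=; exact: cst_continuous.
  have hA y h : A (h *: e_ j + y) = h *: e_ i + A y.
    apply: rV_cons_eq => [|k].
      by rewrite 2!mxE rV_cons0 ij e_coord (negbTE (neq_lift _ _)) mulr0 add0r.
    by rewrite 2!mxE rV_consS ij e_coord (inj_eq lift_inj) 2!mxE e_coord.
  have hD y := derive_line (hA y) (dw (A y)).
  transitivity (\int[lebesgue_rV n]_(y in box n a b) ('D_(e_ j) (w \o A) y)%:E)%E.
    by apply: eq_integral => y _; rewrite (proj2 (hD y)).
  apply: IH.
  + by move=> y; apply: continuous_comp; [exact: cA|exact: cw].
  + by move=> y; have [] := hD y.
  + rewrite (_ : 'D_(e_ j) _ = g \o A); last by apply/funext => y; have [] := hD y.
    by move=> y; apply: continuous_comp; [exact: cA|exact: cDw].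
  + move=> y yj /=; rewrite addrC hA addrC per//.
    by rewrite ij rV_consS.
- rewrite -integral21_prod_meas1//; apply: integral0_eq => y _.
  rewrite /fubini_G.
  under eq_integral do rewrite Bpatch.
  have [yb|yb] := boolP (y \in box n a b); last by apply: integral0_eq.
  rewrite -integral_mkcond.
  pose A (x : R) : 'rV[R]_n.+1 := rV_cons (x : measurableTypeR R, y).
  have cA : continuous A.
    apply: continuous_rV => k; case: (unliftP ord0 k) => [k' ->|->].
      by under eq_fun do rewrite rV_consS /=; exact: cst_continuous.
    by under eq_fun do rewrite rV_cons0 /=; move=> x; exact: cvg_id.
  have hA x h : A (h *: 1 + x) = h *: e_ i + A x.
    apply: rV_cons_eq => [|k]; first by rewrite 2!mxE rV_cons0 i0 e_coord.
    by rewrite 2!mxE rV_consS i0 e_coord eq_sym (negbTE (neq_lift _ _)) mulr0 add0r.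
  have hD x := derive_line (hA x) (dw (A x)).
  have cgA : continuous (g \o A).
    by move=> x; apply: continuous_comp; [exact: cA|exact: cDw].
  have cwA : continuous (w \o A).
    by move=> x; apply: continuous_comp; [exact: cA|exact: cw].
  rewrite (_ : \int[_]_(x in _) _ = \int[lebesgue_measure]_(x in `[a, b[) ((g \o A) x)%:E)%E//.
  rewrite integral_itv_bndo_bndc; last first.
    by apply/measurable_EFinP; apply: measurable_funTS; exact: continuous_measurable_fun.
  rewrite (@continuous_FTC2 _ _ (w \o A) a b ab).
  + have := per (A a); rewrite i0 rV_cons0 => /(_ erefl); rewrite -i0.
    have -> : A a + (b - a) *: e_ i = A b.
      by rewrite addrC -hA -[_ *: 1]/(_ * 1) mulr1 subrK.
    by move=> wab; rewrite /= wab -EFinB subrr.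
  + exact: continuous_subspaceT.
  + split; first by move=> x _; have [] := hD x.
      by apply: cvg_at_right_filter; exact: cwA.
    by apply: cvg_at_left_filter; exact: cwA.
  + by move=> x _; rewrite derive1E; have [] := hD x.
Qed.

End integral_derivative.

(** * Integration against a Gibbs measure *)

Section density.
Context {R : realType} {disp} {T : measurableType disp}.
Local Open Scope ereal_scope.
Variables (m nu : {measure set T -> \bar R}) (D : set T) (g : T -> R).
Hypotheses (mD : measurable D) (mg : measurable_fun setT g) (g0 : forall x, (0 <= g x)%R).
Hypothesis nuE : forall A, measurable A -> nu A = \int[m]_(x in A `&` D) (g x)%:E.

Import HBNNSimple.

Let integral_density_indic (A : set T) : measurable A ->
  \int[nu]_x (\1_A x)%:E = \int[m]_(x in D) ((\1_A x)%:E * (g x)%:E).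
Proof.
move=> mA; rewrite integral_indic// setIT nuE// setIC integral_mkcondr.
apply: eq_integral => x _; rewrite patchE indicE.
by case: ifP => _; rewrite ?mul1e ?mul0e.
Qed.

Let integral_density_nnsfun (f : {nnsfun T >-> R}) :
  \int[nu]_x (f x)%:E = \int[m]_(x in D) ((f x)%:E * (g x)%:E).
Proof.
have mgD : measurable_fun D (EFin \o g) by apply/measurable_EFinP; exact: measurable_funTS.
under [LHS]eq_integral do rewrite fimfunE -fsumEFin//.
rewrite [LHS]ge0_integral_fsum//; last 2 first.
  - by move=> r; exact/measurable_EFinP/measurableT_comp.
  - by move=> n x _; rewrite EFinM nnfun_muleindic_ge0.
under [RHS]eq_integral.
  move=> x xD; rewrite fimfunE -fsumEFin// ge0_mule_fsuml; last first.
    by move=> r; rewrite EFinM nnfun_muleindic_ge0.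
  over.
rewrite [RHS]ge0_integral_fsum//; last 2 first.
  - move=> r; apply: emeasurable_funM => //.
    by apply/measurable_EFinP; apply: measurable_funTS; exact/measurableT_comp.
  - by move=> n x _; rewrite mule_ge0 ?[(0 <= (g _)%:E)%E]lee_fin// EFinM nnfun_muleindic_ge0.
apply: eq_fsbigr => r _; rewrite integralZl_indic_nnsfun//= integral_density_indic//.
have [r0|r0] := leP 0%R r.
  under [in RHS]eq_integral do rewrite EFinM -muleA.
  rewrite ge0_integralZl// ?lee_fin//.
  - by apply: emeasurable_funM => //; exact/measurable_EFinP/measurable_funTS.
  - by move=> x _; rewrite mule_ge0// lee_fin// indicE ler0n.
rewrite preimage_nnfun0// indic0.
by rewrite !integral0_eq ?mule0// => x _; rewrite ?mulr0 mul0e.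
Qed.

(** Indicators, then simple functions, then monotone convergence. *)
Lemma ge0_integral_density (f : T -> \bar R) : measurable_fun setT f ->
  (forall x, 0 <= f x) -> \int[nu]_x f x = \int[m]_(x in D) (f x * (g x)%:E).
Proof.
move=> mf f0; pose f_ := nnsfun_approx measurableT mf.
transitivity (lim (\int[nu]_x (f_ n x)%:E @[n --> \oo])).
  rewrite -monotone_convergence//=.
  - apply: eq_integral => ? /[!inE] xD; apply/esym/cvg_lim => //=.
    exact: cvg_nnsfun_approx.
  - by move=> n; exact/measurable_EFinP/measurable_funTS.
  - by move=> n ? _; rewrite lee_fin.
  - by move=> ? _ ? ? mn; rewrite lee_fin; exact/lefP/nd_nnsfun_approx.
transitivity (lim (\int[m]_(x in D) ((f_ n x)%:E * (g x)%:E) @[n --> \oo])).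
  by apply: congr_lim; apply/funext => n; exact: integral_density_nnsfun.
rewrite -monotone_convergence//=.
- apply: eq_integral => x _; apply/cvg_lim => //; apply: cvgeZr => //.
  exact: cvg_nnsfun_approx.
- move=> n; apply: emeasurable_funM; last first.
    by apply/measurable_EFinP; exact: measurable_funTS.
  exact/measurable_EFinP/measurable_funTS.
- by move=> n x _; rewrite mule_ge0// lee_fin.
- by move=> x _ a b ab; rewrite lee_wpmul2r ?lee_fin//; exact/lefP/nd_nnsfun_approx.
Qed.

End density.

Section gibbs_density.
Context {R : realType} {d : nat} {S : geometry R} (phi : potential d S).

Lemma measurable_gibbs_weight :
  measurable_fun [set: 'rV[R]_d] (fun x => expR (- phi x)).
Proof.
apply: measurableT_comp => //.
apply: measurableT_comp => //.
exact: continuous_measurable_rV (@pot_smooth _ _ _ phi 0%N).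
Qed.

Lemma ge0_integral_gibbs (f : 'rV[R]_d -> \bar R) : measurable_fun setT f ->
  (forall x, 0 <= f x)%E ->
  (\int[gibbs phi]_x f x = \int[lebesgue_rV d]_(x in cell S) (f x * (expR (- phi x))%:E))%E.
Proof.
apply: ge0_integral_density => //.
- exact: measurable_cell.
- exact: measurable_gibbs_weight.
Qed.

Lemma integral_gibbs (f : 'rV[R]_d -> R) : measurable_fun setT f ->
  (\int[gibbs phi]_x (f x)%:E = \int[lebesgue_rV d]_(x in cell S) (f x * expR (- phi x))%:E)%E.
Proof.
move=> mf; rewrite integralE [RHS]integralE.
rewrite ge0_integral_gibbs; [|exact/measurable_funepos/measurable_EFinP|by []].
rewrite ge0_integral_gibbs; [|exact/measurable_funeneg/measurable_EFinP|by []].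
congr (_ - _)%E; apply: eq_integral => x _.
  by rewrite !funeposE EFinM maxe_pMl ?lee_fin ?expR_ge0// mul0e.
by rewrite !funenegE EFinM -mulNe maxe_pMl ?lee_fin ?expR_ge0// mul0e.
Qed.

Lemma ae_gibbs_cell : {ae gibbs phi, forall x, cell S x}.
Proof.
exists (~` cell S); split.
- by apply: measurableC; exact: measurable_cell.
- by rewrite /gibbs /= setICl integral_set0.
- by [].
Qed.

End gibbs_density.

(** * Integrals of test functions over the cell *)

Section cell_integral.
Context {R : realType} {d : nat} (S : geometry R).
Implicit Types theta f : 'rV[R]_d -> R.

(** Brings integrals over the cell within reach of [integral_box_derive]. On R^d the box is the cube
    of half-side [|M| + 1], on whose faces a function vanishing beyond radius [M] is zero; on the
    torus it is the cell itself, and periodicity matches opposite faces. *)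
Lemma cell_box (M : R) : exists a b, [/\ a < b, box d a b `<=` cell S,
    forall x, cell S x -> ~ box d a b x -> M < enorm x &
    forall theta, Defs.periodic S theta ->
      (forall x, cell S x -> M < enorm x -> theta x = 0) ->
      forall (x : 'rV[R]_d) i, x ord0 i = a -> theta (x + (b - a) *: e_ i) = theta x].
Proof.
case: S => [|L]; last first.
  exists 0, L%:num; split => // theta per _ x i x0.
  by rewrite subr0 per.
pose M' := `|M| + 1; have M'0 : 0 < M' by rewrite ltr_wpDl.
have MM' : M < M' by rewrite (le_lt_trans (ler_norm M))// ltrDl.
have far (x : 'rV[R]_d) i : M' <= `|x ord0 i| -> M < enorm x.
  by move=> h; rewrite (lt_le_trans MM')// (le_trans h)// coord_le_enorm.
exists (- M'), M'; split => //.
- by rewrite gtrN.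
- move=> x _ /existsNP[i /negP]; rewrite negb_and -ltNge -leNgt => /orP h.
  apply: (far _ i); case: h => h.
    by rewrite -normrN (le_trans _ (ler_norm _))// lerNr ltW.
  by rewrite (le_trans h)// ler_norm.
- move=> theta _ tM x i xi; rewrite !tM//.
    by apply: (far _ i); rewrite xi normrN ger0_norm// ltW.
  apply: (far _ i); rewrite 2!mxE e_coord eqxx mulr1 xi addrC subrK.
  by rewrite ger0_norm// ltW.
Qed.

Lemma integral_cell_box f (a b M : R) : box d a b `<=` cell S ->
  (forall x, cell S x -> ~ box d a b x -> M < enorm x) ->
  (forall x, cell S x -> M < enorm x -> f x = 0) ->
  (EFin \o f) \_ (cell S) = (EFin \o f) \_ (box d a b).
Proof.
move=> sub out fM; apply/funext => x; rewrite !patchE.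
case: ifPn => [xc|xc]; case: ifPn => [xb|xb] //.
  rewrite notin_setE in xb; rewrite inE in xc.
  by rewrite /= fM//; exact: out.
by move: xc; rewrite notin_setE inE in xb * => /(_ (sub _ xb)).
Qed.

Lemma cell_integrable f (M : R) : continuous f ->
  (forall x, cell S x -> M < enorm x -> f x = 0) ->
  (lebesgue_rV d).-integrable (cell S) (EFin \o f).
Proof.
move=> cf fM; have [a [b [ab sub out _]]] := cell_box M.
apply/integrable_mkcond; first exact: measurable_cell.
rewrite (integral_cell_box sub out fM).
by apply/(integrable_mkcond _ (measurable_box a b)); exact: box_integrable.
Qed.

Lemma test_integral_derive theta i : test S theta ->
  (\int[lebesgue_rV d]_(x in cell S) ('D_(e_ i) theta x)%:E = 0)%E.
Proof.
move=> [st pt [M tM]]; have [a [b [ab sub out bd]]] := cell_box M.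
have dM := test_derive0 st tM.
rewrite integral_mkcond.
rewrite (integral_cell_box sub out (fun x => dM x i)) -integral_mkcond.
apply: integral_box_derive => //.
- exact: smooth_continuous.
- by move=> x; apply: diff_derivable; exact: smooth_differentiable.
- by apply: smooth_continuous; exact: smooth_derive.
- by move=> x; exact: bd.
Qed.

End cell_integral.

Lemma continuous_mul (R : realType) (T : topologicalType) (f g : T -> R) :
  continuous f -> continuous g -> continuous (fun x => f x * g x).
Proof. by move=> cf cg x; apply: cvgM; [exact: cf|exact: cg]. Qed.

(** * Square integrable functions and vector fields *)

Section L2_facts.
Context {R : realType} {disp} {T : measurableType disp}.
Variable m : {measure set T -> \bar R}.
Implicit Types f g : T -> R.

Lemma L2norm_ge0 f : (0 <= L2norm m f)%E.
Proof. exact: Lnorm_ge0. Qed.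

Lemma L2norm_sqr f : (L2norm m f ^+ 2 = \int[m]_x (f x ^+ 2)%:E)%E.
Proof.
rewrite /L2norm unlock poweR12_sqrt; last first.
  by apply: integral_ge0 => x _; exact: poweR_ge0.
rewrite sqr_sqrte; last by apply: integral_ge0 => x _; exact: poweR_ge0.
apply: eq_integral => x _ /=.
by rewrite -(normr_id (f x)) powR_mulrn// normr_id -normrX ger0_norm// sqr_ge0.
Qed.

Lemma L2normv_sqr n (F : T -> 'rV[R]_n) :
  (L2normv m F ^+ 2 = \int[m]_x (enorm (F x) ^+ 2)%:E)%E.
Proof. exact: L2norm_sqr. Qed.

Lemma LfunP2 f : f \in Lfun m 2%:E <->
  measurable_fun setT f /\ (\int[m]_x (f x ^+ 2)%:E < +oo)%E.
Proof.
split=> [/[dup] fL|[mf f2]].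
  rewrite inE => /andP[/[!inE]/= mf _]; split => //.
  have /integrableP[_] := Lfun2_integrable_sqr fL.
  by under eq_integral do rewrite /= ger0_norm ?sqr_ge0//.
apply/andP; split; rewrite inE//= /finite_norm.
rewrite -[X in (X < _)%E]/(L2norm m f).
have : (L2norm m f ^+ 2 < +oo)%E by rewrite L2norm_sqr.
by have := L2norm_ge0 f; case: (L2norm m f) => //= r; rewrite ?ltry.
Qed.

Lemma Lfun_measurable f : f \in Lfun m 2%:E -> measurable_fun setT f.
Proof. by move=> /LfunP2[]. Qed.

Lemma Lfun_mul_integrable f g : f \in Lfun m 2%:E -> g \in Lfun m 2%:E ->
  m.-integrable setT (fun x => (f x * g x)%:E).
Proof. by move=> fL gL; apply/Lfun1_integrable; exact: Lfun2_mul_Lfun1. Qed.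

Lemma Lfun2_lin (a : R) f g : f \in Lfun m 2%:E -> g \in Lfun m 2%:E ->
  (fun x => a * f x + g x) \in Lfun m 2%:E.
Proof.
move=> f2 g2; have [_ addc] := Lfun_addr_closed m (lee1n 2).
apply: (addc (fun x => a * f x)) => //.
by under eq_fun do rewrite mulrC; apply: Lfun_scale => //; rewrite ler1n.
Qed.

Lemma L2v_measurable n (F : T -> 'rV[R]_n) i : L2v m F ->
  measurable_fun setT (fun x => F x ord0 i).
Proof. by move=> /(_ i)/Lfun_measurable. Qed.

Lemma measurable_dot n (F G : T -> 'rV[R]_n) :
  (forall i, measurable_fun setT (fun x => F x ord0 i)) ->
  (forall i, measurable_fun setT (fun x => G x ord0 i)) ->
  measurable_fun setT (fun x => dot (F x) (G x)).
Proof.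
by move=> mF mG; apply: measurable_sum => i; exact: measurable_funM.
Qed.

Lemma measurable_enorm n (F : T -> 'rV[R]_n) :
  (forall i, measurable_fun setT (fun x => F x ord0 i)) ->
  measurable_fun setT (fun x => enorm (F x)).
Proof.
move=> mF; apply: (@measurableT_comp _ _ _ _ _ _ (@Num.sqrt R)).
  exact: (continuous_measurable_fun (@sqrt_continuous R)).
exact: measurable_dot.
Qed.

Lemma L2vP n (F : T -> 'rV[R]_n) : L2v m F <->
  (forall i, measurable_fun setT (fun x => F x ord0 i)) /\
  (\int[m]_x (enorm (F x) ^+ 2)%:E < +oo)%E.
Proof.
split=> [FL|[mF F2] i].
  have mF i : measurable_fun setT (fun x => F x ord0 i) by exact: L2v_measurable.
  split=> //.
  under eq_integral do rewrite enorm_sqr /dot -sumEFin.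
  rewrite ge0_integral_sum//.
  - apply/lte_sum_pinfty => i _.
    by have /LfunP2[_] := FL i; under eq_integral do rewrite expr2.
  - by move=> i; apply/measurable_EFinP; exact: measurable_funM.
  - by move=> i x _; rewrite lee_fin -expr2 sqr_ge0.
apply/LfunP2; split=> //; apply: le_lt_trans F2.
apply: ge0_le_integral => //.
- by move=> x _; rewrite lee_fin sqr_ge0.
- by apply/measurable_EFinP; exact: measurable_funX.
- by apply/measurable_EFinP; apply: measurable_funX; exact: measurable_enorm.
- by move=> x _; rewrite lee_fin enorm_sqr coord_sqr_le_dot.
Qed.

Lemma dot_integrable n (F G : T -> 'rV[R]_n) : L2v m F -> L2v m G ->
  m.-integrable setT (fun x => (dot (F x) (G x))%:E).
Proof.
move=> FL GL; rewrite /dot; under eq_fun do rewrite -sumEFin.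
by apply: integrable_sum => // i _; exact: Lfun_mul_integrable.
Qed.

End L2_facts.

Section finite_L2.
Context {R : realType} {disp} {T : measurableType disp}.
Variable m : probability T R.
Implicit Types f g : T -> R.

Lemma Lfun2_integrable f : f \in Lfun m 2%:E -> m.-integrable setT (EFin \o f).
Proof.
move=> fL; apply/Lfun1_integrable; apply: Lfun_subset12 fL.
exact: fin_num_measure.
Qed.

Lemma Lfun_ae_bounded f (C : R) : measurable_fun setT f ->
  {ae m, forall x, `|f x| <= C} -> f \in Lfun m 2%:E.
Proof.
move=> mf fC; apply/LfunP2; split=> //.
apply: (@le_lt_trans _ _ (\int[m]_x (C ^+ 2)%:E)%E).
  apply: ae_ge0_le_integral => //.
  - by move=> x _; rewrite lee_fin sqr_ge0.
  - by apply/measurable_EFinP; exact: measurable_funX.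
  - by move=> x _; rewrite lee_fin sqr_ge0.
  - apply: filterS fC => x fC _; rewrite lee_fin.
    by rewrite -(@real_normK _ (f x)) ?num_real// lerXn2r ?nnegrE// (le_trans _ fC).
by rewrite integral_cst// lte_mul_pinfty ?lee_fin ?sqr_ge0// ltey_eq fin_num_measure.
Qed.

(** The bound is asked almost everywhere because test functions are bounded on the cell, which has
    full Gibbs measure. *)
Lemma integrable_mul_ae_bounded f g (C : R) : measurable_fun setT g ->
  {ae m, forall x, `|g x| <= C} -> m.-integrable setT (EFin \o f) ->
  m.-integrable setT (fun x => (f x * g x)%:E).
Proof.
move=> mg gC fi; have /integrableP[/measurable_EFinP mf _] := fi.
have fCi : m.-integrable setT (fun x => (f x * C)%:E).
  by under eq_fun do rewrite EFinM; exact: integrableZr.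
have /integrableP[_ fC] := fCi.
apply/integrableP; split.
  by apply/measurable_EFinP; exact: measurable_funM.
apply: le_lt_trans fC; apply: ae_ge0_le_integral => //.
- by apply: measurableT_comp => //; apply/measurable_EFinP; exact: measurable_funM.
- by apply: measurableT_comp => //; apply/measurable_EFinP; exact: measurable_funM.
- apply: filterS gC => x gC _; rewrite lee_fin !normrM ler_wpM2l//.
  by rewrite (le_trans gC)// ler_norm.
Qed.

End finite_L2.

(** * Weak gradients expressed with the Gibbs measure *)

Section weak_gradients.
Context {R : realType} {d : nat} {S : geometry R} (phi : potential d S).
Implicit Types (u w theta f : 'rV[R]_d -> R) (G : 'rV[R]_d -> 'rV[R]_d).

Lemma smooth_expR : smooth (@expR R).
Proof.
by move=> k; elim: k => [|k IH]; [exact: continuous_expR|exact: (Ck_antiderivative (@is_derive_expR R))].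
Qed.

Lemma smooth_weight (s : R) : smooth (fun x => expR (s * phi x)).
Proof.
move=> k; rewrite -[fun x => _]/(expR \o (fun x => s * phi x)).
apply: Ck_comp; first exact: smooth_expR.
by apply: CkM; [exact: Ck_cst|exact: pot_smooth].
Qed.

Lemma periodic_weight (s : R) : Defs.periodic S (fun x => expR (s * phi x)).
Proof.
by case: S phi => // L psi x i; rewrite (pot_periodic psi).
Qed.

Lemma smooth_measurable f : smooth f -> measurable_fun setT f.
Proof. by move=> sf; exact: continuous_measurable_rV (smooth_continuous sf). Qed.

Lemma measurable_expR_pot : measurable_fun setT (fun x => expR (phi x)).
Proof. by apply: measurableT_comp => //; exact: smooth_measurable (pot_smooth phi). Qed.

(** Used with [s = -1], to cancel the factor [expR (phi x)] that [weak_gradP] attaches to test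
    functions. *)
Lemma test_weight theta (s : R) : test S theta ->
  test S (fun x => theta x * expR (s * phi x)).
Proof. by move=> tt; apply: testM => //; [exact: smooth_weight|exact: periodic_weight]. Qed.

Lemma Rintegral_cell_gibbs u f : measurable_fun setT u -> measurable_fun setT f ->
  \int[lebesgue_rV d]_(x in cell S) (u x * f x) =
  \int[gibbs phi]_x (u x * (f x * expR (phi x))).
Proof.
move=> mu mf; rewrite /Rintegral integral_gibbs; last first.
  apply: measurable_funM => //; apply: measurable_funM => //.
  exact: measurable_expR_pot.
congr fine; apply: eq_integral => x _.
by rewrite -!mulrA -expRD subrr expR0 mulr1.
Qed.

Lemma ae_bounded_cell f (M : R) : continuous f ->
  (forall x, cell S x -> M < enorm x -> f x = 0) ->
  exists C, {ae gibbs phi, forall x, `|f x| <= C}.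
Proof.
move=> cf fM; have [C _ hC] := bounded_on_cell cf fM.
by exists C; apply: filterS (ae_gibbs_cell phi) => x cx; exact: hC.
Qed.

Lemma Lfun_continuous f (M : R) : continuous f ->
  (forall x, cell S x -> M < enorm x -> f x = 0) -> f \in Lfun (gibbs phi) 2%:E.
Proof.
move=> cf fM; have [C hC] := ae_bounded_cell cf fM.
by apply: (Lfun_ae_bounded _ hC); exact: continuous_measurable_rV.
Qed.

Lemma continuous_expR_pot : continuous (fun x => expR (phi x)).
Proof.
have := smooth_continuous (smooth_weight 1).
by under eq_fun do rewrite mul1r.
Qed.

Lemma Lfun_test theta : test S theta ->
  (fun x => theta x * expR (phi x)) \in Lfun (gibbs phi) 2%:E.
Proof.
move=> [st _ [M tM]]; apply: (@Lfun_continuous _ M).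
  exact: continuous_mul (smooth_continuous st) continuous_expR_pot.
by move=> x cx Mx; rewrite tM// mul0r.
Qed.

Lemma Lfun_test_derive theta i : test S theta ->
  (fun x => 'D_(e_ i) theta x * expR (phi x)) \in Lfun (gibbs phi) 2%:E.
Proof.
move=> [st _ [M tM]]; apply: (@Lfun_continuous _ M).
  exact: continuous_mul (smooth_continuous (smooth_derive (e_ i) st)) continuous_expR_pot.
by move=> x cx Mx; rewrite (test_derive0 st tM)// mul0r.
Qed.

(** [weak_grad] integrates against Lebesgue measure, whereas the L^2 spaces are those of
    [gibbs phi]. The factor [expR (phi x)] passes from one to the other, and stays bounded against a
    test function. *)
Lemma weak_gradP u G : measurable_fun setT u ->
  (forall i, measurable_fun setT (fun x => G x ord0 i)) ->
  weak_grad S u G <-> forall theta, test S theta -> forall i,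
    \int[gibbs phi]_x (u x * ('D_(e_ i) theta x * expR (phi x))) =
    - \int[gibbs phi]_x (G x ord0 i * (theta x * expR (phi x))).
Proof.
move=> mu mG.
have E theta i : test S theta ->
   (\int[lebesgue_rV d]_(x in cell S) (u x * grad theta x ord0 i) =
   \int[gibbs phi]_x (u x * ('D_(e_ i) theta x * expR (phi x)))) /\
   (\int[lebesgue_rV d]_(x in cell S) (G x ord0 i * theta x) =
   \int[gibbs phi]_x (G x ord0 i * (theta x * expR (phi x)))).
  move=> [st _ _]; rewrite !Rintegral_cell_gibbs//.
  - by split => //; apply: eq_Rintegral => x _; rewrite mxE.
  - exact: smooth_measurable.
  - by under eq_fun do rewrite mxE; exact: (smooth_measurable (smooth_derive (e_ i) st)).
split=> h theta tt i; have [e1 e2] := E _ i tt.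
  by rewrite -e1 -e2; exact: h.
by rewrite e1 e2; exact: h.
Qed.

Lemma is_wgrad_lin (a : R) u w Gu Gw :
  is_wgrad (gibbs phi) (weak_grad S) u Gu -> is_wgrad (gibbs phi) (weak_grad S) w Gw ->
  is_wgrad (gibbs phi) (weak_grad S) (fun x => a * u x + w x) (fun x => a *: Gu x + Gw x).
Proof.
move=> [u2 Gu2 wu] [w2 Gw2 ww].
have u2w := Lfun2_lin a u2 w2.
have G2 : L2v (gibbs phi) (fun x => a *: Gu x + Gw x).
  by move=> i; under eq_fun do rewrite !mxE; exact: Lfun2_lin.
split=> //.
apply/weak_gradP => [|i|theta tt i]; [exact: Lfun_measurable u2w|exact: Lfun_measurable (G2 i)|].
have linI f g k : f \in Lfun (gibbs phi) 2%:E -> g \in Lfun (gibbs phi) 2%:E ->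
    k \in Lfun (gibbs phi) 2%:E ->
    \int[gibbs phi]_x ((a * f x + g x) * k x) =
    a * \int[gibbs phi]_x (f x * k x) + \int[gibbs phi]_x (g x * k x).
  move=> f2 g2 k2; have fk := Lfun_mul_integrable f2 k2; have gk := Lfun_mul_integrable g2 k2.
  rewrite -RintegralZl// -RintegralD//; last first.
    exact: (integrableZl measurableT a fk).
  by apply: eq_Rintegral => x _; rewrite mulrDl mulrA.
have := (weak_gradP (Lfun_measurable u2) (fun i => Lfun_measurable (Gu2 i))).1 wu _ tt i.
have := (weak_gradP (Lfun_measurable w2) (fun i => Lfun_measurable (Gw2 i))).1 ww _ tt i.
move=> hw hu; rewrite linI//; last exact: Lfun_test_derive.
rewrite hw hu mulrN -opprD -linI//; last exact: Lfun_test.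
by congr (- _); apply: eq_Rintegral => x _; rewrite !mxE.
Qed.

(** [theta * eta] is again a test function, so its derivative has zero integral: this is integration
    by parts. *)
Lemma is_wgrad_test theta : test S theta ->
  is_wgrad (gibbs phi) (weak_grad S) theta (grad theta).
Proof.
move=> tt; have [st pt [M tM]] := tt.
have cD i := smooth_continuous (smooth_derive (e_ i) st).
split.
- exact: (Lfun_continuous (smooth_continuous st) tM).
- move=> i; under eq_fun do rewrite mxE.
  by apply: (@Lfun_continuous _ M) => // x cx Mx; exact: (test_derive0 st tM).
move=> eta te i; have [se pe [N eN]] := te.
have tte := testM tt se pe.
have := test_integral_derive i tte.
have DM x : 'D_(e_ i) (fun x => theta x * eta x) x =
    theta x * grad eta x ord0 i + grad theta x ord0 i * eta x.
  rewrite !mxE [LHS]deriveM; [|apply: diff_derivable; exact: smooth_differentiable..].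
  by rewrite -![_ *: _]/(_ * _) mulrC [X in X + _ = _]mulrC [X in X + _]mulrC // (mulrC (eta x)).
under eq_integral do rewrite DM.
move=> h; apply/eqP; rewrite -addr_eq0 -RintegralD ?/Rintegral ?h//.
- exact: measurable_cell.
- apply: (@cell_integrable _ _ _ _ M); last by move=> x cx Mx; rewrite /= tM// mul0r.
  under eq_fun do rewrite mxE.
  exact: continuous_mul (smooth_continuous st) (smooth_continuous (smooth_derive (e_ i) se)).
- apply: (@cell_integrable _ _ _ _ N); last by move=> x cx Mx; rewrite /= eN// mulr0.
  under eq_fun do rewrite mxE.
  exact: continuous_mul (cD i) (smooth_continuous se).
Qed.

(** On R^d a nonzero constant is not a test function, so this case is separate; it rests directly on
    the zero integral of the derivative of a test function. *)
Lemma is_wgrad_cst (c : R) : is_wgrad (gibbs phi) (weak_grad S) (fun=> c) (fun=> 0).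
Proof.
split.
- exact: (Lfun_cst (gibbs phi) c 2).
- by move=> i; under eq_fun do rewrite mxE; exact: (Lfun_cst (gibbs phi) 0 2).
move=> theta tt i; have h := test_integral_derive i tt; have [st _ [M tM]] := tt.
rewrite [X in - X]/Rintegral integral0_eq => [|x _]; last by rewrite mxE mul0r.
rewrite oppr0; under eq_Rintegral do rewrite mxE.
rewrite RintegralZl ?/Rintegral ?h ?mulr0//; first exact: measurable_cell.
apply: (@cell_integrable _ _ _ _ M); last by move=> x cx Mx; exact: (test_derive0 st tM).
exact: (smooth_continuous (smooth_derive (e_ i) st)).
Qed.

End weak_gradients.

(** * Uniqueness of the weak gradient *)

Section halfspaces.
Context {R : realType} {d : nat}.

Definition corner (c : 'I_d -> R) : set 'rV[R]_d := [set x | forall i, x ord0 i < c i].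

Lemma corner_setI : setI_closed (range corner).
Proof.
move=> _ _ [c _ <-] [c' _ <-]; exists (fun i => Num.min (c i) (c' i)) => //.
apply/seteqP; split => x /=.
  by move=> h; split => i; have := h i; rewrite lt_min => /andP[].
by move=> [h h'] i; rewrite lt_min h h'.
Qed.

Lemma measurable_corner c : measurable (corner c).
Proof.
rewrite (_ : corner c = \bigcap_(i in [set: 'I_d])
    ((fun x : 'rV[R]_d => x ord0 i) @^-1` `]-oo, c i[%classic)); last first.
  apply/seteqP; split => [x cx i _|x cx i]; first by rewrite /= in_itv/=.
  by have := cx i I; rewrite /= in_itv.
apply: fin_bigcap_measurable => // i _.
by rewrite -[X in measurable X]setTI; exact: measurable_coord.
Qed.

Lemma corner_nat_cover : \bigcup_n corner (fun=> n%:R) = [set: 'rV[R]_d].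
Proof.
apply/seteqP; split => // x _.
have [n nx] : exists n : nat, \sum_i `|x ord0 i| < n%:R.
  exists (Num.truncn (\sum_i `|x ord0 i|)).+1; exact: truncnS_gt.
exists n => // i; apply: le_lt_trans nx; rewrite (le_trans (ler_norm _))//.
by rewrite (bigD1 i)//= lerDl sumr_ge0.
Qed.

(** A half-space bounding one coordinate is the union over [n] of the corners that bound the other
    coordinates by [n]. With [corner_setI], the corners are a pi-system generating the
    sigma-algebra. *)
Lemma measurable_rV_corner : (@measurable _ 'rV[R]_d) = <<s range corner >>.
Proof.
apply/seteqP; split; last first.
  apply: smallest_sub; first by split; [exact: measurable0|move=> A mA; rewrite setTD; exact: measurableC|move=> F mF; exact: bigcupT_measurable].
  by move=> _ [c _ <-]; exact: measurable_corner.
apply: smallest_sub; first exact: smallest_sigma_algebra.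
rewrite -bigcup_seq => A [i _ [B mB <-]]; rewrite setTI.
suff mc : measurable_fun [set: g_sigma_algebraType (range corner)]
    (fun x : g_sigma_algebraType (range corner) => (x : 'rV[R]_d) ord0 i).
  by have := mc measurableT B mB; rewrite setTI.
apply: (measurability _ (RGenInftyO.measurableE R)).
move=> _ [_ [y ->] <-]; rewrite setTI.
rewrite (_ : _ @^-1` _ = \bigcup_n corner (fun j => if j == i then y else n%:R)).
  by apply: bigcup_measurable => n _; apply: sub_sigma_algebra; exists (fun j => if j == i then y else n%:R).
apply/seteqP; split => x /=.
  rewrite in_itv/= => xy.
  have : (\bigcup_n corner (fun=> n%:R)) (x : 'rV[R]_d) by rewrite corner_nat_cover.
  by move=> [n _ xn]; exists n => // j; case: eqP => [->|_] //; exact: xn.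
by move=> [n _ /(_ i)]; rewrite eqxx in_itv.
Qed.

End halfspaces.

Section fundamental_lemma.
Context {R : realType} {d : nat} {S : geometry R} (phi : potential d S).
Implicit Types (u w theta f g : 'rV[R]_d -> R) (G : 'rV[R]_d -> 'rV[R]_d).
Local Notation P := (gibbs phi).

Lemma cvg_prod_seq n (u_ : 'I_n -> nat -> R) (l : 'I_n -> R) :
  (forall i, u_ i k @[k --> \oo] --> l i) ->
  \prod_i u_ i k @[k --> \oo] --> \prod_i l i.
Proof.
move=> ul; elim: (index_enum _) => [|i r IH].
  by under eq_fun do rewrite big_nil; rewrite big_nil; exact: cvg_cst.
under eq_fun do rewrite big_cons; rewrite big_cons; apply: cvgM => //.
Qed.

Lemma prod_halfline (c : 'I_d -> R) (x : 'rV[R]_d) :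
  \prod_i halfline (c i) (x ord0 i) = \1_(corner c) x.
Proof.
rewrite indicE; case: (boolP (x \in corner c)); rewrite ?inE ?notin_setE => h.
  by rewrite big1// => i _; rewrite /halfline h.
have [i] : exists i, ~ (x ord0 i < c i) by apply/existsNP.
by move=> /negP xi; rewrite (bigD1 i)//= /halfline (negbTE xi) mul0r.
Qed.

(** Products of one-dimensional windows converge to the indicator of the corner at each point of the
    cell, hence almost everywhere; dominated convergence does the rest. *)
Lemma integral_corner (c : 'I_d -> R) :
  exists2 t : nat -> 'rV[R]_d -> R, forall n, test S (t n) &
    forall f, P.-integrable setT (EFin \o f) ->
    \int[P]_x (f x * t n x) @[n --> \oo] --> \int[P]_(x in corner c) f x.
Proof.
have /choice[w hw] : forall i, exists w : nat -> R -> R,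
    (forall n, window_spec S (w n)) /\
    (forall y, cell1 S y -> w n y @[n --> \oo] --> halfline (c i) y).
  by move=> i; have [w w1 w2] := cvg_window S (c i); exists w.
pose t n (x : 'rV[R]_d) := \prod_i w i n (x ord0 i).
have tt n : test S (t n) by apply: (@test_window_prod R d S (fun i => w i n)) => i; have [] := hw i.
have mt n : measurable_fun setT (t n).
  by have [st _ _] := tt n; exact: smooth_measurable.
have t01 n x : 0 <= t n x <= 1.
  rewrite prodr_ge0 => [|i _]; last by have [h _] := hw i; have [_ /(_ (x ord0 i))/andP[]] := h n.
  rewrite prodr_ile1// => i _; have [h _] := hw i; by have [_ /(_ (x ord0 i))] := h n.
exists t => // f fi; have /integrableP[/measurable_EFinP mf _] := fi.
have [] := @dominated_convergence _ _ _ P setT measurableT (fun n x => (f x * t n x)%:E)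
   (fun x => (f x * \1_(corner c) x)%:E) (fun x => (`|f x|)%:E).
- by move=> n; apply/measurable_EFinP; exact: measurable_funM.
- apply/measurable_EFinP; apply: measurable_funM => //.
  by apply: measurable_indic; exact: measurable_corner.
- apply: filterS (ae_gibbs_cell phi) => x cx _; apply: cvg_EFin; first exact: nearW.
  apply: cvgM; first exact: cvg_cst.
  rewrite -prod_halfline; apply: cvg_prod_seq => i; have [_] := hw i; apply.
  by case: (S) cx => [|L] //= /(_ i).
- exact: (integrable_norm fi).
- apply: aeW => x n _; rewrite lee_fin normrM ler_piMr//.
  by have /andP[t0 t1] := t01 n x; rewrite ger0_norm.
move=> fci _ h.
have -> : \int[P]_(x in corner c) f x = \int[P]_x (f x * \1_(corner c) x).
  rewrite Rintegral_mkcond; apply: eq_Rintegral => x _.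
  by rewrite patchE indicE; case: ifP; rewrite ?mulr1 ?mulr0.
apply: fine_cvg; rewrite fineK//.
exact: integrable_fin_num fci.
Qed.

(** The fundamental lemma of the calculus of variations, without convolution: test functions reach
    the indicators of corners, and Dynkin's theorem extends the equality of integrals from corners
    to all measurable sets. *)
Lemma test_ae_eq f g : P.-integrable setT (EFin \o f) -> P.-integrable setT (EFin \o g) ->
  (forall theta, test S theta -> \int[P]_x (f x * theta x) = \int[P]_x (g x * theta x)) ->
  {ae P, forall x, f x = g x}.
Proof.
move=> fi gi fg.
have fiA A : measurable A -> P.-integrable A (EFin \o f) by move=> mA; exact: integrableS fi.
have giA A : measurable A -> P.-integrable A (EFin \o g) by move=> mA; exact: integrableS gi.
have EfinP A : measurable A -> \int[P]_(x in A) f x = \int[P]_(x in A) g x <->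
    (\int[P]_(x in A) (f x)%:E = \int[P]_(x in A) (g x)%:E)%E.
  move=> mA; split=> [h|h]; last by rewrite /Rintegral h.
  rewrite -[LHS]fineK; last exact: integrable_fin_num (fiA A mA).
  rewrite -[RHS]fineK; last exact: integrable_fin_num (giA A mA).
  by congr (_%:E).
have eqc c : \int[P]_(x in corner c) f x = \int[P]_(x in corner c) g x.
  have [t tt ht] := integral_corner c.
  have hf := ht _ fi; have hg := ht _ gi.
  rewrite (_ : (fun n => _) = (fun n => \int[P]_x (g x * t n x))) in hf; last first.
    by apply/funext => n; rewrite fg.
  exact: (cvg_unique _ hf hg).
(* The whole space is the increasing union of the corners with all bounds [n]; equality over it
   serves complements in the Dynkin induction. *)
have cvgT (k : 'rV[R]_d -> R) : P.-integrable setT (EFin \o k) ->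
    \int[P]_(x in corner (fun=> n%:R)) k x @[n --> \oo] --> \int[P]_x k x.
  move=> ki; have /integrableP[/measurable_EFinP mk _] := ki.
  have [] := @dominated_convergence _ _ _ P setT measurableT
    (fun n x => (k x * \1_(corner (fun=> n%:R)) x)%:E) (EFin \o k) (fun x => (`|k x|)%:E).
  - move=> n; apply/measurable_EFinP; apply: measurable_funM => //.
    by apply: measurable_indic; exact: measurable_corner.
  - exact/measurable_EFinP.
  - apply: aeW => x _; apply: cvg_EFin; first exact: nearW.
    have : (\bigcup_n corner (fun=> n%:R)) x by rewrite corner_nat_cover.
    move=> [n0 _ xn0]; apply: (@cvg_trans _ (k x @[n --> \oo])); last exact: cvg_cst.
    apply: near_eq_cvg; near=> n; rewrite /= indicE mem_set ?mulr1// => i.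
    rewrite (lt_le_trans (xn0 i))// ler_nat; near: n; exact: nbhs_infty_ge.
  - exact: (integrable_norm ki).
  - apply: aeW => x n _; rewrite lee_fin normrM ler_piMr//.
    by rewrite indicE; case: (_ \in _); rewrite ?normr1 ?normr0.
  move=> _ _ h.
  have e n : \int[P]_(x in corner (fun=> n%:R)) k x =
      fine (\int[P]_x (k x * \1_(corner (fun=> n%:R)) x)%:E)%E.
    rewrite Rintegral_mkcond; congr fine; apply: eq_integral => x _.
    by rewrite patchE indicE; case: ifP; rewrite ?mulr1 ?mulr0.
  under eq_fun do rewrite e.
  by apply: fine_cvg; rewrite fineK//; exact: integrable_fin_num ki.
have eqT : \int[P]_x f x = \int[P]_x g x.
  have hf := cvgT _ fi; rewrite (_ : (fun n => _) = (fun n =>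
    \int[P]_(x in corner (fun=> n%:R)) g x)) in hf; last by apply/funext => n; rewrite eqc.
  exact: (cvg_unique _ hf (cvgT _ gi)).
have eqA A : measurable A -> (\int[P]_(x in A) (f x)%:E = \int[P]_(x in A) (g x)%:E)%E.
  move=> mA; rewrite measurable_rV_corner in mA.
  apply: (@dynkin_induction _ _ (range corner) (fun A =>
    (\int[P]_(x in A) (f x)%:E = \int[P]_(x in A) (g x)%:E)%E)) mA => //.
  - exact: measurable_rV_corner.
  - exact: corner_setI.
  - exact/EfinP.
  - by move=> _ [c _ <-]; apply/EfinP; [exact: measurable_corner|exact: eqc].
  - move=> B mB /(EfinP _ mB) eB; apply/(EfinP _ (measurableC mB)).
    have split k : P.-integrable setT (EFin \o k) ->
        \int[P]_(x in ~` B) k x = \int[P]_x k x - \int[P]_(x in B) k x.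
      move=> ki; rewrite -(setUv B) Rintegral_setU//.
      + by rewrite addrAC subrr add0r.
      + exact: measurableC.
      + by rewrite setUv.
      + by apply/disj_set2P; rewrite setICr.
    by rewrite !split// eqT eB.
  - move=> F mF tF eF; have mU := bigcupT_measurable _ mF.
    rewrite !integral_bigcup//; [|exact: giA|exact: fiA].
    by apply: eq_eseriesr => n _; exact: eF.
have := @integral_ae_eq _ _ _ P setT measurableT (EFin \o g) (EFin \o f) fi (measurable_int _ gi).
move=> /(_ (fun E _ mE => eqA E mE)); apply: filterS => x /(_ I)[].
by [].
Unshelve. all: by end_near. Qed.

(** Gives access to [wgrad], which is taken by choice: any known weak gradient agrees with it almost
    everywhere. *)
Lemma is_wgrad_ae_eq u G G' : is_wgrad P (weak_grad S) u G -> is_wgrad P (weak_grad S) u G' ->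
  {ae P, forall x, G x = G' x}.
Proof.
move=> [u2 G2 wG] [_ G'2 wG'].
have mG i := Lfun_measurable (G2 i); have mG' i := Lfun_measurable (G'2 i).
have hi i : {ae P, forall x, G x ord0 i = G' x ord0 i}.
  apply: test_ae_eq; [exact: Lfun2_integrable|exact: Lfun2_integrable|].
  move=> theta tt; have tt' := test_weight phi (-1) tt.
  have E (H : 'rV[R]_d -> 'rV[R]_d) : \int[P]_x (H x ord0 i * theta x) =
      \int[P]_x (H x ord0 i * (theta x * expR (-1 * phi x) * expR (phi x))).
    by apply: eq_Rintegral => x _; rewrite -[_ * expR (phi x)]mulrA -expRD mulN1r addNr expR0 mulr1.
  rewrite !E.
  have := (weak_gradP phi (Lfun_measurable u2) mG).1 wG _ tt' i.
  have := (weak_gradP phi (Lfun_measurable u2) mG').1 wG' _ tt' i.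
  by move=> -> /oppr_inj.
have := @filter_forall _ _ _ _ (ae_filter_ringOfSetsType P) hi.
by apply: filterS => x h; apply/rowP.
Qed.

Lemma wgradP u G : is_wgrad P (weak_grad S) u G ->
  is_wgrad P (weak_grad S) u (wgrad P (weak_grad S) u).
Proof. by move=> uG; rewrite /wgrad; apply: xgetPex; exists G. Qed.

Lemma wgrad_ae u G : is_wgrad P (weak_grad S) u G ->
  {ae P, forall x, wgrad P (weak_grad S) u x = G x}.
Proof. by move=> uG; apply: is_wgrad_ae_eq (wgradP uG) uG. Qed.

End fundamental_lemma.

Lemma measurable_pairing {d d1 d2} {T : measurableType d} {T1 : measurableType d1}
  {T2 : measurableType d2} (f : T -> T1) (g : T -> T2) :
  measurable_fun setT f -> measurable_fun setT g -> measurable_fun setT (fun x => (f x, g x)).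
Proof. by move=> mf mg; apply/measurable_fun_pairP. Qed.

(** * Changes of variables: time translation and reassociation of products *)

Section transfer.
Context {R : realType}.
Local Open Scope ereal_scope.

(** The integral of a nonnegative function is a supremum over the simple functions below it, hence
    monotone for arbitrary functions. It is applied to the dual norm in [L2Hm1_sqnorm]. *)
Lemma ge0_le_integral_nonmeasurable d (T : measurableType d) (m : {measure set T -> \bar R})
  (f g : T -> \bar R) : (forall x, 0 <= f x) -> (forall x, f x <= g x) ->
  \int[m]_x f x <= \int[m]_x g x.
Proof.
move=> f0 fg; have g0 x : 0 <= g x by exact: le_trans (f0 x) (fg x).
rewrite !ge0_integralTE//; apply: ereal_sup_le => _ [h hf <-].
by exists h => // x; exact: le_trans (hf x) (fg x).
Qed.

Context {d1 d2} {T1 : measurableType d1} {T2 : measurableType d2}.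
Variables (m1 : {measure set T1 -> \bar R}) (m2 : {measure set T2 -> \bar R}).
Variables (g : T1 -> T2) (D : set T2) (c : R).
Hypotheses (mg : measurable_fun setT g) (mD : measurable D) (c0 : (0 <= c)%R).
Hypothesis m12 : forall f : T2 -> \bar R, measurable_fun setT f -> (forall x, 0 <= f x) ->
  \int[m1]_x f (g x) = c%:E * \int[m2]_(x in D) f x.

(** The section works from the identity [m12] for nonnegative functions, so as to serve both the
    translation of a window, with [c = tau^-1], and the reassociation of a product, with [c = 1]. *)
Lemma integrable_transfer (f : T2 -> R) : measurable_fun setT f ->
  m2.-integrable D (EFin \o f) -> m1.-integrable setT (fun x => (f (g x))%:E).
Proof.
move=> mf /integrableP[_ fi]; apply/integrableP; split.
  by apply/measurable_EFinP; exact: measurableT_comp.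
rewrite (m12 (f := fun x => `|(f x)%:E|))//.
  by rewrite lte_mul_pinfty// lee_fin.
by apply: measurableT_comp => //; exact/measurable_EFinP.
Qed.

Lemma Rintegral_transfer (f : T2 -> R) : measurable_fun setT f ->
  m2.-integrable D (EFin \o f) -> (\int[m1]_x f (g x) = c * \int[m2]_(x in D) f x)%R.
Proof.
move=> mf fi; have mf' : measurable_fun setT (EFin \o f) by exact/measurable_EFinP.
rewrite /Rintegral integralE.
have -> : (fun x => (f (g x))%:E)^\+ = (EFin \o f)^\+ \o g by exact: funepos_comp.
have -> : (fun x => (f (g x))%:E)^\- = (EFin \o f)^\- \o g by exact: funeneg_comp.
rewrite (m12 (f := (EFin \o f)^\+)) ?(m12 (f := (EFin \o f)^\-))//; last 2 first.
- exact: measurable_funeneg.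
- exact: measurable_funepos.
have pf := integrable_pos_fin_num mD fi; have nf := integrable_neg_fin_num mD fi.
rewrite -[(EFin \o f)^\+]/((fun x => (f x)%:E)^\+) in pf *.
rewrite [in RHS]integralE -muleBr//; last by rewrite fin_num_adde_defl// fin_numN.
by rewrite fineM// fin_numB pf nf.
Qed.

Lemma null_transfer (N : set T2) : measurable N -> m2 (N `&` D) = 0 -> m1 (g @^-1` N) = 0.
Proof.
move=> mN N0.
have mgN : measurable (g @^-1` N) by rewrite -[X in measurable X]setTI; exact: mg.
rewrite -[g @^-1` N]setIT -integral_indic//.
rewrite [LHS](_ : _ = \int[m1]_x (fun y => (\1_N y)%:E) (g x))//.
rewrite (m12 (f := fun y => (\1_N y)%:E)).
- by rewrite integral_indic// N0 mule0.
- by apply/measurable_EFinP; exact: measurable_indic.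
- by move=> x; rewrite lee_fin indicE ler0n.
Qed.

Lemma ae_transfer (A : T2 -> Prop) : {ae m2, forall x, D x -> A x} ->
  {ae m1, forall x, A (g x)}.
Proof.
move=> [N [mN N0 AN]]; exists (g @^-1` (N `|` ~` D)); split.
- rewrite -[X in measurable X]setTI; apply: mg => //.
  by apply: measurableU => //; exact: measurableC.
- apply: null_transfer; first by apply: measurableU => //; exact: measurableC.
  rewrite setIUl setICl setU0; apply: (subset_measure0 _ _ _ N0) => //.
  exact: measurableI.
- move=> x /= nA; have [Dx|nD] := pselect (D (g x)); last by right.
  by left; apply: AN => /= /(_ Dx).
Qed.

End transfer.

Section uniform_shift.
Context {R : realType} (tau : R) (htau : 0 < tau) (t0 : R).
Local Open Scope ereal_scope.
Let leb : {measure set (measurableTypeR R) -> \bar R} := lebesgue_measure.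
Let U : {measure set (measurableTypeR R) -> \bar R} := uniform_prob htau.

Definition translation (t : measurableTypeR R) : measurableTypeR R := (t0 + t)%R.

Lemma measurable_translation : measurable_fun setT translation.
Proof. by apply: measurable_funD. Qed.

HB.instance Definition _ := isMeasurableFun.Build _ _ _ _ translation measurable_translation.

(** The two measures agree on the intervals []a, b]], which determine Lebesgue measure. *)
Lemma lebesgue_measure_translation (A : set R) : measurable A ->
  pushforward leb translation A = leb A.
Proof.
move=> mA; apply/esym/lebesgue_measure_unique => //= _ [[a b]] _ <-.
rewrite /pushforward (_ : translation @^-1` _ = `](a - t0)%R, (b - t0)%R]%classic).
  rewrite /leb /= !lebesgue_measure_itv/= !lte_fin ltrD2r.
  by case: ifP => // _; rewrite -!EFinB opprB addrA subrK.
by apply/seteqP; split => t /=; rewrite /translation !in_itv/= ltrBlDl lerBrDl.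
Qed.

Lemma ge0_integral_lebesgue_translation (a b : R) (f : R -> \bar R) :
  measurable_fun setT f -> (forall t, 0 <= f t) ->
  \int[leb]_(t in `[a, b]) f (t0 + t)%R = \int[leb]_(t in `[(t0 + a)%R, (t0 + b)%R]) f t.
Proof.
move=> mf f0.
rewrite (_ : `[a, b]%classic = translation @^-1` `[(t0 + a)%R, (t0 + b)%R]); last first.
  by apply/seteqP; split => t /=; rewrite /translation !in_itv/= !lerD2l.
rewrite -[LHS](@ge0_integral_pushforward _ _ _ _ _ _ measurable_translation leb _ f)//; last first.
  exact: measurable_funTS.
by apply: eq_measure_integral => //= A mA AS; exact: lebesgue_measure_translation.
Qed.

Lemma ge0_integral_uniform_translation (f : R -> \bar R) :
  measurable_fun setT f -> (forall t, 0 <= f t) ->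
  \int[U]_t f (t0 + t)%R = (tau^-1)%:E * \int[leb]_(t in `[t0, (t0 + tau)%R]) f t.
Proof.
move=> mf f0; rewrite /U integral_uniform//; last first.
  exact: (measurableT_comp mf measurable_translation).
by rewrite subr0 ge0_integral_lebesgue_translation// addr0.
Qed.

Context {d2} {Y : measurableType d2} (M : probability Y R).

Lemma ge0_integral_slab (A : set (measurableTypeR R)) (f : measurableTypeR R * Y -> \bar R) :
  measurable A -> measurable_fun setT f -> (forall z, 0 <= f z) ->
  \int[(lebesgue_measure \x M)]_(z in A `*` setT) f z =
  \int[lebesgue_measure]_(t in A) \int[M]_y f (t, y).
Proof.
move=> mA mf f0; rewrite integral_mkcond fubini_tonelli1//; last 2 first.
- apply/(measurable_restrictT _ _).1 => //; first exact: measurableX.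
  exact: measurable_funTS.
- by move=> z; rewrite patchE; case: ifP.
rewrite [RHS]integral_mkcond; apply: eq_integral => t _; rewrite patchE /fubini_F.
case: ifPn => tI.
  by apply: eq_integral => y _; rewrite patchE in_setX tI in_setT.
rewrite integral0_eq// => y _; by rewrite patchE in_setX (negbTE tI).
Qed.

Lemma ge0_integral_uniform_prod_translation (f : measurableTypeR R * Y -> \bar R) :
  measurable_fun setT f -> (forall z, 0 <= f z) ->
  \int[(uniform_prob htau \x M)]_z f ((t0 + z.1)%R, z.2) =
  (tau^-1)%:E * \int[(lebesgue_measure \x M)]_(z in `[t0, (t0 + tau)%R] `*` setT) f z.
Proof.
move=> mf f0; rewrite fubini_tonelli1//; last first.
  apply: (measurableT_comp mf); apply: measurable_pairing; last exact: measurable_snd.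
  exact: (measurableT_comp measurable_translation measurable_fst).
rewrite [LHS](_ : _ = \int[U]_t (fubini_F M f) (t0 + t)%R)//.
rewrite (ge0_integral_uniform_translation (f := fubini_F M f)); last 2 first.
- exact: measurable_fun_fubini_tonelli_F.
- by move=> t; exact: integral_ge0.
by rewrite ge0_integral_slab.
Qed.

End uniform_shift.

Section associativity.
Context {R : realType} {d1 d2 d3} {T1 : measurableType d1} {T2 : measurableType d2}
  {T3 : measurableType d3}.
Local Open Scope ereal_scope.

(** [UgibbsXV] is nested as [U (x) (mu (x) gamma)], whereas velocity slices over [(t, x)] call for
    [(U (x) mu) (x) gamma]. *)
Definition unassoc (z : T1 * T2 * T3) : T1 * (T2 * T3) := (z.1.1, (z.1.2, z.2)).

Lemma measurable_unassoc : measurable_fun setT unassoc.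
Proof.
apply: measurable_pairing; first exact: (measurableT_comp measurable_fst measurable_fst).
apply: measurable_pairing; last exact: measurable_snd.
exact: (measurableT_comp measurable_snd measurable_fst).
Qed.

Variables (m1 : probability T1 R) (m2 : probability T2 R) (m3 : probability T3 R).
Variables (m12 : probability (T1 * T2)%type R) (m23 : probability (T2 * T3)%type R).
Variables (m123 : probability (T1 * (T2 * T3))%type R).
Hypothesis m12E : m12 = (m1 \x m2) :> (set (T1 * T2) -> \bar R).
Hypothesis m23E : m23 = (m2 \x m3) :> (set (T2 * T3) -> \bar R).
Hypothesis m123E : m123 = (m1 \x m23) :> (set (T1 * (T2 * T3)) -> \bar R).

Lemma ge0_integral_assoc (f : T1 * (T2 * T3) -> \bar R) : measurable_fun setT f ->
  (forall z, 0 <= f z) ->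
  \int[m123]_z f z = \int[m12]_p \int[m3]_v f (p.1, (p.2, v)).
Proof.
move=> mf f0.
have mfu : measurable_fun setT (f \o unassoc) by exact: measurableT_comp measurable_unassoc.
have mF := measurable_fun_fubini_tonelli_F (m2 := m3) (f \o unassoc) mfu (fun z => f0 _).
rewrite m12E m123E [LHS]fubini_tonelli1// [RHS]fubini_tonelli1//; last first.
  by move=> p; exact: integral_ge0.
apply: eq_integral => t _; transitivity (\int[(m2 \x m3)]_y f (t, y)); first by rewrite -m23E.
rewrite fubini_tonelli1//.
by apply: (measurableT_comp mf); apply: measurable_pairing => //; exact: measurable_cst.
Qed.

Lemma ge0_integral_unassoc (f : T1 * (T2 * T3) -> \bar R) : measurable_fun setT f ->
  (forall z, 0 <= f z) ->
  \int[(m12 \x m3)]_z f (unassoc z) = 1%:E * \int[m123]_(z in setT) f z.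
Proof.
move=> mf f0; rewrite mul1e ge0_integral_assoc//.
rewrite [LHS](fubini_tonelli1 (f \o unassoc))//.
  exact: measurableT_comp measurable_unassoc.
by move=> z; exact: f0.
Qed.

End associativity.

Lemma continuous_compose (T U V : topologicalType) (f : T -> U) (g : U -> V) :
  continuous f -> continuous g -> continuous (fun x => g (f x)).
Proof. by move=> cf cg x; apply: continuous_comp; [exact: cf|exact: cg]. Qed.

(** * Test functions on phase space *)

Section phase_space.
Context {R : realType} {d : nat}.
Local Notation X := 'rV[R]_d.
Local Notation space := (R * (X * X))%type.
Implicit Types (theta f : space -> R).

Lemma continuous_row_mx_decode (n1 n2 : nat) :
  continuous (fun x : 'rV[R]_(n1 + n2) => lsubmx x) /\
  continuous (fun x : 'rV[R]_(n1 + n2) => rsubmx x).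
Proof.
by split; apply: continuous_rV => i; under eq_fun do rewrite mxE; exact: coord_continuous.
Qed.

(* Continuity gives measurability only on ['rV_n], whose sigma-algebra is generated
   by the coordinates; functions on phase space are transported there. *)
Definition decode (x : 'rV[R]_(1 + (d + d))) : space :=
  (lsubmx x ord0 ord0, (lsubmx (rsubmx x), rsubmx (rsubmx x))).

Definition encode (z : space) : 'rV[R]_(1 + (d + d)) :=
  row_mx (const_mx z.1) (row_mx z.2.1 z.2.2).

Lemma encodeK : cancel encode decode.
Proof.
by move=> [t [x v]]; rewrite /decode /encode /= !row_mxKr !row_mxKl mxE.
Qed.

Lemma continuous_pairing (T U V : topologicalType) (f : T -> U) (g : T -> V) :
  continuous f -> continuous g -> continuous (fun x => (f x, g x)).
Proof. by move=> cf cg x; apply: cvg_pair; [exact: cf|exact: cg]. Qed.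

Lemma continuous_decode : continuous decode.
Proof.
have [cl cr] := continuous_row_mx_decode 1 (d + d).
have [cl' cr'] := continuous_row_mx_decode d d.
apply: continuous_pairing.
  by under eq_fun do rewrite mxE; exact: coord_continuous.
by apply: continuous_pairing; [exact: (continuous_compose cr cl')|exact: (continuous_compose cr cr')].
Qed.

Lemma measurable_encode :
  measurable_fun [set: (measurableTypeR R * (X * X))%type] (encode : _ -> 'rV[R]_(1 + (d + d))).
Proof.
apply: measurable_fun_rV => i; case: (splitP i) => j ij.
  have -> : i = lshift _ j by apply/ord_inj.
  by under eq_fun do rewrite row_mxEl mxE; exact: measurable_fst.
have -> : i = rshift _ j by apply/ord_inj.
under eq_fun do rewrite row_mxEr.
case: (splitP j) => k jk.
  have -> : j = lshift _ k by apply/ord_inj.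
  under eq_fun do rewrite row_mxEl.
  apply: (measurableT_comp (measurable_coord k)).
  exact: (measurableT_comp measurable_fst measurable_snd).
have -> : j = rshift _ k by apply/ord_inj.
under eq_fun do rewrite row_mxEr.
apply: (measurableT_comp (measurable_coord k)).
exact: (measurableT_comp measurable_snd measurable_snd).
Qed.

Lemma continuous_measurable_phase f : continuous f ->
  measurable_fun [set: (measurableTypeR R * (X * X))%type] f.
Proof.
move=> cf; rewrite (_ : f = (f \o decode) \o encode); last first.
  by apply/funext => z; rewrite /= encodeK.
apply: measurableT_comp; last exact: measurable_encode.
apply: continuous_measurable_rV => x; apply: continuous_comp; last exact: cf.
exact: continuous_decode.
Qed.

Lemma phase_bounded f (M : R) : continuous f ->
  exists2 C, 0 <= C & forall t x v, `|t| <= M -> enorm x <= M -> enorm v <= M ->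
    `|f (t, (x, v))| <= C.
Proof.
move=> cf.
have cK : compact ([set t : R | `|t| <= M] `*` (@cube R d M `*` @cube R d M)).
  apply: compact_setX; last by apply: compact_setX; exact: compact_cube.
  rewrite (_ : [set _ | _] = `[- M, M]%classic); first exact: segment_compact.
  by apply/seteqP; split => t /=; rewrite in_itv/= ler_norml.
have [C C0 hC] := continuous_compact_bounded cK cf.
exists C => // t x v tM xM vM; apply: hC; split => //.
by split; exact: enorm_cube.
Qed.

Context (SX SV : geometry R).

Definition phase_vanish (M : R) f := forall t x v, cell SX x -> cell SV v ->
  [|| M < `|t|, M < enorm x | M < enorm v] -> f (t, (x, v)) = 0.

Lemma phase_vanish_bounded f (M : R) : continuous f -> phase_vanish M f ->
  exists2 C, 0 <= C & forall t x v, cell SX x -> cell SV v -> `|f (t, (x, v))| <= C.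
Proof.
move=> cf fM; have [C C0 hC] := phase_bounded M cf.
exists C => // t x v cx cv.
have [|] := boolP [|| M < `|t|, M < enorm x | M < enorm v].
  by move=> h; rewrite fM// normr0.
by rewrite !negb_or -!leNgt => /and3P[? ? ?]; exact: hC.
Qed.

(** The three strict inequalities are open conditions, and [hb] and [hc] keep small positive steps
    in the cells, so [derive_right0] applies along [(a, (b, c))]. *)
Lemma phase_vanish_derive f (M : R) (a : R) (b c : X) : smooth f ->
  (forall x, cell SX x -> \forall h \near (0 : R)^'+, cell SX (h *: b + x)) ->
  (forall x, cell SV x -> \forall h \near (0 : R)^'+, cell SV (h *: c + x)) ->
  phase_vanish M f -> phase_vanish M ('D_((a, (b, c)) : space) f).
Proof.
move=> sf hb hc fM t x v cx cv hM.
apply: derive_right0.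
- by apply: diff_derivable; exact: smooth_differentiable.
- exact: fM.
have near_out : \forall h \near (0 : R)^'+,
    [|| M < `|h * a + t|, M < enorm (h *: b + x) | M < enorm (h *: c + v)].
  case/or3P: hM => [tM|xM|vM].
  - have : `|h * a + t| @[h --> (0 : R)] --> `|t|.
      rewrite (_ : `|t| = `|0 * a + t|); last by rewrite mul0r add0r.
      by apply: cvg_norm; apply: cvgD; [apply: cvgM; [exact: cvg_id|]|]; exact: cvg_cst.
    move=> /cvg_at_right_filter/cvgr_gt/(_ _ tM); apply: filterS => h -> //.
  - by move/enorm_add_near : xM => /(_ b); apply: filterS => h ->; rewrite orbT.
  - by move/enorm_add_near : vM => /(_ c); apply: filterS => h ->; rewrite !orbT.
near=> h.
have -> : h *: ((a, (b, c)) : space) + (t, (x, v)) = (h * a + t, (h *: b + x, h *: c + v)) by [].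
apply: fM; near: h; [exact: hb|exact: hc|exact: near_out].
Unshelve. all: by end_near. Qed.

Lemma cell_add0 S (x : X) : cell S x -> \forall h \near (0 : R)^'+, cell S (h *: (0 : X) + x).
Proof. by move=> cx; apply: nearW => h; rewrite scaler0 add0r. Qed.

Lemma phase_vanish_grad_x f (M : R) i : smooth f -> phase_vanish M f ->
  phase_vanish M (fun z => grad_x f z ord0 i).
Proof.
move=> sf fM t x v cx cv hM; rewrite mxE.
apply: (@phase_vanish_derive f M 0 (e_ i) 0) => //.
- by move=> y; exact: cell_add_e.
- by move=> y; exact: cell_add0.
Qed.

Lemma phase_vanish_grad_v f (M : R) i : smooth f -> phase_vanish M f ->
  phase_vanish M (fun z => grad_v f z ord0 i).
Proof.
move=> sf fM t x v cx cv hM; rewrite mxE.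
apply: (@phase_vanish_derive f M 0 0 (e_ i)) => //.
- by move=> y; exact: cell_add0.
- by move=> y; exact: cell_add_e.
Qed.

Lemma phase_vanish_t f (M : R) : smooth f -> phase_vanish M f ->
  phase_vanish M ('D_((1, (0, 0)) : space) f).
Proof.
by move=> sf fM; apply: phase_vanish_derive => // y; exact: cell_add0.
Qed.

Lemma continuous_grad_x f i : smooth f -> continuous (fun z => grad_x f z ord0 i).
Proof. by move=> sf; under eq_fun do rewrite mxE; exact: (smooth_continuous (smooth_derive _ sf)). Qed.

Lemma continuous_grad_v f i : smooth f -> continuous (fun z => grad_v f z ord0 i).
Proof. by move=> sf; under eq_fun do rewrite mxE; exact: (smooth_continuous (smooth_derive _ sf)). Qed.

Context (phi : potential d SX) (psi : potential d SV).

Lemma continuous_grad (S : geometry R) (p : potential d S) i :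
  continuous (fun x => grad p x ord0 i).
Proof.
under eq_fun do rewrite mxE.
exact: (smooth_continuous (smooth_derive _ (pot_smooth p))).
Qed.

Lemma continuous_velocity : continuous (fun z : space => z.2.2).
Proof. by move=> z; apply: (cvg_comp snd snd); exact: cvg_snd. Qed.

Lemma continuous_position : continuous (fun z : space => z.2.1).
Proof. by move=> z; apply: (cvg_comp snd fst); [exact: cvg_snd|exact: cvg_fst]. Qed.

Lemma continuous_transport theta : smooth theta -> continuous (transport phi psi theta).
Proof.
move=> st z; apply: cvgB; first apply: cvgD.
- exact: (smooth_continuous (smooth_derive ((1, (0, 0)) : space) st)).
- apply: (continuous_dot (f := fun z : space => grad psi z.2.2)) => i; last exact: continuous_grad_x.
  exact: (continuous_compose continuous_velocity (@continuous_grad SV psi i)).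
- apply: (continuous_dot (f := fun z : space => grad phi z.2.1)) => i; last exact: continuous_grad_v.
  exact: (continuous_compose continuous_position (@continuous_grad SX phi i)).
Qed.

Lemma phase_vanish_transport theta (M : R) : smooth theta -> phase_vanish M theta ->
  phase_vanish M (transport phi psi theta).
Proof.
move=> st tM t x v cx cv hM; rewrite /transport (phase_vanish_t st tM)// add0r.
have -> : grad_x theta (t, (x, v)) = 0.
  by apply/rowP => i; rewrite [RHS]mxE; exact: (phase_vanish_grad_x i st tM cx cv hM).
have -> : grad_v theta (t, (x, v)) = 0.
  by apply/rowP => i; rewrite [RHS]mxE; exact: (phase_vanish_grad_v i st tM cx cv hM).
by rewrite !dot0r subr0.
Qed.

Lemma is_diff_slice (t : R) (x v : X) :
  is_diff v (fun v => (t, (x, v)) : space) (fun w => (0, (0, w)) : space).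
Proof.
exact: (is_diff_pair (is_diff_cst t v) (is_diff_pair (is_diff_cst x v) (is_diff_id v))).
Qed.

(** The support condition of [test_txv] speaks of positions in the cell only, whence the condition
    on [p.2]. *)
Lemma test_slice theta p : @test_txv R d SX SV theta -> cell SX p.2 -> test SV (slice theta p).
Proof.
case: p => t x [st _ pv [M tM]] /= cx; split.
- by move=> k; apply: (Ck_precomp (is_diff_slice t x)); exact: st.
- exact: pv.
- by exists M => v cv Mv; apply: tM => //; rewrite Mv !orbT.
Qed.

Lemma grad_slice theta p v : smooth theta -> grad (slice theta p) v = grad_v theta (p.1, (p.2, v)).
Proof.
move=> st; apply/rowP => i; rewrite !mxE.
by apply: (derive_precomp _ (is_diff_slice p.1 p.2 v)); exact: smooth_differentiable.
Qed.

End phase_space.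

(** * Product measures, and integrability of the weak formulation *)

Section product_ae.
Context {R : realType} {d1 d2} {T1 : measurableType d1} {T2 : measurableType d2}.
Variables (m1 : {sigma_finite_measure set T1 -> \bar R}) (m2 : {sigma_finite_measure set T2 -> \bar R}).

Lemma ae_snd (A : T2 -> Prop) : {ae m2, forall y, A y} ->
  {ae (m1 \x m2)%E, forall z, A z.2}.
Proof.
move=> [N [mN N0 AN]]; exists (setT `*` N); split.
- exact: measurableX.
- by rewrite product_measure1E// N0 mule0.
- by move=> z /= nA; split => //; exact: AN.
Qed.

Lemma ae_fst (A : T1 -> Prop) : {ae m1, forall x, A x} ->
  {ae (m1 \x m2)%E, forall z, A z.1}.
Proof.
move=> [N [mN N0 AN]]; exists (N `*` setT); split.
- exact: measurableX.
- by transitivity (m1 N * m2 setT)%E; [exact: product_measure1E|rewrite N0 mul0e].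
- by move=> z /= nA; split => //; exact: AN.
Qed.

Lemma Rintegral_fubini (f : T1 * T2 -> R) : (m1 \x m2)%E.-integrable setT (EFin \o f) ->
  \int[m1]_x \int[m2]_y f (x, y) = \int[(m1 \x m2)%E]_z f z.
Proof.
move=> fi; rewrite [RHS]/Rintegral -(integral12_prod_meas1 fi) /Rintegral; congr fine.
have mF := measurable_fubini_F fi.
apply: ae_eq_integral => //.
  by apply/measurable_EFinP; exact: (measurableT_comp _ mF).
have := ae_integrable1 fi.
apply: filterS => x fx _; rewrite fineK//; exact: integrable_fin_num fx.
Qed.

Lemma measurable_Rintegral_snd (f : T1 * T2 -> R) : measurable_fun setT f ->
  measurable_fun setT (fun x => \int[m2]_y f (x, y)).
Proof.
move=> mf; apply: (measurableT_comp (f := fine)) => //.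
under eq_fun do rewrite integralE.
have mf' : measurable_fun setT (EFin \o f) by exact/measurable_EFinP.
apply: emeasurable_funB.
  rewrite (_ : (fun x => _) = fubini_F m2 (EFin \o f)^\+%E).
    exact: (measurable_fun_fubini_tonelli_F (m2 := m2) _ (measurable_funepos mf') (funepos_ge0 _)).
  by apply/funext => x; apply: eq_integral => y _; rewrite !funeposE.
rewrite (_ : (fun x => _) = fubini_F m2 (EFin \o f)^\-%E).
  exact: (measurable_fun_fubini_tonelli_F (m2 := m2) _ (measurable_funeneg mf') (funeneg_ge0 _)).
by apply/funext => x; apply: eq_integral => y _; rewrite !funenegE.
Qed.

End product_ae.

Section window_integrability.
Context {R : realType} {d2} {Y : measurableType d2} (M : probability Y R).
Local Notation TY := (measurableTypeR R * Y)%type.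
Let m : {measure set TY -> \bar R} := (lebesgue_measure \x M)%E.
Implicit Types f k : TY -> R.

Lemma slab_lty (a b : R) : (m (`[a, b]%classic `*` setT) < +oo)%E.
Proof.
have -> : m (`[a, b]%classic `*` setT) = (lebesgue_measure `[a, b]%classic * M setT)%E.
  exact: product_measure1E.
rewrite probability_setT mule1 lebesgue_measure_itv/=.
by case: ifP => // _; rewrite -EFinB ltry.
Qed.

(** On the slab [[0, T]], [|f k|] is at most [C (1 + f^2)]; at later times the product vanishes. *)
Lemma window_integrable f k (T C : R) : measurable_fun setT f -> measurable_fun setT k ->
  (\int[m]_(z in `[0%R, T] `*` setT) (f z ^+ 2)%:E < +oo)%E ->
  {ae m, forall z, `|k z| <= C} -> {ae m, forall z, T < `|z.1| -> k z = 0} ->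
  m.-integrable (`[0%R, +oo[ `*` setT) (fun z => (f z * k z)%:E).
Proof.
move=> mf mk f2 kC k0.
have mD : measurable (`[0%R, +oo[%classic `*` setT : set TY) by exact: measurableX.
have mW : measurable (`[0%R, T]%classic `*` setT : set TY) by exact: measurableX.
have mfk : measurable_fun setT (fun z => f z * k z) by exact: measurable_funM.
have mg : measurable_fun setT (fun z => C * (1 + f z ^+ 2)).
  apply: measurable_funM => //; apply: measurable_funD => //; exact: measurable_funX.
pose g : TY -> \bar R := (fun z => (`|C * (1 + f z ^+ 2)|)%:E) \_ (`[0%R, T]%classic `*` setT).
have mgE : measurable_fun setT (fun z => (`|C * (1 + f z ^+ 2)|)%:E).
  by apply/measurable_EFinP; apply: measurableT_comp.
have mg' : measurable_fun setT g.
  by apply/(measurable_restrictT _ _).1 => //; exact: measurable_funTS.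
apply/integrableP; split.
  by apply/measurable_EFinP; exact: measurable_funTS.
apply: (@le_lt_trans _ _ (\int[m]_(z in `[0%R, +oo[ `*` setT) g z)%E).
  apply: ae_ge0_le_integral => //.
  - by apply: measurable_funTS; apply: measurableT_comp => //; exact/measurable_EFinP.
  - by move=> z _; rewrite /g patchE; case: ifP.
  - exact: measurable_funTS.
  apply: filterS2 kC k0 => z kC k0 [/= z0 _]; rewrite /g patchE in_setX in_setT andbT.
  rewrite in_itv /= andbT in z0.
  case: ifPn => [|zT].
    move=> _; rewrite lee_fin !normrM mulrC ler_pM//; first by rewrite (le_trans kC)// ler_norm.
    rewrite [leRHS]ger0_norm ?addr_ge0 ?sqr_ge0//.
    have [f1|/ltW f1] := leP `|f z| 1; first by rewrite (le_trans f1)// lerDl sqr_ge0.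
    rewrite -(real_normK (num_real (f z))); nra.
  have : T < `|z.1|.
    by move: zT; rewrite notin_setE /= in_itv/= z0 /= => /negP; rewrite -ltNge ger0_norm.
  by move=> /k0 ->; rewrite mulr0 normr0.
have -> : (\int[m]_(z in `[0%R, +oo[ `*` setT) g z =
    \int[m]_(z in `[0%R, T] `*` setT) (`|C * (1 + f z ^+ 2)|)%:E)%E.
  rewrite /g -integral_mkcondr; congr (integral _ _ _); apply/seteqP; split => z /=.
    by move=> [].
  by rewrite !in_itv/= => -[/andP[-> ->]] _.
under eq_integral do rewrite normrM EFinM.
rewrite ge0_integralZl//; last first.
  apply/measurable_EFinP/measurable_funTS; apply: measurableT_comp => //.
  by apply: measurable_funD => //; exact: measurable_funX.
rewrite lte_mul_pinfty//.
under eq_integral do rewrite ger0_norm ?addr_ge0 ?sqr_ge0// EFinD.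
rewrite ge0_integralD//; last 2 first.
- by move=> z _; rewrite lee_fin sqr_ge0.
- by apply/measurable_EFinP/measurable_funTS; exact: measurable_funX.
by rewrite lte_add_pinfty// integral_cst// mul1e; exact: slab_lty.
Qed.

End window_integrability.

Section solution.
Context {R : realType} {d : nat} {SX SV : geometry R}.
Context (phi : potential d SX) (psi : potential d SV) (xi : R).
Local Notation X := 'rV[R]_d.
Local Notation space := (measurableTypeR R * (X * X))%type.
Local Notation PQ := (gibbsXV phi psi).
Local Notation D0 := (`[0%R, +oo[%classic `*` setT : set space).
Let m : {measure set space -> \bar R} := (lebesgue_measure \x gibbsXV phi psi)%E.
Variables (h0 : X * X -> R) (h : R * (X * X) -> R) (G : R * (X * X) -> X).
Hypothesis sol : VOU_with phi psi xi h0 h G.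

Lemma ae_gibbsXV_cell : {ae PQ, forall y, cell SX y.1 /\ cell SV y.2}.
Proof.
have a1 := ae_fst (gibbs psi) (ae_gibbs_cell phi).
have a2 := ae_snd (gibbs phi) (ae_gibbs_cell psi).
by apply: filterS2 a1 a2.
Qed.

Lemma ae_phase_cell : {ae m, forall z, cell SX z.2.1 /\ cell SV z.2.2}.
Proof. exact: (ae_snd lebesgue_measure ae_gibbsXV_cell). Qed.

Lemma ae_phase_bounded (k : R * (X * X) -> R) (M : R) : continuous k ->
  phase_vanish SX SV M k -> exists C, {ae m, forall z, `|k z| <= C}.
Proof.
move=> ck kM; have [C _ hC] := phase_vanish_bounded ck kM.
by exists C; apply: filterS ae_phase_cell => -[t [x v]] [/= cx cv]; exact: hC.
Qed.

Lemma ae_phase_vanish (k : R * (X * X) -> R) (M : R) : phase_vanish SX SV M k ->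
  {ae m, forall z, M < `|z.1| -> k z = 0}.
Proof.
move=> kM; apply: filterS ae_phase_cell => -[t [x v]] [/= cx cv] Mt.
by apply: kM => //; rewrite Mt.
Qed.

Lemma measurable_L2norm_sqr :
  measurable_fun setT (fun t : measurableTypeR R => (L2norm PQ (at_ h t) ^+ 2)%E).
Proof.
rewrite (_ : (fun t => _) = fubini_F PQ (fun z => (h z ^+ 2)%:E)); last first.
  by apply/funext => t; rewrite L2norm_sqr.
apply: (measurable_fun_fubini_tonelli_F (m2 := PQ) (fun z => (h z ^+ 2)%:E)).
  by apply/measurable_EFinP/measurable_funX; exact: vou_measurable sol.
by move=> z; rewrite lee_fin sqr_ge0.
Qed.

Lemma integral_slab_sqr (a b : R) :
  (\int[m]_(z in `[a, b] `*` setT) (h z ^+ 2)%:E =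
   \int[lebesgue_measure]_(t in `[a, b]) L2norm PQ (at_ h t) ^+ 2)%E.
Proof.
rewrite ge0_integral_slab//.
- by apply: eq_integral => t _; rewrite L2norm_sqr.
- by apply/measurable_EFinP/measurable_funX; exact: vou_measurable sol.
- by move=> z; rewrite lee_fin sqr_ge0.
Qed.

Lemma slab_sqr_lty (a b : R) : 0 <= a ->
  (\int[m]_(z in `[a, b] `*` setT) (h z ^+ 2)%:E < +oo)%E.
Proof.
move=> a0; have [M hM] := vou_bounded sol.
rewrite integral_slab_sqr.
apply: (@le_lt_trans _ _ (\int[lebesgue_measure]_(t in `[a, b]) (M ^+ 2)%:E)%E).
  apply: ge0_le_integral => //.
  - by move=> t _; exact: expe_ge0 (L2norm_ge0 _ _).
  - by apply: measurable_funTS; exact: measurable_L2norm_sqr.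
  - move=> t; rewrite /= in_itv/= => /andP[at_ _].
    have hMt := hM t (le_trans a0 at_).
    by rewrite EFin_expe lee_sqr ?L2norm_ge0// (le_trans (L2norm_ge0 _ _) hMt).
rewrite integral_cst//= lebesgue_measure_itv/=.
by case: ifP => // _; rewrite -?EFinB -?EFinM ?ltry ?mule0.
Qed.

Lemma solution_mul_integrable (k : R * (X * X) -> R) (M : R) : continuous k ->
  phase_vanish SX SV M k -> m.-integrable D0 (fun z => (h z * k z)%:E).
Proof.
move=> ck kM; have [C hC] := ae_phase_bounded ck kM.
apply: (window_integrable (vou_measurable sol) _ _ hC (ae_phase_vanish kM)).
- exact: continuous_measurable_phase.
- exact: slab_sqr_lty.
Qed.

Lemma grad_slab_sqr_lty (T : R) i :
  (\int[m]_(z in `[0%R, T] `*` setT) (G z ord0 i ^+ 2)%:E < +oo)%E.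
Proof.
have mG := vou_grad_measurable sol.
apply: le_lt_trans (vou_grad_L2 sol).
apply: (@le_trans _ _ (\int[m]_(z in `[0%R, +oo[ `*` setT) (G z ord0 i ^+ 2)%:E)%E).
  apply: ge0_subset_integral => //.
  - exact: measurableX.
  - exact: measurableX.
  - by apply/measurable_EFinP/measurable_funTS; exact: measurable_funX.
  - by move=> z _; rewrite lee_fin sqr_ge0.
  - by move=> z [/= + _]; rewrite !in_itv/= andbT => /andP[].
apply: ge0_le_integral => //.
- exact: measurableX.
- by move=> z _; rewrite lee_fin sqr_ge0.
- by apply/measurable_EFinP/measurable_funTS; exact: measurable_funX.
- apply/measurable_EFinP/measurable_funTS; apply: measurable_funX; exact: measurable_enorm.
- by move=> z _; rewrite lee_fin enorm_sqr coord_sqr_le_dot.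
Qed.

Lemma grad_mul_integrable (k : R * (X * X) -> R) (M : R) i : continuous k ->
  phase_vanish SX SV M k -> m.-integrable D0 (fun z => (G z ord0 i * k z)%:E).
Proof.
move=> ck kM; have [C hC] := ae_phase_bounded ck kM.
apply: (window_integrable (vou_grad_measurable sol i) _ _ hC (ae_phase_vanish kM)).
- exact: continuous_measurable_phase.
- exact: grad_slab_sqr_lty.
Qed.

Lemma grad_dot_integrable (theta : R * (X * X) -> R) (M : R) : smooth theta ->
  phase_vanish SX SV M theta ->
  m.-integrable D0 (fun z => (dot (G z) (grad_v theta z))%:E).
Proof.
move=> st tM.
rewrite (_ : (fun z => _) = (fun z => \sum_i (G z ord0 i * grad_v theta z ord0 i)%:E)%E); last first.
  by apply/funext => z; rewrite sumEFin.
apply: integrable_sum; first exact: measurableX.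
move=> i _; apply: (@grad_mul_integrable (fun z => grad_v theta z ord0 i) M).
- exact: continuous_grad_v.
- exact: phase_vanish_grad_v.
Qed.

Lemma test_phase_vanish (theta : R * (X * X) -> R) : @test_txv R d SX SV theta ->
  exists M, phase_vanish SX SV M theta.
Proof. by move=> [_ _ _ [M tM]]; exists M. Qed.

(** Makes the real integral in [vou_weak] meaningful: as a [Rintegral] it would default to 0 if
    infinite. *)
Lemma weak_integrand_integrable (theta : R * (X * X) -> R) : @test_txv R d SX SV theta ->
  m.-integrable D0
    (fun z => (h z * transport phi psi theta z - xi * dot (G z) (grad_v theta z))%:E).
Proof.
move=> tt; have [st _ _ _] := tt; have [M tM] := test_phase_vanish tt.
have mD : measurable D0 by exact: measurableX.
have i1 : m.-integrable D0 (fun z => (h z * transport phi psi theta z)%:E).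
  apply: (@solution_mul_integrable _ M); first exact: continuous_transport.
  exact: phase_vanish_transport.
have i2 := integrableZl mD xi (grad_dot_integrable st tM).
exact: (integrableB mD i1 i2).
Qed.

End solution.

(** * Cauchy-Schwarz, and the dual norm of the right-hand side of (VOU) *)

Section cauchy_schwarz.
Context {R : realType} {disp} {T : measurableType disp}.
Variable m : {measure set T -> \bar R}.

Lemma L2normv_lty n (F : T -> 'rV[R]_n) : L2v m F -> (L2normv m F < +oo)%E.
Proof.
move=> /L2vP[mF F2]; have : (L2normv m F ^+ 2 < +oo)%E by rewrite L2normv_sqr.
by have := L2norm_ge0 m (enorm \o F); rewrite /L2normv; case: (L2norm _ _) => //= r; rewrite ?ltry.
Qed.

Lemma Rintegral_dot_le n (F G : T -> 'rV[R]_n) : L2v m F -> L2v m G ->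
  (`|\int[m]_x dot (F x) (G x)|%:E <= L2normv m F * L2normv m G)%E.
Proof.
move=> FL GL; have FG := dot_integrable FL GL.
have [mF _] := (L2vP _ _).1 FL; have [mG _] := (L2vP _ _).1 GL.
have meF := measurable_enorm mF; have meG := measurable_enorm mG.
apply: (@le_trans _ _ (\int[m]_x `|dot (F x) (G x)|%:E)%E).
  rewrite EFin_normr_Rintegral//; exact: le_abse_integral (measurable_int _ FG).
apply: (@le_trans _ _ (Lnorm m 1 (EFin \o (fun x => enorm (F x) * enorm (G x))))).
  rewrite Lnorm1; apply: ge0_le_integral => //.
  - apply/measurable_EFinP; apply: measurableT_comp => //; exact: measurable_dot.
  - apply: measurableT_comp => //; apply/measurable_EFinP; exact: measurable_funM.
  - move=> x _; rewrite /= lee_fin [leRHS]ger0_norm ?mulr_ge0 ?enorm_ge0//.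
    exact: dot_le_enorm.
by apply: hoelder => //; rewrite [RHS](splitr 1) div1r.
Qed.

End cauchy_schwarz.

Section H1_norm.
Context {R : realType} {d : nat} {S : geometry R} (psi : potential d S).
Local Notation Q := (gibbs psi).

Lemma L2normv_wgrad_le u : (L2normv Q (wgradx psi u) <= H1normx psi u)%E.
Proof.
rewrite /H1normx /H1norm -[leLHS]gee0_abs ?L2norm_ge0// -sqrte_sqr lee_sqrt.
  by rewrite leeDr// expe_ge0 ?L2norm_ge0.
by rewrite adde_ge0 ?expe_ge0 ?L2norm_ge0.
Qed.

Lemma L2normv_ae_eq (F G : 'rV[R]_d -> 'rV[R]_d) :
  (forall i, measurable_fun setT (fun x => F x ord0 i)) ->
  (forall i, measurable_fun setT (fun x => G x ord0 i)) ->
  {ae Q, forall x, F x = G x} -> (L2normv Q F ^+ 2 = L2normv Q G ^+ 2)%E.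
Proof.
move=> mF mG FG; rewrite !L2normv_sqr; apply: ae_eq_integral => //.
- by apply/measurable_EFinP/measurable_funX; exact: measurable_enorm.
- by apply/measurable_EFinP/measurable_funX; exact: measurable_enorm.
- by apply: filterS FG => x ->.
Qed.

Lemma H1norm_cst0 : (H1normx psi (fun=> 0%R) = 0)%E.
Proof.
have w0 := is_wgrad_cst psi 0.
have [_ Gw _] := wgradP w0; have [_ G0 _] := w0.
rewrite /H1normx /H1norm (L2normv_ae_eq _ _ (wgrad_ae w0)); last 2 first.
- by move=> i; exact: L2v_measurable Gw.
- by move=> i; exact: L2v_measurable G0.
rewrite L2norm_sqr L2normv_sqr !integral0_eq ?adde0 ?sqrte0// => x _.
  by rewrite enorm_sqr dot0r.
by rewrite expr0n.
Qed.

(** A supremum over an empty set would be [-oo]. The zero function is admissible: its H^1 norm is 0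
    because its chosen gradient vanishes almost everywhere. *)
Lemma H1dual_norm_ge0 F : (0 <= H1dual_norm Q (weak_grad S) F)%E.
Proof.
apply: (@le_trans _ _ (`|F (fun=> 0%R)|%:E)%E); first by rewrite lee_fin.
apply: ereal_sup_ubound; exists (fun=> 0%R) => //; split.
  by exists (fun=> 0%R); exact: is_wgrad_cst.
by rewrite -[H1norm _ _ _]/(H1normx psi _) H1norm_cst0 lee_fin.
Qed.

(* For [g] the velocity gradient of a solution [h] and [c = - xi], this is
   [u |-> <- xi nabla_v^* nabla_v h, u>], the right-hand side of (VOU). *)
Definition grad_pairing (c : R) (g : 'rV[R]_d -> 'rV[R]_d) (u : 'rV[R]_d -> R) : R :=
  c * \int[Q]_v dot (g v) (wgradx psi u v).

Lemma grad_pairing_le (c : R) g u : L2v Q g -> H1x psi u ->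
  (`|grad_pairing c g u|%:E <= `|c|%:E * L2normv Q g * H1normx psi u)%E.
Proof.
move=> g2 [Gu uG]; have [_ w2 _] := wgradP uG.
rewrite /grad_pairing normrM EFinM -muleA lee_wpmul2l//.
apply: le_trans (Rintegral_dot_le g2 w2) _.
by apply: lee_wpmul2l; [exact: L2norm_ge0|exact: L2normv_wgrad_le].
Qed.

Lemma grad_pairing_dual (c : R) g : L2v Q g -> H1dual Q (weak_grad S) (grad_pairing c g).
Proof.
move=> g2; split=> [a u w [Gu uG] [Gw wG]|]; last first.
  exists (`|c| * fine (L2normv Q g)) => u uH.
  rewrite EFinM fineK; first exact: grad_pairing_le.
  by rewrite ge0_fin_numE ?L2norm_ge0// L2normv_lty.
have lin := is_wgrad_lin a (wgradP uG) (wgradP wG).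
have [_ u2 _] := wgradP uG; have [_ w2 _] := wgradP wG; have [_ uw2 _] := wgradP lin.
have gu := dot_integrable g2 u2; have gw := dot_integrable g2 w2.
rewrite /grad_pairing.
have -> : \int[Q]_v dot (g v) (wgradx psi (fun x => a * u x + w x) v) =
    \int[Q]_v (a * dot (g v) (wgradx psi u v) + dot (g v) (wgradx psi w v)).
  rewrite /Rintegral; congr fine; apply: ae_eq_integral => //.
  - exact: measurable_int (dot_integrable g2 uw2).
  - have mgu := measurable_int _ gu; have mgw := measurable_int _ gw.
    apply/measurable_EFinP; apply: measurable_funD; last exact/measurable_EFinP.
    by apply: measurable_funM => //; exact/measurable_EFinP.
  - by apply: filterS (wgrad_ae lin) => v + _; rewrite /wgradx => ->; rewrite dotDr dotZr.
rewrite RintegralD// ?RintegralZl//; last exact: (integrableZl measurableT a gu).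
by rewrite mulrDr mulrCA.
Qed.

(** Stated for every measurable [g], square integrable or not, so that it holds in every velocity
    slice of the gradient and not just in almost every one. *)
Lemma H1dual_norm_pairing_le (c : R) (g : 'rV[R]_d -> 'rV[R]_d) :
  (forall i, measurable_fun setT (fun x : 'rV[R]_d => g x ord0 i)) ->
  (H1dual_norm Q (weak_grad S) (grad_pairing c g) ^+ 2 <=
   (c ^+ 2)%:E * \int[Q]_v (enorm (g v) ^+ 2)%:E)%E.
Proof.
(* For [c = 0] the right-hand side is 0 even if the integral is infinite; for [c != 0] an infinite
   integral makes it [+oo]. *)
move=> mg; have [->|c0] := eqVneq c 0.
  have -> : H1dual_norm Q (weak_grad S) (grad_pairing 0 g) = 0%E; last first.
    by rewrite expe2 mul0e expr0n mul0e.
  apply/eqP; rewrite eq_le H1dual_norm_ge0 andbT.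
  by apply: ge_ereal_sup => _ [u _ <-]; rewrite /grad_pairing mul0r normr0.
have [g2|] := ltP (\int[Q]_v (enorm (g v) ^+ 2)%:E)%E +oo%E; last first.
  by rewrite leye_eq => /eqP ->; rewrite gt0_muley ?leey// lte_fin lt_neqAle eq_sym sqrf_eq0 c0 sqr_ge0.
have gL : L2v Q g by apply/L2vP.
rewrite -L2normv_sqr -(real_normK (num_real c)) EFin_expe !expe2 muleACA -!expe2.
rewrite lee_sqr ?H1dual_norm_ge0//; last by rewrite mule_ge0 ?L2norm_ge0.
apply: ge_ereal_sup => _ [u [uH u1] <-].
apply: le_trans (grad_pairing_le c gL uH) _.
by rewrite -[leRHS]mule1 lee_wpmul2l// mule_ge0// L2norm_ge0.
Qed.

End H1_norm.

(** * Integrals compared without measurability *)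

Section nonmeasurable.
Context {R : realType} {d} {T : measurableType d} (m : {measure set T -> \bar R}).
Import HBNNSimple.

(* Needed because neither the dual norm of [F p] nor the representative [wgrad]
   of the gradient of [slice theta p] has to be measurable in [p]. *)
Lemma ge0_ae_le_integral_nonmeasurable (f g : T -> \bar R) :
  (forall x, 0 <= f x)%E -> (forall x, 0 <= g x)%E -> {ae m, forall x, (f x <= g x)%E} ->
  (\int[m]_x f x <= \int[m]_x g x)%E.
Proof.
move=> f0 g0 [N [mN N0 fgN]]; rewrite !ge0_integralTE//.
apply: ge_ereal_sup => _ [h hf <-].
have mNC : measurable (~` N) by exact: measurableC.
rewrite -integralT_nnsfun; have -> : (\int[m]_x (h x)%:E = \int[m]_x (proj_nnsfun h mNC x)%:E)%E.
  apply: ae_eq_integral => //.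
  - exact/measurable_EFinP.
  - exact/measurable_EFinP.
  - exists N; split => // x /= hx; apply: contrapT => nN; apply: hx => _.
    by rewrite /proj_nnsfun/= mindicE mem_set ?mulr1.
rewrite integralT_nnsfun; apply: ereal_sup_ubound; exists (proj_nnsfun h mNC) => // x.
rewrite /proj_nnsfun/= mindicE; have [/set_mem nN|_] := boolP (x \in ~` N); last by rewrite mulr0.
rewrite mulr1; apply: le_trans (hf x) _.
by apply: contrapT => nfg; apply: nN; exact: fgN.
Qed.

Lemma ae_eq_Rintegral_nonmeasurable (f g : T -> R) : {ae m, forall x, f x = g x} ->
  \int[m]_x f x = \int[m]_x g x.
Proof.
move=> fg; rewrite /Rintegral [X in fine X]integralE [X in _ = fine X]integralE.
congr (fine (_ - _)); apply/eqP; rewrite eq_le; apply/andP; split;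
  apply: ge0_ae_le_integral_nonmeasurable => [x|x|];
  rewrite ?funepos_ge0 ?funeneg_ge0//; apply: filterS fg => x fgx;
  by rewrite ?funeposE ?funenegE fgx.
Qed.

End nonmeasurable.

(** * Translation of a window to [[0, tau]] *)

Section translated_test.
Context {R : realType} {d : nat} {SX SV : geometry R}.
Context (phi : potential d SX) (psi : potential d SV).
Local Notation X := 'rV[R]_d.
Local Notation space := (R * (X * X))%type.

Definition translate {Y : Type} (t0 : R) (z : R * Y) : R * Y := (t0 + z.1, z.2).

Lemma translateK {Y : Type} (t0 : R) : cancel (@translate Y t0) (@translate Y (- t0)).
Proof. by move=> [t y]; rewrite /translate /= addKr. Qed.

Lemma is_diff_translate (t0 : R) (z : space) :
  is_diff z (@translate (X * X) t0) (id : space -> space).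
Proof.
have -> : @translate (X * X) t0 = cst ((t0, 0) : space) + (id : space -> space).
  by apply/funext => -[t [x v]]; congr pair; apply/esym; exact: add0r.
have -> : (id : space -> space) = (0 : space -> space) + id.
  by apply/funext => y; apply/esym; exact: add0r.
by rewrite {1}add0r; exact: is_diffD (is_diff_cst _ z) (is_diff_id z).
Qed.

Lemma grad_v_coord (theta : space -> R) z i : grad_v theta z ord0 i = 'D_(0, (0, e_ i)) theta z.
Proof. by rewrite mxE. Qed.

Lemma grad_x_coord (theta : space -> R) z i : grad_x theta z ord0 i = 'D_(0, (e_ i, 0)) theta z.
Proof. by rewrite mxE. Qed.

Lemma grad_v_translate (t0 : R) (theta : space -> R) (z : space) : smooth theta ->
  grad_v (theta \o translate t0) z = grad_v theta (translate t0 z).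
Proof.
move=> st; apply/rowP => i; apply: etrans (grad_v_coord _ _ _) _.
  apply: etrans _ (esym (grad_v_coord _ _ _)).
apply: (derive_precomp _ (is_diff_translate t0 z)); exact: smooth_differentiable.
Qed.

Lemma transport_translate (t0 : R) (theta : space -> R) (z : space) : smooth theta ->
  transport phi psi (theta \o translate t0) z = transport phi psi theta (translate t0 z).
Proof.
move=> st; rewrite /transport (grad_v_translate _ _ st).
have -> : grad_x (theta \o translate t0) z = grad_x theta (translate t0 z).
  apply/rowP => i; apply: etrans (grad_x_coord _ _ _) _.
  apply: etrans _ (esym (grad_x_coord _ _ _)).
  apply: (derive_precomp _ (is_diff_translate t0 z)); exact: smooth_differentiable.
have E : 'D_((1, (0, 0)) : space) (theta \o translate t0) z =
    'D_((1, (0, 0)) : space) theta (translate t0 z).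
  apply: (derive_precomp _ (is_diff_translate t0 z)); exact: smooth_differentiable.
exact: (f_equal (fun a => a + dot (grad psi z.2.2) (grad_x theta (translate t0 z)) -
  dot (grad phi z.2.1) (grad_v theta (translate t0 z))) E).
Qed.

Lemma test_translate (t0 : R) theta : @test_txv R d SX SV theta ->
  @test_txv R d SX SV (theta \o translate t0).
Proof.
move=> [st px pv [M tM]]; split.
- by move=> k; apply: (Ck_precomp (is_diff_translate t0)); exact: st.
- by move=> t v; exact: (px (t0 + t) v).
- by move=> t x; exact: (pv (t0 + t) x).
exists (`|M| + `|t0|) => t x v cx cv hM; apply: tM => //=.
have MM : M <= `|M| + `|t0| by rewrite (le_trans (ler_norm M))// lerDl.
case/or3P: hM => [h|h|h]; apply/or3P.
- apply: Or31; apply: le_lt_trans (ler_norm M) _.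
  rewrite -(ltrD2r `|t0|) (lt_le_trans h)//.
  by rewrite -{1}(addKr t0 t) (le_trans (ler_normD _ _))// normrN addrC.
- by apply: Or32; exact: le_lt_trans h.
- by apply: Or33; exact: le_lt_trans h.
Qed.

(** Both time conditions are open, so [theta] vanishes for small positive steps from [z] along [v],
    and [derive_right0] applies. *)
Lemma derive_time_cut (tau eps : R) (theta : space -> R) (v z : space) : 0 < eps -> smooth theta ->
  (forall t y, (t < eps) || (tau - eps < t) -> theta (t, y) = 0) ->
  (z.1 < eps) || (tau - eps < z.1) -> 'D_v theta z = 0.
Proof.
move=> e0 st cut hz; apply: derive_right0.
- by apply: diff_derivable; exact: smooth_differentiable.
- by rewrite (surjective_pairing z) cut.
have c1 : h * v.1 + z.1 @[h --> (0 : R)^'+] --> z.1.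
  rewrite -[X in _ --> X]add0r -[X in _ --> X + _](mul0r v.1).
  apply: cvg_at_right_filter; apply: cvgD; last exact: cvg_cst.
  by apply: cvgM; [exact: cvg_id|exact: cvg_cst].
have near_out : \forall h \near (0 : R)^'+, (h * v.1 + z.1 < eps) || (tau - eps < h * v.1 + z.1).
  case/orP: hz => hz.
  - by near=> h; apply/orP; left; near: h; exact: (cvgr_lt _ c1).
  - by near=> h; apply/orP; right; near: h; exact: (cvgr_gt _ c1).
apply: filterS near_out => h /= hh.
by rewrite [X in theta X]surjective_pairing cut.
Unshelve. all: by end_near. Qed.

Lemma transport_time_cut (tau eps : R) (theta : space -> R) (z : space) : 0 < eps -> smooth theta ->
  (forall t y, (t < eps) || (tau - eps < t) -> theta (t, y) = 0) ->
  (z.1 < eps) || (tau - eps < z.1) -> transport phi psi theta z = 0 /\ grad_v theta z = 0.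
Proof.
move=> e0 st cut hz.
have gv : grad_v theta z = 0.
  by apply/rowP => i; rewrite [RHS]mxE; apply: etrans (grad_v_coord _ _ _) _; exact: derive_time_cut hz.
have gx : grad_x theta z = 0.
  by apply/rowP => i; rewrite [RHS]mxE; apply: etrans (grad_x_coord _ _ _) _; exact: derive_time_cut hz.
by split => //; rewrite /transport gv gx !dot0r (derive_time_cut _ e0 st cut hz) addr0 subr0.
Qed.

End translated_test.

Section translated_solution.
Context {R : realType} {d : nat} {SX SV : geometry R}.
Context (phi : potential d SX) (psi : potential d SV) {tau : R} (tau_gt0 : 0 < tau) (xi : R).
Local Notation X := 'rV[R]_d.
Local Notation space := (measurableTypeR R * (X * X))%type.
Local Notation P := (gibbs phi).
Local Notation Q := (gibbs psi).
Local Notation PQ := (gibbsXV phi psi).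
Local Notation U2 := (Umu tau_gt0 phi).
Local Notation U3 := (UgibbsXV phi psi tau_gt0).
Variables (h0 : X * X -> R) (h : R * (X * X) -> R) (G : R * (X * X) -> X).
Hypothesis sol : VOU_with phi psi xi h0 h G.
Variable t0 : R.
Hypothesis t0_ge0 : 0 <= t0.
Local Notation W := (`[t0, t0 + tau]%classic `*` setT).
Let hs : R * (X * X) -> R := h \o translate t0.
Let Gs : R * (X * X) -> X := G \o translate t0.
Let F (p : R * X) (u : X -> R) : R := grad_pairing psi (- xi) (slice Gs p) u.

Lemma measurable_translate {d2} {Y : measurableType d2} :
  measurable_fun setT (translate t0 : measurableTypeR R * Y -> measurableTypeR R * Y).
Proof.
apply: measurable_pairing; last exact: measurable_snd.
exact: (measurableT_comp (measurable_translation t0) measurable_fst).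
Qed.

Lemma integral_translate {d2} {Y : measurableType d2} (M : probability Y R)
  (f : measurableTypeR R * Y -> \bar R) : measurable_fun setT f -> (forall z, (0 <= f z)%E) ->
  (\int[(uniform_prob tau_gt0 \x M)%E]_z f (translate t0 z) =
   (tau^-1)%:E * \int[(lebesgue_measure \x M)%E]_(z in W) f z)%E.
Proof. by move=> mf f_ge0; exact: ge0_integral_uniform_prod_translation. Qed.

Lemma integral_assoc (f : space -> \bar R) : measurable_fun setT f ->
  (forall z, (0 <= f z)%E) ->
  (\int[U3]_z f z = \int[U2]_p \int[Q]_v f (p.1, (p.2, v)))%E.
Proof. exact: (ge0_integral_assoc (m2 := P) (m23 := PQ) erefl erefl erefl). Qed.

Let mh : measurable_fun setT (h : space -> R) := vou_measurable sol.
Let mG i : measurable_fun setT (fun z : space => G z ord0 i) := vou_grad_measurable sol i.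

Lemma measurable_translated : measurable_fun setT (hs : space -> R).
Proof. exact: (measurableT_comp mh measurable_translate). Qed.

Lemma measurable_translated_grad i : measurable_fun setT (fun z : space => Gs z ord0 i).
Proof. exact: (measurableT_comp (mG i) measurable_translate). Qed.

Lemma measurable_slice_grad (p : R * X) i : measurable_fun setT (fun v => slice Gs p v ord0 i).
Proof.
apply: (measurableT_comp (measurable_translated_grad i)).
by apply: measurable_pairing; [exact: measurable_cst|apply: measurable_pairing].
Qed.

Lemma translated_sqr :
  (\int[U3]_z (hs z ^+ 2)%:E = (tau^-1)%:E * Hcal phi psi tau h t0)%E.
Proof.
rewrite /Hcal -(integral_slab_sqr sol).
apply: (integral_translate PQ (f := fun z => (h z ^+ 2)%:E)).
  by apply/measurable_EFinP; exact: measurable_funX.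
by move=> z; rewrite lee_fin sqr_ge0.
Qed.

Lemma Hcal_lty : (Hcal phi psi tau h t0 < +oo)%E.
Proof. by rewrite /Hcal -(integral_slab_sqr sol); exact: (slab_sqr_lty sol). Qed.

Lemma translated_L2 : hs \in Lfun U3 2%:E.
Proof.
apply/LfunP2; split; first exact: measurable_translated.
by rewrite translated_sqr lte_mul_pinfty ?Hcal_lty// lee_fin invr_ge0 ltW.
Qed.

Let mG2 : measurable_fun setT (fun z : space => (enorm (G z) ^+ 2)%:E).
Proof. by apply/measurable_EFinP/measurable_funX; exact: measurable_enorm. Qed.

Lemma translated_grad_sqr :
  (\int[U3]_z (enorm (Gs z) ^+ 2)%:E = (tau^-1)%:E *
   \int[lebesgue_measure]_(r in `[t0, (t0 + tau)%R]) L2normv PQ (fun y => G (r, y)) ^+ 2)%E.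
Proof.
transitivity ((tau^-1)%:E * \int[(lebesgue_measure \x PQ)%E]_(z in W) (enorm (G z) ^+ 2)%:E)%E.
  apply: (integral_translate PQ (f := fun z => (enorm (G z) ^+ 2)%:E)) => //.
  by move=> z; rewrite lee_fin sqr_ge0.
congr (_ * _)%E; rewrite ge0_integral_slab//; last by move=> z; rewrite lee_fin sqr_ge0.
by apply: eq_integral => r _; rewrite L2normv_sqr.
Qed.

Lemma translated_grad_sqr_lty : (\int[U3]_z (enorm (Gs z) ^+ 2)%:E < +oo)%E.
Proof.
rewrite [X in (X < _)%E](_ : _ = (tau^-1)%:E * \int[(lebesgue_measure \x PQ)%E]_(z in W) (enorm (G z) ^+ 2)%:E)%E; last first.
  apply: (integral_translate PQ (f := fun z => (enorm (G z) ^+ 2)%:E)) => //.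
  by move=> z; rewrite lee_fin sqr_ge0.
apply: lte_mul_pinfty => //; first by rewrite lee_fin invr_ge0 ltW.
apply: le_lt_trans (vou_grad_L2 sol); apply: ge0_subset_integral => //.
- exact: measurableX.
- exact: measurableX.
- exact: measurable_funTS.
- by move=> z _; rewrite lee_fin sqr_ge0.
- move=> z [/= + _]; rewrite !in_itv/= => /andP[tz _]; split => //=.
  by rewrite andbT (le_trans t0_ge0).
Qed.

Lemma translated_grad_L2 : L2v U3 Gs.
Proof. by apply/L2vP; split; [exact: measurable_translated_grad|exact: translated_grad_sqr_lty]. Qed.

Lemma translated_slice_wgrad : {ae U2, forall p,
  is_wgrad Q (weak_grad SV) (slice hs p) (slice Gs p)}.
Proof.
have hW : {ae (lebesgue_measure \x P)%E, forall p : measurableTypeR R * X, W p ->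
    is_wgrad Q (weak_grad SV) (slice h p) (slice G p)}.
  apply: (@filterS _ _ (ae_filter_ringOfSetsType _) _ _ _ (vou_grad sol)) => p hp [/= + _]; rewrite in_itv/= => /andP[tp _].
  by apply: hp; rewrite (le_trans t0_ge0).
apply: (ae_transfer measurable_translate _ (integral_translate P) hW).
exact: measurableX.
Qed.

Lemma translated_L2H1 : L2H1 phi psi tau_gt0 hs.
Proof.
split; first exact: translated_L2.
by exists Gs; [exact: translated_grad_L2|exact: translated_slice_wgrad].
Qed.

Lemma L2Hm1_sqnorm_le : (L2Hm1_sqnorm phi psi tau_gt0 F <=
  (xi ^+ 2)%:E * \int[U3]_z (enorm (Gs z) ^+ 2)%:E)%E.
Proof.
have mGs : measurable_fun setT (fun z : space => (enorm (Gs z) ^+ 2)%:E).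
  apply/measurable_EFinP/measurable_funX; exact: measurable_enorm measurable_translated_grad.
rewrite integral_assoc//; last by move=> z; rewrite lee_fin sqr_ge0.
rewrite -ge0_integralZl//; last 3 first.
- apply: (measurable_fun_fubini_tonelli_F (m2 := Q)
    (fun z => (enorm (Gs (unassoc z)) ^+ 2)%:E) (measurableT_comp mGs measurable_unassoc)).
  by move=> z; rewrite lee_fin sqr_ge0.
- by move=> p _; apply: integral_ge0 => v _; rewrite lee_fin sqr_ge0.
- by rewrite lee_fin sqr_ge0.
apply: ge0_le_integral_nonmeasurable => p.
  by apply: expe_ge0; exact: H1dual_norm_ge0.
by rewrite -(sqrrN xi); apply: H1dual_norm_pairing_le => i; exact: measurable_slice_grad.
Qed.

(** Measurability is asked for one [u] at a time. The chosen gradient of [u] does not depend on [p],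
    so the pairing is a partial integral of a jointly measurable function. *)
Lemma translated_L2Hm1 : L2Hm1 phi psi tau_gt0 F.
Proof.
split.
- apply: (@filterS _ _ (ae_filter_ringOfSetsType _) _ _ _ translated_slice_wgrad) => p [_ G2 _].
  exact: grad_pairing_dual.
- move=> u [Gu uG]; have [_ w2 _] := wgradP uG.
  apply: measurable_funM; first exact: measurable_cst.
  apply: (measurable_Rintegral_snd Q (f := fun z => dot (Gs (unassoc z)) (wgradx psi u z.2))).
  apply: measurable_dot => i.
    exact: (measurableT_comp (measurable_translated_grad i) measurable_unassoc).
  exact: (measurableT_comp (L2v_measurable i w2) measurable_snd).
- apply: le_lt_trans L2Hm1_sqnorm_le _; apply: lte_mul_pinfty => //.
    by rewrite lee_fin sqr_ge0.
  exact: translated_grad_sqr_lty.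
Qed.

Let ae_U3_cell : {ae U3, forall z : space, cell SX z.2.1 /\ cell SV z.2.2}.
Proof. exact: (ae_snd (uniform_prob tau_gt0) (ae_gibbsXV_cell phi psi)). Qed.

Lemma phase_vanish_L2 (k : R * (X * X) -> R) (M : R) : continuous k ->
  phase_vanish SX SV M k -> exists2 C, measurable_fun setT (k : space -> R) &
  {ae U3, forall z, `|k z| <= C}.
Proof.
move=> ck kM; have [C _ hC] := phase_vanish_bounded ck kM.
exists C; first exact: continuous_measurable_phase.
apply: (@filterS _ _ (ae_filter_ringOfSetsType _) _ _ _ ae_U3_cell) => -[t [x v]] [/= cx cv].
exact: hC.
Qed.

(** Test (VOU) with [theta] moved forward by [t0]. The cuts of [theta] near 0 and [tau] remove the
    initial term and confine the integrand to the window; after translation, the velocity term is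
    recognised slice by slice as [F p (slice theta p)]. *)
Lemma translated_transport : transport_eq phi psi tau_gt0 hs F.
Proof.
move=> theta tt [eps e0 cut]; have [st _ _ [M tM]] := tt.
pose th := theta \o translate (- t0); have tth := test_translate (- t0) tt.
have [sth _ _ _] := tth.
pose k (z : space) := h z * transport phi psi th z - xi * dot (G z) (grad_v th z).
have kI := weak_integrand_integrable sol tth.
have mD0 : measurable (`[0%R, +oo[%classic `*` setT : set space) by exact: measurableX.
have mW : measurable (W : set space) by exact: measurableX.
have k0 z : ~ (W : set space) z -> k z = 0.
  move=> nW; have hz : ((translate (- t0) z).1 < eps) || (tau - eps < (translate (- t0) z).1).
    rewrite /translate/= addrC; have [lt1|ge1] := ltP z.1 t0.
      by rewrite (lt_trans _ e0)// subr_lt0.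
    have [le2|gt2] := leP z.1 (t0 + tau).
      by exfalso; apply: nW; split => //=; rewrite in_itv/= ge1 le2.
    apply/orP; right; rewrite ltrBrDl (lt_le_trans _ (ltW gt2))//.
    by rewrite ltrD2l ltrBlDr ltrDl.
  have [tr0 gv0] := transport_time_cut phi psi e0 st cut hz.
  by rewrite /k (transport_translate _ _ _ _ st) (grad_v_translate _ _ st) tr0 gv0 mulr0 dot0r mulr0 subr0.
have intW : \int[(lebesgue_measure \x PQ)%E]_(z in W) k z = 0.
  (* The initial term is zero: [th (0, y) = theta (- t0, y)] and [- t0 <= 0 < eps]. *)
  have := vou_weak sol tth; rewrite [X in _ + X](_ : _ = 0) ?addr0 => [<-|]; last first.
    rewrite /Rintegral integral0_eq// => y _; rewrite /th /translate/= cut ?mulr0//.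
    by rewrite addr0 (le_lt_trans _ e0)// oppr_le0.
  rewrite [LHS]Rintegral_mkcond [RHS]Rintegral_mkcond; congr (Rintegral _ _ _).
  apply/funext => z; rewrite !patchE; case: ifPn => [zW|/negP zW].
    rewrite mem_set//; move: zW => /set_mem[/= + _]; rewrite in_itv/= => /andP[tz _].
    by split => //=; rewrite in_itv/= andbT (le_trans t0_ge0).
  by case: ifP => // _; rewrite -/(k z) k0// => ?; apply: zW; exact: mem_set.
have mk : measurable_fun setT k.
  have mt : measurable_fun setT (transport phi psi th : space -> R).
    by apply: continuous_measurable_phase; exact: continuous_transport.
  have mg i : measurable_fun setT (fun z : space => grad_v th z ord0 i).
    by apply: continuous_measurable_phase; exact: continuous_grad_v.
  apply: measurable_funB (measurable_funM mh mt) _.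
  exact: measurable_funM (measurable_cst _) (measurable_dot mG mg).
have kIW : (lebesgue_measure \x PQ)%E.-integrable W (EFin \o k).
  apply: integrableS kI => // z [/= + _]; rewrite !in_itv/= => /andP[tz _].
  by split => //; rewrite andbT (le_trans t0_ge0).
have := Rintegral_transfer mW (integral_translate PQ) mk kIW.
rewrite intW mulr0.
have -> : (fun z => k (translate t0 z)) =
    (fun z => hs z * transport phi psi theta z - xi * dot (Gs z) (grad_v theta z)).
  apply/funext => z; rewrite /k (transport_translate _ _ _ _ st) (grad_v_translate _ _ st).
  by rewrite translateK.
have ct : continuous (transport phi psi theta) by exact: continuous_transport.
have vt : phase_vanish SX SV M (transport phi psi theta) by exact: phase_vanish_transport.
have [C mtr htr] := phase_vanish_L2 ct vt.
have ai := integrable_mul_ae_bounded mtr htr (Lfun2_integrable translated_L2).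
have gL : L2v U3 (grad_v theta).
  move=> i; have ci : continuous (fun z => grad_v theta z ord0 i) by exact: continuous_grad_v.
  have vi : phase_vanish SX SV M (fun z => grad_v theta z ord0 i) by exact: phase_vanish_grad_v.
  have [Ci mi hi] := phase_vanish_L2 ci vi.
  exact: Lfun_ae_bounded mi hi.
have bi := dot_integrable translated_grad_L2 gL.
have bxi := integrableZl measurableT (- xi) bi.
rewrite RintegralB//; last exact: (integrableZl measurableT xi bi).
rewrite RintegralZl// => /eqP; rewrite subr_eq0 => /eqP E; rewrite [X in - X]E.
pose b (z : space) := - xi * dot (Gs z) (grad_v theta z).
(* [F p] pairs with the chosen gradient of [slice theta p]. For almost every [p] this slice is a
   test function, and the chosen gradient is the classical one almost everywhere in [v]. *)
have -> : \int[U2]_p F p (slice theta p) = \int[U2]_p \int[Q]_v b (unassoc (p, v)).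
  apply: ae_eq_Rintegral_nonmeasurable.
  have cU2 : {ae U2, forall p, cell SX p.2}.
    exact: (ae_snd (uniform_prob tau_gt0) (ae_gibbs_cell phi)).
  apply: (@filterS2 _ _ (ae_filter_ringOfSetsType _) _ _ _ _ cU2 translated_slice_wgrad) => p cp [_ G2 _].
  have ts := test_slice tt cp; have wt := is_wgrad_test psi ts; have [_ g2 _] := wt.
  rewrite /F /grad_pairing (_ : \int[Q]_v _ = \int[Q]_v dot (slice Gs p v) (grad (slice theta p) v)).
    have bE v : b (unassoc (p, v)) = - xi * dot (slice Gs p v) (grad (slice theta p) v).
      exact: (f_equal (fun a => - xi * dot (slice Gs p v) a) (esym (grad_slice p v st))).
    rewrite (_ : (fun v => b (unassoc (p, v))) =
      (fun v => - xi * dot (slice Gs p v) (grad (slice theta p) v))); last exact/funext.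
    exact: (esym (RintegralZl (- xi) measurableT (dot_integrable G2 g2))).
  apply: ae_eq_Rintegral_nonmeasurable.
  by apply: filterS (wgrad_ae wt) => v; rewrite /wgradx => ->.
have mb : measurable_fun setT b.
  apply: measurable_funM => //; apply: measurable_dot => i.
    exact: measurable_translated_grad.
  by apply: continuous_measurable_phase; exact: continuous_grad_v.
(* The dual pairing leads to an integral over [(U (x) mu) (x) gamma], the transport term to one over
   [U (x) (mu (x) gamma)]. *)
pose unI := ge0_integral_unassoc (m2 := P) (m12 := U2) (m23 := PQ) (m123 := U3) erefl erefl erefl.
rewrite (Rintegral_fubini (f := fun z => b (unassoc z))); last first.
  exact: (integrable_transfer measurable_unassoc ler01 unI mb bxi).
rewrite (Rintegral_transfer measurableT unI mb bxi) mul1r.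
by rewrite [RHS]RintegralZl// mulNr.
Qed.

Lemma translated_H1kin : H1kin phi psi tau_gt0 hs F.
Proof. by split; [exact: translated_L2H1|exact: translated_L2Hm1|exact: translated_transport]. Qed.

End translated_solution.

(** * Cutoffs in time, position and velocity *)

Section flat_bounds.
Context {R : realType}.
Implicit Types x : R.

Lemma flatk_ge0 k x : 0 <= flatk k x.
Proof.
rewrite /flatk; case: ifPn => // x0.
by rewrite mulr_ge0 ?expR_ge0// exprn_ge0// invr_ge0 ltW.
Qed.

Lemma flatk_le_inv k x : 0 < x -> flatk k x <= x^-1 ^+ k.
Proof.
move=> x0; rewrite /flatk x0 ler_piMr//; first by rewrite exprn_ge0// invr_ge0 ltW.
by rewrite -expR0 ler_expR oppr_le0 invr_ge0 ltW.
Qed.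

Lemma flatk01_le1 x : flatk 0 x + flatk 1 x <= 1.
Proof.
rewrite /flatk; case: ifPn => [x0|_]; last by rewrite addr0.
rewrite expr0 expr1 -mulrDl expRN ler_pdivrMr ?expR_gt0// mul1r.
exact: expR_ge1Dx.
Qed.

Lemma flatk_mul k x : x * flatk k.+1 x = flatk k x.
Proof.
rewrite /flatk; case: ifPn => [x0|_]; last by rewrite mulr0.
by rewrite exprS -mulrA mulVKf// gt_eqF.
Qed.

End flat_bounds.

Section time_cutoff.
Context {R : realType} (T : R).
Hypothesis T0 : 0 <= T.
Implicit Types t : R.

(* With [u = 1 / (n.+1 (T - t))], the derivative of the first two factors is
   [- (1 + u) e^(- u)], which lies in [-1, 0] and tends to [-1] for [t < T]. The
   last factor makes the support compact and tends to 1 for [t >= 0]. *)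
Definition time_cutoff (n : nat) t : R :=
  (T - t) * flatk 0 (n.+1%:R * (T - t)) * flatk 0 (n.+1%:R * (t + 1)).

Definition time_cutoff' (n : nat) t : R :=
  - (flatk 0 (n.+1%:R * (T - t)) + flatk 1 (n.+1%:R * (T - t))) * flatk 0 (n.+1%:R * (t + 1)) +
  (T - t) * flatk 0 (n.+1%:R * (T - t)) * (n.+1%:R * flatk 2 (n.+1%:R * (t + 1))).

Lemma is_derive_time_cutoff n t : is_derive t (1 : R) (time_cutoff n) (time_cutoff' n t).
Proof.
have d1 : is_derive t (1 : R) (fun s : R => T - s) (- 1).
  by rewrite -[- 1]sub0r; exact: is_deriveB.
have d2 : is_derive t (1 : R) (fun s : R => n.+1%:R * (T - s)) (- n.+1%:R).
  by apply: (is_derive_eq (is_deriveZ n.+1%:R d1)); rewrite -[_ *: _]/(_ * _) mulrN1.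
have d3 : is_derive t (1 : R) (fun s : R => n.+1%:R * (s + 1)) n.+1%:R.
  have d : is_derive t (1 : R) (fun s : R => s + 1) 1.
    by rewrite -[X in is_derive _ _ _ X]addr0; exact: is_deriveD.
  by apply: (is_derive_eq (is_deriveZ n.+1%:R d)); rewrite -[_ *: _]/(_ * _) mulr1.
have f (u : R -> R) du : is_derive t (1 : R) u du ->
    is_derive t (1 : R) (fun s => flatk 0 (u s)) (flatk 2 (u t) * du).
  move=> hu; apply: is_derive_eq.
    exact: (@is_derive1_comp _ (flatk 0) u _ _ _ (is_derive_flatk 0 (u t)) hu).
  by rewrite oppr0 mul0r add0r.
have dM := is_deriveM (is_deriveM d1 (f _ _ d2)) (f _ _ d3).
(* Once [flatk 1 x] is written as [x * flatk 2 x], the identity is polynomial. *)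
apply: (is_derive_eq dM); rewrite /time_cutoff' -!(flatk_mul 1) -![_ *: _]/(_ * _).
rewrite -[X in X * (flatk 2 _ * _)]/((T - t) * flatk 0 (n.+1%:R * (T - t))).
move: (flatk 0 _) (flatk 0 _) (flatk 2 _) (flatk 2 _) => a b c e; by ring.
Qed.

Lemma smooth_time_cutoff n : smooth (time_cutoff n).
Proof.
have a (c : R) : smooth (fun t => n.+1%:R * (c - t)).
  move=> k; rewrite (_ : (fun _ => _) = fun t => - n.+1%:R * t + n.+1%:R * c).
    exact: smooth_affine.
  by apply/funext => t; ring.
move=> k; apply: CkM; first apply: CkM.
- rewrite (_ : (fun _ => _) = fun t => - 1 * t + T); first exact: smooth_affine.
  by apply/funext => t; ring.
- exact: (Ck_comp (smooth_flatk 0 k) (a T k)).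
- apply: (Ck_comp (smooth_flatk 0 k) (f := fun t => n.+1%:R * (t + 1))).
  rewrite (_ : (fun _ => _) = fun t => n.+1%:R * t + n.+1%:R); first exact: smooth_affine.
  by apply/funext => t; ring.
Qed.

Lemma time_cutoff_out n t : (T <= t) || (t <= -1) -> time_cutoff n t = 0.
Proof.
case/orP => h; rewrite /time_cutoff.
  by rewrite (flatk0_le0 (y := _ * (T - t))) ?mulr0 ?mul0r// pmulr_rle0// subr_le0.
by rewrite (flatk0_le0 (y := _ * (t + 1))) ?mulr0// pmulr_rle0// -lerBrDr sub0r.
Qed.

Lemma time_cutoff'_out n t : T <= t -> time_cutoff' n t = 0.
Proof.
move=> h; have hN : n.+1%:R * (T - t) <= 0 by rewrite pmulr_rle0// subr_le0.
by rewrite /time_cutoff' /flatk ltNge hN/= addr0 oppr0 mul0r !mulr0 mul0r addr0.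
Qed.

Lemma time_cutoff_le n t : 0 <= t -> `|time_cutoff n t| <= T.
Proof.
move=> t0; have [tT|Tt] := leP T t; first by rewrite time_cutoff_out ?tT// normr0.
have /andP[a0 a1] := flatk0_itv (n.+1%:R * (T - t)).
have /andP[b0 b1] := flatk0_itv (n.+1%:R * (t + 1)).
have Tt0 : 0 <= T - t by rewrite subr_ge0 ltW.
rewrite /time_cutoff ger0_norm; last by rewrite !mulr_ge0.
rewrite -mulrA (le_trans (ler_piMr _ _))//; first by rewrite mulr_ile1.
by rewrite gerBl.
Qed.

(** The last factor of [time_cutoff] makes its transition just after [t = -1], so its derivative is
    negligible on [t >= 0]. *)
Lemma flatk2_scaled_le n t : 0 <= t -> n.+1%:R * flatk 2 (n.+1%:R * (t + 1)) <= n.+1%:R^-1.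
Proof.
move=> t0; have t1 : 0 < t + 1 by rewrite ltr_wpDl.
apply: (@le_trans _ _ (n.+1%:R * (n.+1%:R * (t + 1))^-1 ^+ 2)).
  by rewrite ler_wpM2l// flatk_le_inv// mulr_gt0.
rewrite invfM exprMn [n.+1%:R^-1 ^+ 2]expr2 !mulrA mulfV ?pnatr_eq0// mul1r.
have i0 : 0 <= (t + 1)^-1 by rewrite invr_ge0 ltW.
have i1 : (t + 1)^-1 <= 1 by rewrite invf_le1// lerDr.
by rewrite -mulrA ler_piMr ?invr_ge0// mulr_ile1.
Qed.

Lemma time_cutoff'_le n t : 0 <= t -> `|time_cutoff' n t| <= 1 + T.
Proof.
move=> t0; have [tT|Tt] := leP T t.
  by rewrite time_cutoff'_out// normr0 addr_ge0.
have /andP[a0 a1] := flatk0_itv (n.+1%:R * (T - t)).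
have /andP[b0 b1] := flatk0_itv (n.+1%:R * (t + 1)).
have Tt0 : 0 <= T - t by rewrite subr_ge0 ltW.
have c0 : 0 <= n.+1%:R * flatk 2 (n.+1%:R * (t + 1)) by rewrite mulr_ge0// flatk_ge0.
have c1 : n.+1%:R * flatk 2 (n.+1%:R * (t + 1)) <= 1.
  by rewrite (le_trans (flatk2_scaled_le n t0))// invf_le1// ler1n.
rewrite (le_trans (ler_normD _ _))// lerD//.
  rewrite mulNr normrN ger0_norm; last by rewrite mulr_ge0// addr_ge0// flatk_ge0.
  by rewrite mulr_ile1// ?flatk01_le1// addr_ge0// flatk_ge0.
rewrite ger0_norm; last by rewrite mulr_ge0// mulr_ge0.
rewrite -mulrA (le_trans (ler_piMr _ _))//; first by rewrite mulr_ile1.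
by rewrite gerBl.
Qed.

Lemma cvg_inv_nat : n.+1%:R^-1 @[n --> \oo] --> (0 : R).
Proof. exact: cvg_harmonic. Qed.

Lemma cvg_time_cutoff' t : 0 <= t ->
  time_cutoff' n t @[n --> \oo] --> (- (if t < T then 1 else 0) : R).
Proof.
move=> t0; case: ifPn => [tT|]; last first.
  rewrite -leNgt oppr0 => Tt; rewrite (_ : (fun _ => _) = fun=> 0); first exact: cvg_cst.
  by apply/funext => n; exact: time_cutoff'_out.
have Tt : 0 < T - t by rewrite subr_gt0.
have c0 (c : R) : 0 < c -> flatk 0 (n.+1%:R * c) @[n --> \oo] --> (1 : R).
  move=> c0; apply: (cvg_flatk0 c0); apply: nearW => n.
  by rewrite mulrC (ler_wpM2r (ltW c0))// ler_nat.
have c1 : flatk 1 (n.+1%:R * (T - t)) @[n --> \oo] --> (0 : R).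
  apply: (@squeeze_cvgr _ _ _ _ (fun=> 0) (fun n => (T - t)^-1 * n.+1%:R^-1)).
  - apply: nearW => n; rewrite flatk_ge0/= -invfM mulrC.
    by rewrite -[leRHS]expr1 flatk_le_inv// mulr_gt0.
  - exact: cvg_cst.
  - by rewrite -[X in _ --> X](mulr0 (T - t)^-1); apply: cvgMl_tmp; exact: cvg_inv_nat.
have c2 : n.+1%:R * flatk 2 (n.+1%:R * (t + 1)) @[n --> \oo] --> (0 : R).
  apply: (@squeeze_cvgr _ _ _ _ (fun=> 0) (fun n => n.+1%:R^-1)).
  - by apply: nearW => n; rewrite flatk2_scaled_le// mulr_ge0// flatk_ge0.
  - exact: cvg_cst.
  - exact: cvg_inv_nat.
have -> : - 1 = - (1 + 0) * 1 + (T - t) * 1 * 0 :> R by rewrite !mulr1 mulr0 !addr0.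
apply: cvgD.
- apply: cvgM; last by apply: c0; rewrite ltr_wpDl.
  by apply: cvgN; apply: cvgD => //; exact: c0.
- by apply: cvgM => //; apply: cvgM; [exact: cvg_cst|exact: c0].
Qed.

End time_cutoff.

Section space_cutoff.
Context {R : realType} {d : nat}.
Local Notation X := 'rV[R]_d.

(** The classical bump [exp (1 - 1 / (1 - y^2))] on []-1, 1[], normalised by [expR 1] to equal 1 at
    the origin. *)
Definition bump (y : R) : R := expR 1 * flatk 0 (1 - y ^+ 2).

Lemma bump_window : window_spec Euclidean bump.
Proof.
split.
- move=> k; apply: CkM; first exact: Ck_cst.
  rewrite -[fun _ => _]/(flatk 0 \o (fun y : R => 1 - y ^+ 2)).
  apply: Ck_comp; first exact: smooth_flatk.
  apply: CkD; first exact: Ck_cst.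
  apply: CkN; rewrite (_ : (fun y : R => y ^+ 2) = fun y => (1 * y + 0) * (1 * y + 0)); last first.
    by apply/funext => y; rewrite mul1r addr0 expr2.
  by apply: CkM; exact: smooth_affine.
- move=> y; rewrite /bump mulr_ge0 ?expR_ge0 ?flatk_ge0//=.
  rewrite /flatk; case: ifPn => [y0|_]; last by rewrite mulr0.
  rewrite expr0 mul1r -expRD -[leRHS]expR0 ler_expR subr_le0.
  by rewrite -[leLHS]invr1 lef_pV2 ?posrE// gerBl sqr_ge0.
- exists 1 => y y1; rewrite /bump flatk0_le0 ?mulr0// subr_le0.
  by rewrite -real_normK ?num_real// exprn_ege1// ltW.
Qed.

Lemma bump0 : bump 0 = 1.
Proof. by rewrite /bump expr0n/= subr0 /flatk ltr01 expr0 mul1r invr1 -expRD subrr expR0. Qed.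

Lemma derive_scale (K : X -> R) (a : R) (x v : X) : differentiable K (a *: x) ->
  'D_v (fun y => K (a *: y)) x = a * 'D_v K (a *: x).
Proof.
move=> dK; rewrite [LHS](derive_precomp v (is_diff_scaler a x))//.
by rewrite !deriveE// linearZ.
Qed.

(** On R^d these are dilations of a single bump, whose gradients are of order [1 / n]. That rate
    kills the drift terms in the mass balance, where a gradient of the cutoff multiplies functions
    that are merely integrable. On the torus the constant 1 is itself a test function, and
    [C = 0]. *)
Lemma space_cutoff (S : geometry R) : exists eta : nat -> X -> R, exists2 C : R, 0 <= C &
  [/\ forall n, test S (eta n), forall n x, 0 <= eta n x <= 1,
      forall x, eta n x @[n --> \oo] --> (1 : R) &
      forall n x, enorm (grad (eta n) x) <= C * n.+1%:R^-1].
Proof.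
case: S => [|L]; last first.
  exists (fun _ _ => 1), 0 => //; split.
  - move=> n; split; [by move=> k; exact: Ck_cst|by []|].
    exists (Num.sqrt (d%:R * L%:num ^+ 2)) => x cx; rewrite ltNge => /negP[].
    apply: enorm_le_cube => i; have /andP[x0 xL] := cx i.
    by rewrite ger0_norm// ltW.
  - by move=> n x; rewrite ler01 lexx.
  - by move=> x; exact: cvg_cst.
  - move=> n x; rewrite mul0r (_ : grad _ _ = 0) /enorm ?dot0r ?sqrtr0//.
    by apply/rowP => i; rewrite !mxE derive_cst.
pose K (x : X) := \prod_i bump (x ord0 i).
have tK : test Euclidean K by apply: (@test_window_prod _ _ Euclidean (fun=> bump)) => i; exact: bump_window.
have [sK _ [M KM]] := tK.
have cg : continuous (fun x => enorm (grad K x)).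
  apply: continuous_enorm => i; under eq_fun do rewrite mxE.
  exact: (smooth_continuous (smooth_derive _ sK)).
have gM x : cell Euclidean x -> M < enorm x -> enorm (grad K x) = 0.
  move=> cx Mx; rewrite (_ : grad K x = 0) /enorm ?dot0r ?sqrtr0//.
  by apply/rowP => i; rewrite !mxE; exact: (test_derive0 sK KM).
have [C C0 hC] := bounded_on_cell cg gM.
have b01 (y : R) : 0 <= bump y <= 1 by have [] := bump_window.
exists (fun n x => K (n.+1%:R^-1 *: x)), C => //; split.
- move=> n; split => //.
    by move=> k; apply: (Ck_precomp (is_diff_scaler n.+1%:R^-1)); exact: sK.
  exists (n.+1%:R * M) => x _ Mx; apply: KM => //.
  rewrite /enorm dotZl dotZr mulrA -expr2 sqrtrM ?sqr_ge0// sqrtr_sqr ger0_norm ?invr_ge0//.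
  by rewrite ltr_pdivlMl.
- move=> n x; rewrite prodr_ge0 => [|i _]; last by have /andP[] := b01 ((n.+1%:R^-1 *: x) ord0 i).
  by apply: prodr_ile1 => i _; exact: b01.
- move=> x; have K0 : K 0 = 1 by rewrite /K big1// => i _; rewrite mxE bump0.
  rewrite -[X in _ --> X]K0; apply: continuous_cvg; first exact: (smooth_continuous sK).
  by rewrite -[X in _ --> X](scale0r x); apply: cvgZr_tmp; exact: cvg_harmonic.
- move=> n x; have -> : grad (fun y => K (n.+1%:R^-1 *: y)) x = n.+1%:R^-1 *: grad K (n.+1%:R^-1 *: x).
    apply/rowP => i; rewrite !mxE derive_scale//; exact: smooth_differentiable.
  rewrite /enorm dotZl dotZr mulrA -expr2 sqrtrM ?sqr_ge0// sqrtr_sqr ger0_norm ?invr_ge0//.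
  by rewrite mulrC ler_wpM2r ?invr_ge0// (le_trans (ler_norm _))// hC.
Qed.

End space_cutoff.

Section tensor.
Context {R : realType} {d : nat}.
Local Notation X := 'rV[R]_d.
Local Notation space := (R * (X * X))%type.

Lemma is_diff_fst (E F : normedModType R) (z : E * F) :
  is_diff z (fst : E * F -> E) (fst : E * F -> E).
Proof.
have c : continuous (fst : E * F -> E) by move=> y; exact: cvg_fst.
by apply: DiffDef; [exact: linear_differentiable|exact: diff_lin].
Qed.

Lemma is_diff_snd (E F : normedModType R) (z : E * F) :
  is_diff z (snd : E * F -> F) (snd : E * F -> F).
Proof.
have c : continuous (snd : E * F -> F) by move=> y; exact: cvg_snd.
by apply: DiffDef; [exact: linear_differentiable|exact: diff_lin].
Qed.

Definition tensor (A : R -> R) (eta zeta : X -> R) (z : space) : R :=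
  A z.1 * (eta z.2.1 * zeta z.2.2).

Variables (A : R -> R) (eta zeta : X -> R).
Hypotheses (sA : smooth A) (seta : smooth eta) (szeta : smooth zeta).

Let is_diff_x (z : space) : is_diff z (fun z : space => z.2.1) (fun z : space => z.2.1).
Proof. exact: (is_diff_comp (is_diff_snd z) (is_diff_fst z.2)). Qed.

Let is_diff_v (z : space) : is_diff z (fun z : space => z.2.2) (fun z : space => z.2.2).
Proof. exact: (is_diff_comp (is_diff_snd z) (is_diff_snd z.2)). Qed.

Lemma smooth_tensor : smooth (tensor A eta zeta).
Proof.
move=> k; apply: CkM; first by apply: (Ck_precomp (@is_diff_fst R (X * X)%type)); exact: sA.
by apply: CkM; [apply: (Ck_precomp is_diff_x)|apply: (Ck_precomp is_diff_v)].
Qed.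

Lemma derive_tensor (v z : space) : 'D_v (tensor A eta zeta) z =
  'D_(v.1) A z.1 * (eta z.2.1 * zeta z.2.2) +
  A z.1 * ('D_(v.2.1) eta z.2.1 * zeta z.2.2 + eta z.2.1 * 'D_(v.2.2) zeta z.2.2).
Proof.
have dA := smooth_differentiable z.1 sA.
have de := smooth_differentiable z.2.1 seta.
have dz := smooth_differentiable z.2.2 szeta.
have EA : 'D_v (A \o (fst : space -> R)) z = 'D_(v.1) A z.1.
  exact: (derive_precomp v (is_diff_fst z)).
have Ee : 'D_v (eta \o (fun z : space => z.2.1)) z = 'D_(v.2.1) eta z.2.1.
  exact: (derive_precomp v (is_diff_x z)).
have Ez : 'D_v (zeta \o (fun z : space => z.2.2)) z = 'D_(v.2.2) zeta z.2.2.
  exact: (derive_precomp v (is_diff_v z)).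
have dA' : derivable (A \o (fst : space -> R)) z v.
  by apply: diff_derivable; apply: differentiable_comp => //; have [] := is_diff_fst z.
have de' : derivable (eta \o (fun z : space => z.2.1)) z v.
  by apply: diff_derivable; apply: differentiable_comp => //; have [] := is_diff_x z.
have dz' : derivable (zeta \o (fun z : space => z.2.2)) z v.
  by apply: diff_derivable; apply: differentiable_comp => //; have [] := is_diff_v z.
apply: etrans (deriveM dA' (derivableM de' dz')) _.
rewrite (deriveM de' dz') EA Ee Ez -![_ *: _]/(_ * _) /=.
have key (a b c x y w : R) : x * (y * c + w * b) + y * w * a = a * (y * w) + x * (b * w + y * c).
  by ring.
exact: key.
Qed.

Lemma derive_zero (E : normedModType R) (f : E -> R) x : differentiable f x -> 'D_0 f x = 0.
Proof. by move=> df; rewrite deriveE// linear0. Qed.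

Lemma grad_x_tensor (z : space) :
  grad_x (tensor A eta zeta) z = (A z.1 * zeta z.2.2) *: grad eta z.2.1.
Proof.
have key (x y w b : R) : 0 * (y * w) + x * (b * w + y * 0) = x * w * b by ring.
apply/rowP => i; apply: etrans (grad_x_coord _ _ _) _; rewrite derive_tensor/= 2?mxE.
by rewrite (derive_zero (f := A)) ?(derive_zero (f := zeta)) ?key//; exact: smooth_differentiable.
Qed.

Lemma grad_v_tensor (z : space) :
  grad_v (tensor A eta zeta) z = (A z.1 * eta z.2.1) *: grad zeta z.2.2.
Proof.
have key (x y w c : R) : 0 * (y * w) + x * (0 * w + y * c) = x * y * c by ring.
apply/rowP => i; apply: etrans (grad_v_coord _ _ _) _; rewrite derive_tensor/= 2?mxE.
by rewrite (derive_zero (f := A)) ?(derive_zero (f := eta)) ?key//; exact: smooth_differentiable.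
Qed.

Lemma transport_tensor (SX SV : geometry R) (phi : potential d SX) (psi : potential d SV)
  (z : space) : transport phi psi (tensor A eta zeta) z =
  'D_1 A z.1 * (eta z.2.1 * zeta z.2.2) +
  A z.1 * (dot (grad psi z.2.2) (grad eta z.2.1) * zeta z.2.2) -
  A z.1 * (eta z.2.1 * dot (grad phi z.2.1) (grad zeta z.2.2)).
Proof.
have key (a x y w b c : R) : a * (y * w) + x * (0 * w + y * 0) + x * w * b - x * y * c =
    a * (y * w) + x * (b * w) - x * (y * c) by ring.
rewrite /transport grad_x_tensor grad_v_tensor !dotZr derive_tensor/=.
by rewrite (derive_zero (f := eta)) ?(derive_zero (f := zeta)) ?key//; exact: smooth_differentiable.
Qed.

End tensor.

Lemma test_tensor (R : realType) (d : nat) (SX SV : geometry R) (A : R -> R)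
  (eta zeta : 'rV[R]_d -> R) (M : R) : smooth A -> (forall t, M < `|t| -> A t = 0) ->
  test SX eta -> test SV zeta -> @test_txv R d SX SV (tensor A eta zeta).
Proof.
move=> sA AM [se pe [Me he]] [sz pz [Mz hz]]; split.
- exact: smooth_tensor.
- by move=> t v; case: SX pe {he} => // L pe x i; rewrite /tensor/= pe.
- by move=> t x; case: SV pz {hz} => // L pz v i; rewrite /tensor/= pz.
exists (`|M| + `|Me| + `|Mz|) => t x v cx cv.
have b1 : M <= `|M| + `|Me| + `|Mz|.
  by rewrite -addrA (le_trans (ler_norm M))// lerDl addr_ge0.
have b2 : Me <= `|M| + `|Me| + `|Mz|.
  by rewrite addrAC (le_trans (ler_norm Me))// lerDr addr_ge0.
have b3 : Mz <= `|M| + `|Me| + `|Mz|.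
  by rewrite (le_trans (ler_norm Mz))// lerDr addr_ge0.
rewrite /tensor /= => /or3P[h|h|h].
- by rewrite AM ?mul0r// (le_lt_trans b1).
- by rewrite he ?mul0r ?mulr0// (le_lt_trans b2).
- by rewrite hz ?mulr0// (le_lt_trans b3).
Qed.

(** * Conservation of mass *)

Section real_dominated_convergence.
Context {R : realType} {d} {T : measurableType d} (m : {measure set T -> \bar R}).

Lemma dominated_cvg_Rintegral (D : set T) (f_ : nat -> T -> R) (f g : T -> R) :
  measurable D -> (forall n, measurable_fun D (f_ n)) ->
  (forall x, D x -> f_ n x @[n --> \oo] --> f x) ->
  m.-integrable D (EFin \o g) -> (forall n x, D x -> `|f_ n x| <= g x) ->
  \int[m]_(x in D) f_ n x @[n --> \oo] --> \int[m]_(x in D) f x.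
Proof.
move=> mD mf cf ig fg.
have mf' n : measurable_fun D (EFin \o f_ n) by exact/measurable_EFinP.
have cf' x : D x -> (EFin \o f_ n) x @[n --> \oo] --> (EFin \o f) x.
  by move=> Dx; apply: cvg_EFin; [exact: nearW|exact: cf].
have fg' n x : D x -> (`|(EFin \o f_ n) x| <= (EFin \o g) x)%E.
  by move=> Dx; rewrite lee_fin; exact: fg.
have mf0 : measurable_fun D (EFin \o f).
  by apply/measurable_EFinP; apply: (measurable_fun_cvg mf) => x; exact: cf.
have [iff _ cvg_int] := dominated_convergence mD mf' mf0 (aeW m cf') ig
  (aeW m (fun x n => fg' n x)).
by apply: fine_cvg; rewrite fineK//; exact: integrable_fin_num iff.
Qed.

Lemma cvg0_harmonic_le (u : nat -> R) (c : R) : (forall n, `|u n| <= c * n.+1%:R^-1) ->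
  u n @[n --> \oo] --> (0 : R).
Proof.
move=> uc; apply/norm_cvg0P; apply: (@squeeze_cvgr _ _ _ _ (fun=> 0) (fun n => c * n.+1%:R^-1)).
- by apply: nearW => n; rewrite normr_ge0 uc.
- exact: cvg_cst.
- by rewrite -[X in _ --> X](mulr0 c); apply: cvgMl_tmp; exact: cvg_harmonic.
Qed.

End real_dominated_convergence.

(** The domination of the weak integrand by a multiple of [moment]: [a], [b], [c], [g] stand for the
    norms of [h], [nabla psi], [nabla phi] and the velocity gradient, [x] for [|xi|] and [t] for
    [T]. Each of [a], [a b], [a c] and [g] is at most 1 plus the sum of the four squares. *)
Lemma moment_dominates (R : realFieldType) (a b c g x t C1 C2 : R) :
  0 <= a -> 0 <= b -> 0 <= c -> 0 <= g -> 0 <= x -> 0 <= t -> 0 <= C1 -> 0 <= C2 ->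
  a * ((1 + t) + t * (b * C1) + t * (c * C2)) + x * (t * (g * C2)) <=
  ((1 + t) + t * C1 + t * C2 + x * (t * C2)) * (1 + a ^+ 2 + b ^+ 2 + c ^+ 2 + g ^+ 2).
Proof.
move=> a0 b0 c0 g0 x0 t0 C1_ge0 C2_ge0.
have le1 : a <= 1 + a ^+ 2 + b ^+ 2 + c ^+ 2 + g ^+ 2 by nra.
have le2 : a * b <= 1 + a ^+ 2 + b ^+ 2 + c ^+ 2 + g ^+ 2 by nra.
have le3 : a * c <= 1 + a ^+ 2 + b ^+ 2 + c ^+ 2 + g ^+ 2 by nra.
have le4 : g <= 1 + a ^+ 2 + b ^+ 2 + c ^+ 2 + g ^+ 2 by nra.
move: (1 + a ^+ 2 + b ^+ 2 + c ^+ 2 + g ^+ 2) le1 le2 le3 le4 => k le1 le2 le3 le4.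
have -> : a * (1 + t + t * (b * C1) + t * (c * C2)) + x * (t * (g * C2)) =
  (1 + t) * a + t * C1 * (a * b) + t * C2 * (a * c) + x * (t * C2) * g by ring.
have p0 : 0 <= 1 + t by rewrite addr_ge0.
have q0 : 0 <= t * C1 by rewrite mulr_ge0.
have r0 : 0 <= t * C2 by rewrite mulr_ge0.
have s0 : 0 <= x * (t * C2) by rewrite mulr_ge0.
move: (1 + t) (t * C1) (x * (t * C2)) (t * C2) p0 q0 s0 r0 => p q s r p0 q0 s0 r0.
by rewrite !mulrDl !lerD// ler_wpM2l.
Qed.

Lemma prod3_le (R : realFieldType) (a b c t e : R) :
  `|a| <= t -> `|b| <= e -> `|c| <= 1 -> `|a * (b * c)| <= t * e.
Proof.
by move=> at_ be c1; rewrite !normrM ler_pM ?mulr_ge0// -[leRHS]mulr1 ler_pM.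
Qed.

Section marginals.
Context {R : realType} {d1 d2} {T1 : measurableType d1} {T2 : measurableType d2}.
Variables (m1 : probability T1 R) (m2 : probability T2 R).
Local Open Scope ereal_scope.

Lemma ge0_integral_snd (f : T2 -> \bar R) : measurable_fun setT f -> (forall y, 0 <= f y) ->
  \int[(m1 \x m2)]_z f z.2 = \int[m2]_y f y.
Proof.
move=> mf f0; rewrite fubini_tonelli1//; last exact: measurableT_comp.
apply: etrans (integral_cst m1 measurableT (\int[m2]_y f y)) _.
by rewrite [X in _ * X](@probability_setT _ _ _ m1) mule1.
Qed.

Lemma ge0_integral_fst (f : T1 -> \bar R) : measurable_fun setT f -> (forall x, 0 <= f x) ->
  \int[(m1 \x m2)]_z f z.1 = \int[m1]_x f x.
Proof.
move=> mf f0; rewrite fubini_tonelli1//; last exact: measurableT_comp.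
apply: eq_integral => x _; apply: etrans (integral_cst m2 measurableT (f x)) _.
by rewrite [X in _ * X](@probability_setT _ _ _ m2) mule1.
Qed.

End marginals.

Section mass.
Context {R : realType} {d : nat} {SX SV : geometry R}.
Context (phi : potential d SX) (psi : potential d SV) (xi : R).
Local Notation X := 'rV[R]_d.
Local Notation space := (measurableTypeR R * (X * X))%type.
Local Notation P := (gibbs phi).
Local Notation Q := (gibbs psi).
Local Notation PQ := (gibbsXV phi psi).
Local Notation D0 := (`[0%R, +oo[%classic `*` setT : set space).
Let m : {measure set space -> \bar R} := (lebesgue_measure \x gibbsXV phi psi)%E.
Variables (h0 : X * X -> R) (h : R * (X * X) -> R) (G : R * (X * X) -> X).
Hypothesis sol : VOU_with phi psi xi h0 h G.
Hypothesis grad_phi_L2 : L2v P (grad phi).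
Hypothesis grad_psi_L2 : L2v Q (grad psi).
Variable T : R.
Hypothesis T0 : 0 <= T.
Local Notation W := (`[0%R, T]%classic `*` setT : set space).

Definition moment (z : R * (X * X)) : R :=
  1 + h z ^+ 2 + enorm (grad psi z.2.2) ^+ 2 + enorm (grad phi z.2.1) ^+ 2 + enorm (G z) ^+ 2.

Let mW : measurable W. Proof. exact: measurableX. Qed.
Let mD0 : measurable D0. Proof. exact: measurableX. Qed.

Lemma slab_cst_integrable (f : X * X -> R) : measurable_fun setT f ->
  (\int[PQ]_y (f y ^+ 2)%:E < +oo)%E -> m.-integrable W (fun z => (f z.2 ^+ 2)%:E).
Proof.
move=> mf f2; have mf2 : measurable_fun setT (fun z : space => (f z.2 ^+ 2)%:E).
  apply/measurable_EFinP/measurable_funX; exact: (measurableT_comp mf measurable_snd).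
apply/integrableP; split; first exact: measurable_funTS.
under eq_integral do rewrite /= ger0_norm ?sqr_ge0//.
rewrite (ge0_integral_slab PQ (A := `[0%R, T]%classic) _ mf2)//; last first.
  by move=> z; rewrite lee_fin sqr_ge0.
rewrite [X in (X < _)%E](integral_cst lebesgue_measure _ (\int[PQ]_y (f y ^+ 2)%:E)%E)//.
apply: lte_mul_pinfty => //.
- by apply: integral_ge0 => y _; rewrite lee_fin sqr_ge0.
- by rewrite ge0_fin_numE// integral_ge0// => y _; rewrite lee_fin sqr_ge0.
- apply: (@le_lt_trans _ _ (lebesgue_measure (`[0%R, T]%classic : set R))) => //.
  by rewrite lebesgue_measure_itv/=; case: ifP => // _; rewrite -EFinB ltry.
Qed.

Let mgphi i : measurable_fun setT (fun x => grad phi x ord0 i).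
Proof. exact: L2v_measurable. Qed.

Let mgpsi i : measurable_fun setT (fun x => grad psi x ord0 i).
Proof. exact: L2v_measurable. Qed.

Lemma moment_integrable : m.-integrable W (EFin \o moment).
Proof.
have mh := vou_measurable sol; have mG := vou_grad_measurable sol.
have i1 : m.-integrable W (fun=> 1%:E).
  apply/integrableP; split=> //; under eq_integral do rewrite /= normr1.
  by rewrite integral_cst// mul1e; exact: slab_lty.
have i2 : m.-integrable W (fun z => (h z ^+ 2)%:E).
  apply/integrableP; split.
    by apply: measurable_funTS; apply/measurable_EFinP; exact: measurable_funX.
  by under eq_integral do rewrite /= ger0_norm ?sqr_ge0//; exact: (slab_sqr_lty sol).
have i3 : m.-integrable W (fun z => (enorm (grad psi z.2.2) ^+ 2)%:E).
  apply: (slab_cst_integrable (f := fun y => enorm (grad psi y.2))).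
    apply: (measurableT_comp (f := fun v => enorm (grad psi v))); last exact: measurable_snd.
    exact: measurable_enorm.
  have [_] := (L2vP _ _).1 grad_psi_L2; apply: le_lt_trans.
  rewrite (ge0_integral_snd P Q (f := fun v => (enorm (grad psi v) ^+ 2)%:E))//.
    by apply/measurable_EFinP/measurable_funX; exact: measurable_enorm.
  by move=> v; rewrite lee_fin sqr_ge0.
have i4 : m.-integrable W (fun z => (enorm (grad phi z.2.1) ^+ 2)%:E).
  apply: (slab_cst_integrable (f := fun y => enorm (grad phi y.1))).
    apply: (measurableT_comp (f := fun v => enorm (grad phi v))); last exact: measurable_fst.
    exact: measurable_enorm.
  have [_] := (L2vP _ _).1 grad_phi_L2; apply: le_lt_trans.
  rewrite (ge0_integral_fst P Q (f := fun x => (enorm (grad phi x) ^+ 2)%:E))//.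
    by apply/measurable_EFinP/measurable_funX; exact: measurable_enorm.
  by move=> x; rewrite lee_fin sqr_ge0.
have i5 : m.-integrable W (fun z => (enorm (G z) ^+ 2)%:E).
  have mG2 : measurable_fun setT (fun z : space => (enorm (G z) ^+ 2)%:E).
    by apply/measurable_EFinP/measurable_funX; exact: measurable_enorm.
  apply/integrableP; split; first exact: measurable_funTS.
  under eq_integral do rewrite /= ger0_norm ?sqr_ge0//.
  apply: le_lt_trans (vou_grad_L2 sol); apply: ge0_subset_integral => //.
  - exact: measurable_funTS.
  - by move=> z _; rewrite lee_fin sqr_ge0.
  - by move=> z [/= + _]; rewrite !in_itv/= => /andP[-> _].
exact: (integrableD mW (integrableD mW (integrableD mW (integrableD mW i1 i2) i3) i4) i5).
Qed.

Lemma moment_patch_integrable (B : R) :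
  m.-integrable D0 (fun z => (if z \in W then B * moment z else 0)%:E).
Proof.
apply: (integrableS measurableT) => //.
rewrite (_ : (fun z => _) = (fun z => (B * moment z)%:E) \_ W); last first.
  by apply/funext => z; rewrite patchE; case: ifP.
apply/(integrable_mkcond _ mW).1.
exact: (integrableZl mW B moment_integrable).
Qed.

(** The factor multiplying [h] is the limit of [time_cutoff'], the time derivative of
    [(T - t)^+]. *)
Lemma before_integrable :
  m.-integrable D0 (fun z => (h z * - (if z.1 < T then 1 else 0))%:E).
Proof.
have mh := vou_measurable sol.
apply: (le_integrable mD0 _ _ (moment_patch_integrable 1)).
  apply: measurable_funTS; apply/measurable_EFinP; apply: measurable_funM => //.
  apply: measurableT_comp => //; apply: measurable_fun_if => //.
    by apply: measurable_fun_ltr => //; exact: measurable_fst.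
move=> z [/= + _]; rewrite in_itv/= andbT lee_fin => z0.
case: ifPn => [zT|_]; last by rewrite oppr0 mulr0 normr0.
rewrite mem_set; last by split => //=; rewrite in_itv/= z0 ltW.
rewrite mul1r mulrN1 normrN [leRHS]ger0_norm; last by rewrite /moment !addr_ge0// sqr_ge0.
apply: (@le_trans _ _ (1 + h z ^+ 2)); last by rewrite /moment -2!addrA lerDl !addr_ge0// sqr_ge0.
by rewrite -(real_normK (num_real (h z))); have := normr_ge0 (h z); nra.
Qed.

Hypothesis h0_L2 : h0 \in Lfun PQ 2%:E.
Hypothesis h0_mean : \int[PQ]_y h0 y = 0.

(** The test functions approximate [(T - t)^+], constant in [x] and [v]. The terms with a derivative
    in [x] or [v] are [O(1 / n)] pointwise, and the initial term tends to 0 because [h0] has mean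
    zero. *)
Lemma mass_before : \int[m]_(z in D0) (h z * - (if z.1 < T then 1 else 0)) = 0.
Proof.
have mh := vou_measurable sol; have mG := vou_grad_measurable sol.
have [eta [C1 C1_ge0 [teta beta ceta geta]]] := @space_cutoff R d SX.
have [zeta [C2 C2_ge0 [tzeta bzeta czeta gzeta]]] := @space_cutoff R d SV.
pose th n := tensor (time_cutoff T n) (eta n) (zeta n).
have sA n := @smooth_time_cutoff R T n.
have tth n : @test_txv R d SX SV (th n).
  apply: (@test_tensor _ _ _ _ _ _ _ (1 + T)) => // t.
  move=> ht; apply: time_cutoff_out; case: (leP 0 t) ht => t0.
    by rewrite ger0_norm// => h'; rewrite (le_trans _ (ltW h')) ?lerDr.
  rewrite ltr0_norm// => h'; apply/orP; right.
  by rewrite lerNr (le_trans _ (ltW h'))// lerDl.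
pose F n (z : space) := h z * transport phi psi (th n) z - xi * dot (G z) (grad_v (th n) z).
(* [P_], [Q_] and [R_] are the error terms: the gradient of a cutoff against [nabla psi], against
   [nabla phi], and against the velocity gradient of the solution. *)
pose P_ n (z : space) := time_cutoff T n z.1 * (dot (grad psi z.2.2) (grad (eta n) z.2.1) * zeta n z.2.2).
pose Q_ n (z : space) := time_cutoff T n z.1 * (eta n z.2.1 * dot (grad phi z.2.1) (grad (zeta n) z.2.2)).
pose R_ n (z : space) := time_cutoff T n z.1 * eta n z.2.1 * dot (G z) (grad (zeta n) z.2.2).
have FE n z : F n z = h z * (time_cutoff' T n z.1 * (eta n z.2.1 * zeta n z.2.2) + P_ n z - Q_ n z) - xi * R_ n z.
  have [seta _ _] := teta n; have [szeta _ _] := tzeta n.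
  rewrite /F (transport_tensor (sA n) seta szeta) (grad_v_tensor (sA n) seta szeta) dotZr.
  by have -> : 'D_1 (time_cutoff T n) z.1 = time_cutoff' T n z.1 by have [] := is_derive_time_cutoff T n z.1.
have nb (y : R) : 0 <= y <= 1 -> `|y| <= 1 by move=> /andP[y0 y1]; rewrite ger0_norm.
have dn (e a C : R) n : a <= C * n.+1%:R^-1 -> 0 <= e -> e * a <= e * C * n.+1%:R^-1.
  by move=> aC e0; rewrite -mulrA ler_wpM2l.
have bP n (z : space) : 0 <= z.1 -> `|P_ n z| <= T * (enorm (grad psi z.2.2) * C1 * n.+1%:R^-1).
  move=> z0; apply: prod3_le; [exact: time_cutoff_le| |exact: nb].
  by apply: le_trans (dot_le_enorm _ _) _; apply: dn => //; exact: enorm_ge0.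
have bQ n (z : space) : 0 <= z.1 -> `|Q_ n z| <= T * (enorm (grad phi z.2.1) * C2 * n.+1%:R^-1).
  move=> z0; rewrite /Q_ [eta n _ * _]mulrC; apply: prod3_le; [exact: time_cutoff_le| |exact: nb].
  by apply: le_trans (dot_le_enorm _ _) _; apply: dn => //; exact: enorm_ge0.
have bR n (z : space) : 0 <= z.1 -> `|R_ n z| <= T * (enorm (G z) * C2 * n.+1%:R^-1).
  move=> z0; rewrite /R_ -mulrA [eta n _ * _]mulrC; apply: prod3_le; [exact: time_cutoff_le| |exact: nb].
  by apply: le_trans (dot_le_enorm _ _) _; apply: dn => //; exact: enorm_ge0.
have {dn}bP n (z : space) : 0 <= z.1 -> `|P_ n z| <= T * (enorm (grad psi z.2.2) * C1) * n.+1%:R^-1.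
  by move=> z0; rewrite -mulrA; exact: bP.
have {}bQ n (z : space) : 0 <= z.1 -> `|Q_ n z| <= T * (enorm (grad phi z.2.1) * C2) * n.+1%:R^-1.
  by move=> z0; rewrite -mulrA; exact: bQ.
have {}bR n (z : space) : 0 <= z.1 -> `|R_ n z| <= T * (enorm (G z) * C2) * n.+1%:R^-1.
  by move=> z0; rewrite -mulrA; exact: bR.
(* The factor of [moment_dominates], once [n.+1%:R^-1] is bounded by 1 in the error terms. *)
pose B := (1 + T) + T * C1 + T * C2 + `|xi| * (T * C2).
have cvgF : \int[m]_(z in D0) F n z @[n --> \oo] --> \int[m]_(z in D0) (h z * - (if z.1 < T then 1 else 0)).
  apply: (@dominated_cvg_Rintegral _ _ _ m D0 F _ (fun z => if z \in W then B * moment z else 0)) => //.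
  - move=> n; apply/measurable_EFinP; exact: measurable_int (weak_integrand_integrable sol (tth n)).
  - move=> z [/= + _]; rewrite in_itv/= andbT => z0.
    under eq_fun do rewrite FE.
    have -> : h z * - (if z.1 < T then 1 else 0) =
        h z * (- (if z.1 < T then 1 else 0) * (1 * 1) + 0 - 0) - xi * 0.
      by rewrite mulr0 !subr0 addr0 !mulr1.
    apply: cvgB; apply: cvgM; [exact: cvg_cst| |exact: cvg_cst|].
    + apply: cvgB; last exact: (cvg0_harmonic_le (fun n => bQ n z z0)).
      apply: cvgD; last exact: (cvg0_harmonic_le (fun n => bP n z z0)).
      by apply: cvgM; [exact: cvg_time_cutoff'|apply: cvgM].
    + exact: (cvg0_harmonic_le (fun n => bR n z z0)).
  - exact: moment_patch_integrable.
  - move=> n z [/= + _]; rewrite in_itv/= andbT => z0.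
    have [zT|zT] := leP z.1 T; last first.
      rewrite ifN; last by apply/negP => /set_mem[/= + _]; rewrite in_itv/= z0 leNgt zT.
      rewrite FE /P_ /Q_ /R_ (time_cutoff'_out _ (ltW zT)) time_cutoff_out ?(ltW zT)//.
      by rewrite !mul0r addr0 subr0 !mulr0 subr0 normr0.
    rewrite mem_set; last by split => //=; rewrite in_itv/= z0.
    have n1 (a y : R) : 0 <= y -> a <= y * n.+1%:R^-1 -> a <= y.
      by move=> y0 /le_trans; apply; rewrite ler_piMr// invf_le1// ler1n.
    have e1 := enorm_ge0 (grad psi z.2.2); have e2 := enorm_ge0 (grad phi z.2.1).
    have e3 := enorm_ge0 (G z).
    have {}bP := n1 _ _ _ (bP n z z0); have {}bQ := n1 _ _ _ (bQ n z z0).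
    have {}bR := n1 _ _ _ (bR n z z0).
    have bA : `|time_cutoff' T n z.1 * (eta n z.2.1 * zeta n z.2.2)| <= 1 + T.
      rewrite normrM -[leRHS]mulr1 ler_pM ?time_cutoff'_le//.
      by rewrite normrM mulr_ile1// nb.
    rewrite FE (le_trans (ler_normB _ _))// [`|h z * _|]normrM [`|xi * _|]normrM.
    apply: (@le_trans _ _ (`|h z| * ((1 + T) + T * (enorm (grad psi z.2.2) * C1) +
        T * (enorm (grad phi z.2.1) * C2)) + `|xi| * (T * (enorm (G z) * C2)))).
      apply: lerD; apply: ler_wpM2l => //; last by apply: bR; rewrite !mulr_ge0.
      rewrite (le_trans (ler_normB _ _))// lerD//; last by apply: bQ; rewrite !mulr_ge0.
      rewrite (le_trans (ler_normD _ _))// lerD//; by apply: bP; rewrite !mulr_ge0.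
    have hh : h z ^+ 2 = `|h z| ^+ 2 by rewrite real_normK// num_real.
    by rewrite /B /moment hh; apply: moment_dominates.
have cvg0 : \int[PQ]_y (h0 y * (eta n y.1 * zeta n y.2)) @[n --> \oo] --> (0 : R).
  rewrite -h0_mean; apply: (@dominated_cvg_Rintegral _ _ _ PQ setT _ _ (fun y => `|h0 y|)) => //.
  - have mh0 := Lfun_measurable h0_L2.
    move=> n; have [seta _ _] := teta n; have [szeta _ _] := tzeta n.
    apply: measurable_funM => //; apply: measurable_funM.
      exact: (measurableT_comp (smooth_measurable seta) measurable_fst).
    exact: (measurableT_comp (smooth_measurable szeta) measurable_snd).
  - move=> y _; rewrite -[X in _ --> X]mulr1 -[X in _ * X]mulr1.
    by apply: cvgM; [exact: cvg_cst|apply: cvgM].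
  - exact: integrable_norm (Lfun2_integrable h0_L2).
  - move=> n y _; rewrite normrM -[leRHS]mulr1 ler_wpM2l// normrM.
    by rewrite mulr_ile1// nb.
have init n : \int[m]_(z in D0) F n z = - (time_cutoff T n 0 * \int[PQ]_y (h0 y * (eta n y.1 * zeta n y.2))).
  apply/eqP; rewrite -addr_eq0 -[X in _ == X](vou_weak sol (tth n)); apply/eqP; congr (_ + _).
  have [seta _ [M1 hM1]] := teta n; have [szeta _ [M2 hM2]] := tzeta n.
  rewrite -RintegralZl//; first by congr (Rintegral _ _ _); apply/funext => y; rewrite mulrCA.
  apply: (integrable_mul_ae_bounded (C := 1)) (Lfun2_integrable h0_L2).
    apply: measurable_funM.
      exact: (measurableT_comp (smooth_measurable seta) measurable_fst).
    exact: (measurableT_comp (smooth_measurable szeta) measurable_snd).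
  by apply: aeW => y; rewrite normrM mulr_ile1// nb.
have cvgF0 : \int[m]_(z in D0) F n z @[n --> \oo] --> (0 : R).
  rewrite (_ : (fun n => \int[m]_(z in D0) F n z) =
    (fun n => - (time_cutoff T n 0 * \int[PQ]_y (h0 y * (eta n y.1 * zeta n y.2))))); last exact/funext.
  apply/norm_cvg0P; apply: (@squeeze_cvgr _ _ _ _ (fun=> 0)
    (fun n => T * `|\int[PQ]_y (h0 y * (eta n y.1 * zeta n y.2))|)).
  - by apply: nearW => n; rewrite normr_ge0 normrN normrM ler_wpM2r// time_cutoff_le.
  - exact: cvg_cst.
  - by rewrite -[X in _ --> X](mulr0 T); apply: cvgMl_tmp; exact/norm_cvg0P.
exact: cvg_unique cvgF cvgF0.
Qed.

End mass.

Section mean.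
Context {R : realType} {d : nat} {SX SV : geometry R}.
Context (phi : potential d SX) (psi : potential d SV) {tau : R} (tau_gt0 : 0 < tau) (xi : R).
Local Notation X := 'rV[R]_d.
Local Notation space := (measurableTypeR R * (X * X))%type.
Local Notation PQ := (gibbsXV phi psi).
Local Notation U2 := (Umu tau_gt0 phi).
Local Notation U3 := (UgibbsXV phi psi tau_gt0).
Local Notation D0 := (`[0%R, +oo[%classic `*` setT : set space).
Let m : {measure set space -> \bar R} := (lebesgue_measure \x gibbsXV phi psi)%E.
Variables (h0 : X * X -> R) (h : R * (X * X) -> R) (G : R * (X * X) -> X).
Hypothesis sol : VOU_with phi psi xi h0 h G.
Hypothesis grad_phi_L2 : L2v (gibbs phi) (grad phi).
Hypothesis grad_psi_L2 : L2v (gibbs psi) (grad psi).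
Hypothesis h0_L2 : h0 \in Lfun PQ 2%:E.
Hypothesis h0_mean : \int[PQ]_y h0 y = 0.
Variable t0 : R.
Hypothesis t0_ge0 : 0 <= t0.
Local Notation W := (`[t0, t0 + tau]%classic `*` setT : set space).

(** The difference of [mass_before] at [t0] and at [t0 + tau]. The two strict indicators leave the
    half-open interval [[t0, t0 + tau[], which differs from the closed window at a single, null,
    time. *)
Lemma translated_mean : \int[U3]_z h (translate t0 z) = 0.
Proof.
have mh := vou_measurable sol.
have t1_ge0 : 0 <= t0 + tau by rewrite addr_ge0// ltW.
have mW : measurable W by exact: measurableX.
have mD0 : measurable D0 by exact: measurableX.
have i0 := before_integrable sol grad_phi_L2 grad_psi_L2 t0.
have i1 := before_integrable sol grad_phi_L2 grad_psi_L2 (t0 + tau).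
have E : \int[m]_(z in W) h z = \int[m]_(z in D0) (h z * - (if z.1 < t0 then 1 else 0) -
    h z * - (if z.1 < t0 + tau then 1 else 0)).
  rewrite [LHS]Rintegral_mkcond [RHS]Rintegral_mkcond.
  apply: ae_eq_Rintegral_nonmeasurable.
  have net : {ae (lebesgue_measure : {measure set (measurableTypeR R) -> \bar R}), forall t : R, t != t0 + tau}.
    exists [set t0 + tau]; split; [exact: measurable_set1|exact: lebesgue_measure_set1|].
    by move=> t /= /negP; rewrite negbK => /eqP.
  have := @ae_fst _ _ _ _ _ lebesgue_measure PQ _ net.
  apply: (@filterS _ _ (ae_filter_ringOfSetsType m)) => z zt; rewrite !patchE.
  have [zW|zW] := boolP (z \in W).
    move: zW => /set_mem[/= + _]; rewrite in_itv/= => /andP[z0 z1].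
    rewrite mem_set; last by split => //=; rewrite in_itv/= (le_trans t0_ge0).
    by rewrite ltNge z0/= lt_neqAle zt z1 oppr0 mulr0 sub0r mulrN1 opprK.
  case: ifPn => // /set_mem[/= + _]; rewrite in_itv/= andbT => z0.
  have [zt0|zt0] := ltP z.1 t0.
    by rewrite (lt_le_trans zt0) ?lerDl ?(ltW tau_gt0)// subrr.
  case: ifPn => [zt1|_]; last by rewrite oppr0 mulr0 subr0.
  exfalso; move/negP : zW; apply; apply/mem_set; split => //=.
  by rewrite in_itv/= zt0 ltW.
have hW : m.-integrable W (EFin \o h).
  have := moment_integrable sol grad_phi_L2 grad_psi_L2 (t0 + tau).
  move=> hi; apply: (le_integrable mW _ _ (integrableS _ mW _ hi)).
  - by apply: measurable_funTS; exact/measurable_EFinP.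
  - move=> z _; rewrite lee_fin [leRHS]ger0_norm; last by rewrite /moment !addr_ge0// sqr_ge0.
    apply: (@le_trans _ _ (1 + h z ^+ 2)); last by rewrite /moment -2!addrA lerDl !addr_ge0// sqr_ge0.
    by rewrite -(real_normK (num_real (h z))); have := normr_ge0 (h z); nra.
  - exact: measurableX.
  - move=> z [/= + _]; rewrite !in_itv/= => /andP[z0 z1]; split => //=.
    by rewrite z1 (le_trans t0_ge0).
rewrite (Rintegral_transfer mW (integral_translate tau_gt0 t0 PQ) mh hW).
rewrite [X in _ * X]E RintegralB//.
rewrite (mass_before sol grad_phi_L2 grad_psi_L2 t0_ge0 h0_L2 h0_mean).
by rewrite (mass_before sol grad_phi_L2 grad_psi_L2 t1_ge0 h0_L2 h0_mean) subr0 mulr0.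
Qed.

Lemma translated_avg_mean : \int[U2]_p avg psi (h \o translate t0) p = 0.
Proof.
have hI := Lfun2_integrable (translated_L2 tau_gt0 sol t0_ge0).
have mhs := measurable_translated sol t0.
pose unI := ge0_integral_unassoc (m2 := gibbs phi) (m12 := U2) (m3 := gibbs psi) (m23 := PQ) (m123 := U3) erefl erefl erefl.
have hI' := integrable_transfer measurable_unassoc ler01 unI mhs hI.
rewrite -[RHS]translated_mean -[RHS]mul1r -[RHS](Rintegral_transfer measurableT unI mhs hI).
exact: (Rintegral_fubini hI').
Qed.

End mean.

(** * The estimate on one window: Pythagoras, Poincare, Lions, averaging *)

Section variance.
Context {R : realType} {disp} {T : measurableType disp} (m : probability T R).

Lemma Rintegral_prob_cst (a : R) : \int[m]_x a = a.
Proof.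
by rewrite /Rintegral (integral_cst m measurableT) [X in (_ * X)%E](@probability_setT _ _ _ m) mule1.
Qed.

Lemma integral_variance (g : T -> R) : g \in Lfun m 2%:E ->
  (\int[m]_x (g x ^+ 2)%:E =
   \int[m]_x ((g x - \int[m]_y g y) ^+ 2)%:E + ((\int[m]_y g y) ^+ 2)%:E)%E.
Proof.
move=> g2; have gi := Lfun2_integrable g2; set a := \int[m]_y g y.
have g2i : m.-integrable setT (fun x => (g x ^+ 2)%:E).
  by have := Lfun_mul_integrable g2 g2; under eq_fun do rewrite -expr2.
have li : m.-integrable setT (fun x => (- (2 * a) * g x + a ^+ 2)%:E).
  have ci : m.-integrable setT (fun=> (a ^+ 2)%:E) by exact: finite_measure_integrable_cst.
  exact: (integrableD measurableT (integrableZl measurableT (- (2 * a)) gi) ci).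
have -> : (fun x => ((g x - a) ^+ 2)%:E) = (fun x => (g x ^+ 2)%:E + (- (2 * a) * g x + a ^+ 2)%:E)%E.
  by apply/funext => x; rewrite -EFinD; congr EFin; ring.
rewrite integralD// -addeA; have -> : (\int[m]_x (- (2 * a) * g x + a ^+ 2)%:E = (- a ^+ 2)%:E)%E.
  have <- : (\int[m]_x (- (2 * a) * g x + a ^+ 2))%:E = (\int[m]_x (- (2 * a) * g x + a ^+ 2)%:E)%E.
    by rewrite /Rintegral fineK//; exact: integrable_fin_num li.
  rewrite RintegralD//; last 2 first.
  - exact: (integrableZl measurableT (- (2 * a)) gi).
  - exact: finite_measure_integrable_cst.
  rewrite RintegralZl// -/a Rintegral_prob_cst; congr EFin; ring.
by rewrite -EFinD addNr adde0.
Qed.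

End variance.

Section slicewise_poincare.
Context {R : realType} {d : nat} {S : geometry R} (psi : potential d S).
Local Notation Q := (gibbs psi).

(** Subtracting the mean leaves the weak gradient [Gg] unchanged, and [Gg] may replace the gradient
    chosen by [wgradx] almost everywhere. *)
Lemma poincare_sqr (c : R) g Gg : 0 < c -> poincare psi c ->
  is_wgrad Q (weak_grad S) g Gg ->
  (\int[Q]_v ((g v - \int[Q]_w g w) ^+ 2)%:E <= (c^-1)%:E * \int[Q]_v (enorm (Gg v) ^+ 2)%:E)%E.
Proof.
move=> c0 hc gG; have [g2 G2 _] := gG; set a := \int[Q]_w g w.
have uG := is_wgrad_lin 1 gG (is_wgrad_cst psi (- a)).
have uE : (fun x => 1 * g x + - a) = (fun x => g x - a) by apply/funext => x; rewrite mul1r.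
have GE : (fun x => 1 *: Gg x + 0) = Gg by apply/funext => x; rewrite scale1r addr0.
rewrite uE GE in uG.
have gi := Lfun2_integrable g2.
have mean0 : \int[Q]_v (g v - a) = 0.
  rewrite RintegralB//; last exact: finite_measure_integrable_cst.
  by rewrite -/a Rintegral_prob_cst subrr.
have hle := hc _ (ex_intro _ _ uG) mean0.
have mG := fun i => L2v_measurable i G2.
have [_ W2 _] := wgradP uG.
rewrite -L2norm_sqr -L2normv_sqr -(L2normv_ae_eq (fun i => L2v_measurable i W2) mG (wgrad_ae uG)).
have cE : c^-1 = (c `^ (- 2^-1)) ^+ 2.
  by rewrite -powR_mulrn ?powR_ge0// -powRrM mulNr mulVf// powR_inv1// ltW.
rewrite cE EFin_expe !expe2 muleACA -!expe2 lee_sqr ?L2norm_ge0//.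
by rewrite mule_ge0 ?L2norm_ge0// lee_fin powR_ge0.
Qed.

End slicewise_poincare.

(** [A], [B], [g] are the squared norms of [(Id - Pi) h], [Pi h] and the velocity gradient, [Y] and
    [Z] the squared dual norms of [(d_t + T) h] and [nabla Pi h]. From [B <= C K (A + Y)] comes
    [A + B <= (1 + C K) A + C K xi^2 g], and the last coefficient is rounded up to [(1 + C K) xi^2]
    to factor the constant. Finiteness of [g] allows the passage to real numbers. *)
Lemma lions_averaging_combine (R : realType) (C K c xi : R) (A B g Y Z : \bar R) :
  0 < c -> 0 <= C -> 0 <= K -> (0 <= B)%E -> (0 <= g)%E -> (0 <= A)%E ->
  (A <= c^-1%:E * g)%E -> (g < +oo)%E -> (Y <= (xi ^+ 2)%:E * g)%E ->
  (Z <= K%:E * (A + Y))%E -> (B <= C%:E * Z)%E ->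
  (A + B <= ((1 + C * K) * (c^-1 + xi ^+ 2))%:E * g)%E.
Proof.
move=> c0 C0 K0 B0 g0 A0 Ag goo Yg ZY BZ.
have gf : g \is a fin_num by rewrite ge0_fin_numE.
have Aoo : (A < +oo)%E.
  by apply: le_lt_trans Ag _; rewrite -(fineK gf) -EFinM ltry.
have Af : A \is a fin_num by rewrite ge0_fin_numE.
rewrite -(fineK gf) in Ag Yg *; rewrite -(fineK Af) in Ag ZY *.
rewrite -!EFinM lee_fin in Ag; rewrite -EFinM in Yg.
have {}BZ : (B <= (C * (K * (fine A + xi ^+ 2 * fine g)))%:E)%E.
  rewrite (le_trans BZ)// EFinM lee_wpmul2l ?lee_fin// (le_trans ZY)// EFinM lee_wpmul2l ?lee_fin//.
  by rewrite EFinD leeD2l.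
apply: (le_trans (leeD2l _ BZ)); rewrite -EFinD -EFinM lee_fin.
have CK : 0 <= C * K by rewrite mulr_ge0.
have x2g : 0 <= xi ^+ 2 * fine g by rewrite mulr_ge0 ?sqr_ge0// fine_ge0.
rewrite mulrA -[leRHS]mulrA mulrDl mul1r [(c^-1 + _) * _]mulrDl.
apply: lerD; first by rewrite (le_trans Ag)// lerDl.
by rewrite ler_wpM2l// lerD2r.
Qed.

Section key_estimate.
Context {R : realType} {d : nat} {SX SV : geometry R}.
Context (phi : potential d SX) (psi : potential d SV) {tau : R} (tau_gt0 : 0 < tau) (xi : R).
Local Notation X := 'rV[R]_d.
Local Notation space := (measurableTypeR R * (X * X))%type.
Local Notation Q := (gibbs psi).
Local Notation PQ := (gibbsXV phi psi).
Local Notation U2 := (Umu tau_gt0 phi).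
Local Notation U3 := (UgibbsXV phi psi tau_gt0).
Variables (h0 : X * X -> R) (h : R * (X * X) -> R) (G : R * (X * X) -> X).
Hypothesis sol : VOU_with phi psi xi h0 h G.
Variable t0 : R.
Hypothesis t0_ge0 : 0 <= t0.
Let hs : R * (X * X) -> R := h \o translate t0.
Let Gs : R * (X * X) -> X := G \o translate t0.

Let mhs : measurable_fun setT (hs : space -> R).
Proof. exact: measurable_translated sol t0. Qed.

Let mu3 : measurable_fun setT (fun z : measurableTypeR R * X * X => hs (unassoc z)).
Proof. exact: (measurableT_comp mhs measurable_unassoc). Qed.

Lemma measurable_avg : measurable_fun setT (fun p : measurableTypeR R * X => avg psi hs p).
Proof. exact: (measurable_Rintegral_snd Q mu3). Qed.

Lemma measurable_centered :
  measurable_fun setT (fun z : space => hs z - avg psi hs (z.1, z.2.1)).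
Proof.
apply: measurable_funB => //; apply: (measurableT_comp measurable_avg).
apply: measurable_pairing; first exact: measurable_fst.
exact: (measurableT_comp measurable_fst measurable_snd).
Qed.

Let mc2 : measurable_fun setT (fun z : space => ((hs z - avg psi hs (z.1, z.2.1)) ^+ 2)%:E).
Proof. by apply/measurable_EFinP/measurable_funX; exact: measurable_centered. Qed.

Let mh2 : measurable_fun setT (fun z : space => (hs z ^+ 2)%:E).
Proof. by apply/measurable_EFinP/measurable_funX. Qed.

Let mG2 : measurable_fun setT (fun z : space => (enorm (Gs z) ^+ 2)%:E).
Proof.
apply/measurable_EFinP/measurable_funX; apply: measurable_enorm => i.
exact: measurable_translated_grad sol t0 i.
Qed.

Let sqr0 (y : R) : (0 <= (y ^+ 2)%:E)%E. Proof. by rewrite lee_fin sqr_ge0. Qed.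

Let fubini_measurable (f : space -> \bar R) : measurable_fun setT f -> (forall z, (0 <= f z)%E) ->
  measurable_fun setT (fun p : measurableTypeR R * X => \int[Q]_v f (p.1, (p.2, v)))%E.
Proof.
move=> mf f0; exact: (measurable_fun_fubini_tonelli_F (m2 := Q) (fun z => f (unassoc z))
  (measurableT_comp mf measurable_unassoc) (fun z => f0 _)).
Qed.

(** Pythagoras for the projection [Pi]: the variance identity in almost every velocity fibre,
    integrated over [(t, x)]. *)
Lemma translated_variance : (\int[U3]_z (hs z ^+ 2)%:E =
  \int[U3]_z ((hs z - avg psi hs (z.1, z.2.1)) ^+ 2)%:E + \int[U2]_p (avg psi hs p ^+ 2)%:E)%E.
Proof.
have ma2 : measurable_fun setT (fun p : measurableTypeR R * X => (avg psi hs p ^+ 2)%:E).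
  by apply/measurable_EFinP/measurable_funX; exact: measurable_avg.
rewrite (integral_assoc phi psi tau_gt0 mh2)// (integral_assoc phi psi tau_gt0 mc2)// -ge0_integralD//.
- apply: ae_eq_integral => //.
  + exact: (fubini_measurable mh2 (fun z => sqr0 _)).
  + by apply: emeasurable_funD => //; exact: (fubini_measurable mc2 (fun z => sqr0 _)).
  apply: (@filterS _ _ (ae_filter_ringOfSetsType _) _ _ _ (translated_slice_wgrad tau_gt0 sol t0_ge0)).
  by move=> p [h2 _ _] _; exact: integral_variance h2.
- by move=> p _; exact: integral_ge0.
- exact: (fubini_measurable mc2 (fun z => sqr0 _)).
Qed.

Lemma translated_poincare (c : R) : 0 < c -> poincare psi c ->
  (\int[U3]_z ((hs z - avg psi hs (z.1, z.2.1)) ^+ 2)%:E <=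
   (c^-1)%:E * \int[U3]_z (enorm (Gs z) ^+ 2)%:E)%E.
Proof.
move=> c0 hc; rewrite (integral_assoc phi psi tau_gt0 mc2)// (integral_assoc phi psi tau_gt0 mG2)//.
rewrite -ge0_integralZl//; last 3 first.
- exact: (fubini_measurable mG2 (fun z => sqr0 _)).
- by move=> p _; exact: integral_ge0.
- by rewrite lee_fin invr_ge0 ltW.
apply: ge0_ae_le_integral_nonmeasurable => [p|p|].
- exact: integral_ge0.
- by rewrite mule_ge0 ?integral_ge0// lee_fin invr_ge0 ltW.
apply: (@filterS _ _ (ae_filter_ringOfSetsType _) _ _ _ (translated_slice_wgrad tau_gt0 sol t0_ge0)).
by move=> p hG; exact: poincare_sqr hG.
Qed.

Lemma Hcal_le (C K c : R) : 0 <= C -> 0 <= K -> 0 < c ->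
  lions tau_gt0 phi C -> averaging phi psi tau_gt0 K -> poincare psi c ->
  \int[U2]_p avg psi hs p = 0 ->
  (Hcal phi psi tau h t0 <= ((1 + C * K) * (c^-1 + xi ^+ 2))%:E *
   \int[lebesgue_measure]_(r in `[t0, (t0 + tau)%R]) L2normv PQ (fun y => G (r, y)) ^+ 2)%E.
Proof.
move=> C0 K0 c0 hL hA hP amean.
have tau0 : (0 <= tau%:E)%E by rewrite lee_fin ltW.
(* Both sides carry the factor [1 / tau] of the uniform law, so the inequality may be proved on the
   translated window. *)
suff : (\int[U3]_z (hs z ^+ 2)%:E <=
    ((1 + C * K) * (c^-1 + xi ^+ 2))%:E * \int[U3]_z (enorm (Gs z) ^+ 2)%:E)%E.
  rewrite (translated_sqr tau_gt0 sol t0) (translated_grad_sqr tau_gt0 sol t0).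
  have tauK (y : \bar R) : (tau%:E * ((tau^-1)%:E * y) = y)%E.
    by rewrite muleA -EFinM mulfV ?gt_eqF// mul1e.
  by move=> /(lee_wpmul2l tau0); rewrite [leRHS]muleCA !tauK.
have g_lty := translated_grad_sqr_lty tau_gt0 sol t0_ge0.
have hvar := translated_variance; have hpoin := translated_poincare c0 hP.
(* The Lions inequality is available for square integrable functions; Pythagoras bounds the norm of
   [Pi h] by that of [h]. *)
have a2 : (fun p : measurableTypeR R * X => avg psi hs p) \in Lfun U2 2%:E.
  apply/LfunP2; split; first exact: measurable_avg.
  have [_ tot] := (LfunP2 _ _).1 (translated_L2 tau_gt0 sol t0_ge0).
  apply: le_lt_trans tot; rewrite hvar leeDr//; exact: integral_ge0.
have := hL _ a2; rewrite amean L2norm_sqr.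
rewrite (_ : (fun p => ((avg psi hs p - 0) ^+ 2)%:E) = (fun p => (avg psi hs p ^+ 2)%:E)); last first.
  by apply/funext => p; rewrite subr0.
have := hA _ _ (translated_H1kin tau_gt0 sol t0_ge0); rewrite L2norm_sqr -/hs -/Gs.
have := L2Hm1_sqnorm_le tau_gt0 sol t0; rewrite -/Gs.
rewrite hvar; move: hpoin g_lty.
have : (0 <= \int[U3]_z ((hs z - avg psi hs (z.1, z.2.1)) ^+ 2)%:E)%E by exact: integral_ge0.
have : (0 <= \int[U3]_z (enorm (Gs z) ^+ 2)%:E)%E by exact: integral_ge0.
have : (0 <= \int[U2]_p (avg psi hs p ^+ 2)%:E)%E by exact: integral_ge0.
move: (L2Hm1_sqnorm _ _ _ _) (Hm1norm_tx _ _ _ ^+ 2)%E (\int[U3]_z (enorm _ ^+ 2)%:E)%E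
  (\int[U3]_z ((hs z - _) ^+ 2)%:E)%E (\int[U2]_p (avg psi hs p ^+ 2)%:E)%E.
move=> Y Z g A B B0 g0 A0 AG goo YG ZY BZ.
exact: lions_averaging_combine c0 C0 K0 B0 g0 A0 AG goo YG ZY BZ.
Qed.

End key_estimate.

(** * From a drop over each window to exponential decay *)

Section gronwall.
Context {R : realType}.

(** Take inverses: [1 - x <= expR (- x)] at [x = y / (1 + y)], where [1 - x = 1 / (1 + y)]. It
    bounds the powers [(1 + y) ^+ n] of the discrete scheme from below by exponentials. *)
Lemma expR_div1D_le (y : R) : 0 <= y -> expR (y / (1 + y)) <= 1 + y.
Proof.
move=> y0; have y1 : 0 < 1 + y by rewrite ltr_pwDl.
rewrite -lef_pV2 ?posrE ?expR_gt0// -expRN.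
apply: le_trans (expR_ge1Dx _); rewrite le_eqVlt; apply/orP; left; apply/eqP.
by field; rewrite gt_eqF.
Qed.

(* The step [d = t / n] gives [H t * (1 + l d) ^+ n <= H 0]; let [n] tend to infinity. *)
Lemma gronwall (H : R -> R) (l t : R) : 0 <= l -> (forall s, 0 <= s -> 0 <= H s) ->
  (forall s d, 0 <= s -> 0 <= d -> H (s + d) * (1 + l * d) <= H s) ->
  0 <= t -> H t * expR (l * t) <= H 0.
Proof.
move=> l0 H0 step t0.
have iter d k : 0 <= d -> H (k%:R * d) * (1 + l * d) ^+ k <= H 0.
  move=> d0; have ld : 0 <= 1 + l * d by rewrite addr_ge0// mulr_ge0.
  elim: k => [|k IH]; first by rewrite mul0r expr0 mulr1.
  apply: le_trans IH; rewrite exprS mulrA ler_wpM2r ?exprn_ge0// -natr1 mulrDl mul1r.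
  by apply: step => //; rewrite mulr_ge0.
have lt0 : 0 <= l * t by rewrite mulr_ge0.
have bound n : H t * expR (l * t / (1 + l * t * n.+1%:R^-1)) <= H 0.
  have d0 : 0 <= t / n.+1%:R by rewrite divr_ge0.
  have tE : n.+1%:R * (t / n.+1%:R) = t by rewrite mulrCA divff ?mulr1// pnatr_eq0.
  have := iter _ n.+1 d0; rewrite tE; apply: le_trans.
  rewrite ler_wpM2l ?H0//.
  rewrite (_ : l * t / _ = (l * (t / n.+1%:R)) / (1 + l * (t / n.+1%:R)) *+ n.+1); last first.
    by rewrite -[RHS]mulr_natl [RHS]mulrA [n.+1%:R * _]mulrCA tE !mulrA.
  by rewrite -mulr_natl expRM_natl lerXn2r ?nnegrE ?expR_ge0 ?addr_ge0 ?mulr_ge0// expR_div1D_le// mulr_ge0.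
have cvg_bound : H t * expR (l * t / (1 + l * t * n.+1%:R^-1)) @[n --> \oo] --> H t * expR (l * t).
  apply: cvgM; first exact: cvg_cst.
  apply: (@continuous_cvg _ _ _ _ _ _ expR); first exact: continuous_expR.
  rewrite -[X in _ --> X]divr1 -[X in _ / X]addr0.
  apply: cvgM; first exact: cvg_cst.
  apply: cvgV; first by rewrite addr0 oner_eq0.
  apply: cvgD; first exact: cvg_cst.
  by rewrite -[X in _ --> X](mulr0 (l * t)); apply: cvgMl_tmp; exact: cvg_harmonic.
rewrite -(cvg_lim _ cvg_bound)//; apply: limr_le; first by apply/cvg_ex; eexists; exact: cvg_bound.
exact: nearW.
Qed.

End gronwall.

Lemma integral_segment_cst (R : realType) (a b : R) (k : \bar R) : a <= b ->
  (\int[lebesgue_measure]_(s in `[a, b]) k = k * (b - a)%:E)%E.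
Proof.
move=> ab; rewrite (integral_cst lebesgue_measure)//; congr (_ * _)%E.
apply: etrans (lebesgue_measure_itv _) _; rewrite /= lte_fin.
by case: ltgtP ab => // ->; rewrite subrr.
Qed.

Section averaged_decay.
Context {R : realType} (N : R -> \bar R) (tau l : R).
Local Notation J a b := (\int[lebesgue_measure]_(s in `[a%R, b%R]) N s)%E.
Hypotheses (mN : measurable_fun (setT : set (measurableTypeR R)) N) (N_ge0 : forall t, (0 <= N t)%E).
Hypotheses (N0_lty : (N 0 < +oo)%E) (tau_gt0 : 0 < tau) (l_ge0 : 0 <= l).
Hypothesis N_le : forall s t, 0 <= s -> s <= t -> (N t <= N s)%E.
Hypothesis N_drop : forall t, 0 <= t -> (l%:E * J t (t + tau)%R + N (t + tau) <= N t)%E.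

Lemma integral_itv_split (a b c : R) : a <= b -> b <= c -> (J a c = J a b + J b c)%E.
Proof.
move=> ab bc; rewrite (@itv_bndbnd_setU _ _ (BLeft a) (BRight b) (BRight c))//.
rewrite ge0_integral_setU//=.
- by rewrite integral_itv_obnd_cbnd//; exact: measurable_funTS.
- exact: measurable_funTS.
- rewrite disj_set2E; apply/eqP/seteqP; split => // x [/=].
  by rewrite !in_itv/= => /andP[_ xb] /andP[bx _]; move: (lt_le_trans bx xb); rewrite ltxx.
Qed.

Lemma integral_itv_ge0 (a b : R) : (0 <= J a b)%E.
Proof. exact: integral_ge0. Qed.

Lemma integral_itv_fin (a b : R) : 0 <= a -> J a b \is a fin_num.
Proof.
move=> a0; rewrite ge0_fin_numE ?integral_itv_ge0//.
apply: (@le_lt_trans _ _ (\int[lebesgue_measure]_(s in `[a, b]) N 0)%E).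
  apply: ge0_le_integral => //.
  - exact: measurable_funTS.
  - by move=> s; rewrite /= in_itv/= => /andP[as_ _]; apply: N_le => //; exact: le_trans as_.
rewrite (integral_cst lebesgue_measure)// lte_mul_pinfty//; first by rewrite ge0_fin_numE.
apply: (@le_lt_trans _ _ (lebesgue_measure (`[a, b]%classic : set R))) => //.
by rewrite lebesgue_measure_itv/=; case: ifP => // _; rewrite -EFinB ltry.
Qed.

Lemma integral_itv_antitone (s t : R) : 0 <= s -> s <= t -> (J t (t + tau) <= J s (s + tau))%E.
Proof.
move=> s0 st; have shift u : (J u (u + tau) = \int[lebesgue_measure]_(r in `[0%R, tau]) N (u + r)%R)%E.
  by rewrite (ge0_integral_lebesgue_translation u _ _ mN)// addr0.
rewrite !shift; apply: ge0_le_integral => //.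
- by apply: measurable_funTS; exact: (measurableT_comp mN (measurable_translation t)).
- by apply: measurable_funTS; exact: (measurableT_comp mN (measurable_translation s)).
- move=> r; rewrite /= in_itv/= => /andP[r0 _].
  by apply: N_le; [rewrite addr_ge0|rewrite lerD2r].
Qed.

(* [N (s + tau) <= N s - l J (t + d) (t + d + tau)] for [t <= s <= t + d], because
   the sliding integral is nonincreasing; integrate this over [s]. *)
Lemma integral_itv_step (t d : R) : 0 <= t -> 0 <= d ->
  fine (J (t + d) (t + d + tau)) * (1 + l * d) <= fine (J t (t + tau)).
Proof.
move=> t0 d0; have td : t <= t + d by rewrite lerDl.
have td0 : 0 <= t + d by rewrite addr_ge0.
have tt : t <= t + tau by rewrite lerDl ltW.
have tt0 : 0 <= t + tau by rewrite addr_ge0// ltW.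
set H := J (t + d) (t + d + tau); set j1 := J t (t + d); set j2 := J (t + tau) (t + tau + d).
have fH : H \is a fin_num by exact: integral_itv_fin.
have f1 : j1 \is a fin_num by exact: integral_itv_fin.
have f2 : j2 \is a fin_num by exact: integral_itv_fin.
have fHt : J t (t + tau) \is a fin_num by exact: integral_itv_fin.
have split_eq : (j1 + H = J t (t + tau) + j2)%E.
  rewrite -(integral_itv_split td) ?lerDl ?(ltW tau_gt0)//.
  by rewrite -(integral_itv_split tt) ?lerDl// addrAC.
have step : (l%:E * H * d%:E + j2 <= j1)%E.
  have dE : (\int[lebesgue_measure]_(s in `[t, (t + d)%R]) (l%:E * H) = l%:E * H * d%:E)%E.
    by rewrite integral_segment_cst// addrC addKr.
  have j2E : j2 = (\int[lebesgue_measure]_(s in `[t, (t + d)%R]) N (tau + s)%R)%E.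
    by rewrite (ge0_integral_lebesgue_translation tau _ _ mN)// /j2 addrA [tau + t]addrC.
  have lH : (0 <= l%:E * H)%E by rewrite mule_ge0// integral_itv_ge0.
  have mNt : measurable_fun (setT : set (measurableTypeR R)) (fun s => N (tau + s)).
    exact: (measurableT_comp mN (measurable_translation tau)).
  rewrite -dE j2E -ge0_integralD//; last exact: measurable_funTS.
  apply: ge0_le_integral => //.
  - by move=> s _; rewrite adde_ge0.
  - by apply: emeasurable_funD => //; exact: measurable_funTS.
  - exact: measurable_funTS.
  - move=> s; rewrite /= in_itv/= => /andP[ts sd]; have s0 := le_trans t0 ts.
    apply: le_trans (N_drop s0); rewrite [(tau + s)%R]addrC leeD2r// lee_wpmul2l//.
    exact: integral_itv_antitone.
move: split_eq step; rewrite -(fineK fH) -(fineK f1) -(fineK f2) -(fineK fHt) -!EFinM -!EFinD lee_fin => -[].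
by rewrite /=; move: (fine _) (fine _) (fine _) (fine _) => a b c e E1 E2; lra.
Qed.

Lemma averaged_decay (t : R) : 0 <= t -> (J t (t + tau) <= (expR (- (l * t)))%:E * J 0 tau)%E.
Proof.
move=> t0; have f0 : J 0 tau \is a fin_num by exact: integral_itv_fin.
have ft : J t (t + tau) \is a fin_num by exact: integral_itv_fin.
have := gronwall (H := fun s => fine (J s (s + tau))) l_ge0 (fun s _ => fine_ge0 (integral_itv_ge0 _ _))
  integral_itv_step t0.
rewrite add0r -(fineK f0) -(fineK ft) -EFinM lee_fin expRN => h.
by rewrite mulrC ler_pdivlMr ?expR_gt0.
Qed.

(** For [t < tau] the factor [expR (l / 2 * (tau - t))] is at least 1, and monotonicity of [N]
    suffices. For [t >= tau] the window [[t - tau, t]] yields the factor [expR (l * (tau - t))],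
    which is at most the one claimed. *)
Lemma pointwise_decay (t : R) : 0 <= t ->
  (N t <= (expR (l / 2 * tau) * expR (- (l / 2 * t)))%:E * N 0)%E.
Proof.
move=> t0; have N0f : N 0 \is a fin_num by rewrite ge0_fin_numE.
have l20 : 0 <= l / 2 by rewrite divr_ge0.
have Nt0 : (N t <= N 0)%E by exact: N_le.
rewrite -expRD -mulrBr; have [tt|tt] := ltP t tau.
  rewrite (le_trans Nt0)// -[leLHS]mul1e lee_wpmul2r// lee_fin -[leLHS]expR0 ler_expR.
  by rewrite mulr_ge0// subr_ge0 ltW.
have s0 : 0 <= t - tau by rewrite subr_ge0.
have h1 : (N t * tau%:E <= J (t - tau) t)%E.
  have <- : (\int[lebesgue_measure]_(s in `[(t - tau)%R, t]) (N t) = N t * tau%:E)%E.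
    have e : t - (t - tau) = tau by rewrite opprB addrC subrK.
    have le_t : t - tau <= t by rewrite gerBl ltW.
    by rewrite integral_segment_cst// e.
  apply: ge0_le_integral => //; first exact: measurable_funTS.
  move=> s; rewrite /= in_itv/= => /andP[ts st]; apply: N_le => //; exact: le_trans ts.
have h2 := averaged_decay s0; rewrite subrK in h2.
have h3 : (J 0 tau <= N 0 * tau%:E)%E.
  have <- : (\int[lebesgue_measure]_(s in `[0%R, tau]) (N 0) = N 0 * tau%:E)%E.
    by rewrite integral_segment_cst ?subr0// ltW.
  apply: ge0_le_integral => //; first exact: measurable_funTS.
  by move=> s; rewrite /= in_itv/= => /andP[s0' _]; exact: N_le.
have h4 : (N t * tau%:E <= (expR (- (l * (t - tau))))%:E * N 0 * tau%:E)%E.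
  apply: le_trans h1 _; apply: le_trans h2 _; rewrite -muleA lee_wpmul2l// lee_fin expR_ge0.
have h5 : (N t <= (expR (- (l * (t - tau))))%:E * N 0)%E.
  by rewrite -(@lee_pmul2r _ tau%:E)// lte_fin.
apply: (le_trans h5); rewrite lee_wpmul2r// lee_fin ler_expR.
by nra.
Qed.

End averaged_decay.

(** * Square integrability of the gradients of the potentials *)

Section potential_gradients.
Context {R : realType} {d : nat} {S : geometry R} (phi : potential d S).

Lemma measurable_grad i : measurable_fun setT (fun x => grad phi x ord0 i).
Proof. exact: (continuous_measurable_rV (@continuous_grad _ _ _ phi i)). Qed.

Lemma H1normx_lty u G : is_wgrad (gibbs phi) (weak_grad S) u G -> (H1normx phi u < +oo)%E.
Proof.
move=> uG; have [u2 _ _] := uG; have [_ w2 _] := wgradP uG.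
have [_ hu] := (LfunP2 _ _).1 u2; have [_ hw] := (L2vP _ _).1 w2.
rewrite /H1normx /H1norm L2norm_sqr L2normv_sqr.
rewrite -L2norm_sqr in hu *; rewrite -L2normv_sqr in hw *.
have : (L2norm (gibbs phi) u ^+ 2 + L2normv (gibbs phi) (wgrad (gibbs phi) (weak_grad S) u) ^+ 2 < +oo)%E.
  exact: lte_add_pinfty.
by case: (_ + _)%E => //= r _; rewrite ltry.
Qed.

(** The drift bound at the constant [z = 1], which has finite H^1 norm because the Gibbs measure is
    a probability. *)
Lemma drift_bound_grad_L2 (L : R) : 0 <= L -> drift_bound phi L -> L2v (gibbs phi) (grad phi).
Proof.
move=> L0 hL; apply/L2vP; split; first exact: measurable_grad.
have w1 := is_wgrad_cst phi 1; have := hL _ (ex_intro _ _ w1).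
rewrite (_ : (fun x => (1 * enorm (grad phi x))%R) = enorm \o grad phi); last first.
  by apply/funext => x; rewrite mul1r.
move=> hle; have : (L2norm (gibbs phi) (enorm \o grad phi) < +oo)%E.
  apply: le_lt_trans hle _; apply: lte_mul_pinfty => //; exact: H1normx_lty w1.
rewrite -L2normv_sqr /L2normv; have := L2norm_ge0 (gibbs phi) (enorm \o grad phi).
by case: (L2norm _ _) => //= r _ _; rewrite ltry.
Qed.

(** From the fourth moment, by [b <= 1 + b^2] with [b] the squared norm of the gradient. *)
Lemma velocity_grad_L2 : velocity_assumption phi -> L2v (gibbs phi) (grad phi).
Proof.
move=> [h4 _ _]; apply/L2vP; split; first exact: measurable_grad.
have me := measurable_enorm measurable_grad.
have i4 : (\int[gibbs phi]_x (enorm (grad phi x) ^+ 4)%:E < +oo)%E.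
  apply: le_lt_trans h4; rewrite leeDl//; apply: integral_ge0 => x _.
  by rewrite lee_fin sqr_ge0.
apply: (@le_lt_trans _ _ (\int[gibbs phi]_x (1 + (enorm (grad phi x) ^+ 4)%:E))%E).
  apply: ge0_le_integral => //.
  - by move=> x _; rewrite lee_fin sqr_ge0.
  - by apply/measurable_EFinP; exact: measurable_funX.
  - apply: emeasurable_funD => //; apply/measurable_EFinP; exact: measurable_funX.
  - move=> x _; rewrite -EFinD lee_fin.
    rewrite [X in _ <= 1 + X](exprM _ 2 2).
    by have := sqr_ge0 (enorm (grad phi x)); move: (_ ^+ 2) => b b0; nra.
rewrite ge0_integralD//; last 2 first.
- by move=> x _; rewrite lee_fin exprn_ge0// enorm_ge0.
- by apply/measurable_EFinP; exact: measurable_funX.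
apply: lte_add_pinfty => //.
rewrite (integral_cst (gibbs phi) measurableT) mul1e.
by rewrite [X in (X < _)%E](@probability_setT _ _ _ (gibbs phi)) ltry.
Qed.

End potential_gradients.

(** * Monotonicity of the energy, and assembly of the estimates *)

Section solution_decay.
Context {R : realType} {d : nat} {SX SV : geometry R}.
Context (phi : potential d SX) (psi : potential d SV) (xi : R).
Local Notation X := 'rV[R]_d.
Local Notation PQ := (gibbsXV phi psi).
Variables (h0 : X * X -> R) (h : R * (X * X) -> R) (G : R * (X * X) -> X).
Hypothesis sol : VOU_with phi psi xi h0 h G.
Hypothesis xi_ge0 : 0 <= xi.
Local Notation N t := (L2norm PQ (at_ h t) ^+ 2)%E.

Lemma energy_le (s t : R) : 0 <= s -> s <= t -> (N t <= N s)%E.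
Proof.
move=> s0 st; rewrite -(vou_energy sol s0 st) leeDl// mule_ge0//.
  by rewrite lee_fin mulr_ge0.
by apply: integral_ge0 => r _; rewrite expe_ge0 ?L2norm_ge0.
Qed.

Lemma energy0 : h0 \in Lfun PQ 2%:E -> N 0 = (L2norm PQ h0 ^+ 2)%E.
Proof.
move=> h02; rewrite !L2norm_sqr; apply: ae_eq_integral => //.
- apply/measurable_EFinP/measurable_funX.
  apply: (measurableT_comp (vou_measurable sol)).
  by apply: measurable_pairing; [exact: measurable_cst|exact: measurable_id].
- by apply/measurable_EFinP/measurable_funX; exact: Lfun_measurable h02.
- by apply: filterS (vou_initial sol) => y + _; rewrite /at_ => ->.
Qed.

End solution_decay.

Theorem corollary5 (R : realType) (d : nat) (SX SV : geometry R)
  (phi : potential d SX) (psi : potential d SV)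
  (tau xi : R) (tau_gt0 : 0 < tau) (xi_gt0 : 0 < xi)
  (CLions : R -> R)
  (HLions : forall (s : R) (s_gt0 : 0 < s),
     0 < CLions s /\ lions s_gt0 phi (CLions s))
  (Hpsi : velocity_assumption psi)
  (Hlie : hormander phi psi)
  (Hdrift : exists2 L : R, 0 <= L & drift_bound phi L)
  (c_psi : R) (c_psi_gt0 : 0 < c_psi) (Hpoincare : poincare psi c_psi)
  (Kavg : R) (Kavg_ge0 : 0 <= Kavg) (Havg : averaging phi psi tau_gt0 Kavg) :
  let lambda_bar := (1 + CLions tau * Kavg)^-1 * ((xi * c_psi)^-1 + xi)^-1 in
  exists lambda : R,
    [/\ lambda_bar <= lambda, 0 < lambda_bar &
        forall h0 h,
          h0 \in Lfun (gibbsXV phi psi) 2%:E ->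
          \int[gibbsXV phi psi]_y h0 y = 0 ->
          VOU_solution phi psi xi h0 h ->
          (forall t, 0 <= t ->
             (Hcal phi psi tau h t <=
              (expR (- (2 * lambda * t)))%:E * Hcal phi psi tau h 0)%E) /\
          (forall t, 0 <= t ->
             (L2norm (gibbsXV phi psi) (at_ h t) ^+ 2 <=
              (expR (lambda * tau) * expR (- (lambda * t)))%:E *
              L2norm (gibbsXV phi psi) h0 ^+ 2)%E)].
Proof.
move: (CLions tau) (HLions tau tau_gt0) => C [C_gt0 hL] lambda_bar.
have k_gt0 : 0 < 1 + C * Kavg by rewrite ltr_pwDl// mulr_ge0// ltW.
have e_gt0 : 0 < (xi * c_psi)^-1 + xi by rewrite addr_gt0// invr_gt0 mulr_gt0.
have l_gt0 : 0 < lambda_bar by rewrite mulr_gt0// invr_gt0.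
exists lambda_bar; split => // h0 h h0_L2 h0_mean [G sol].
have xi_ge0 := ltW xi_gt0.
have [L L_ge0 hdrift] := Hdrift.
have phi_L2 := drift_bound_grad_L2 L_ge0 hdrift.
have psi_L2 := velocity_grad_L2 Hpsi.
pose N (t : R) := (L2norm (gibbsXV phi psi) (at_ h t) ^+ 2)%E.
have mN : measurable_fun (setT : set (measurableTypeR R)) N := measurable_L2norm_sqr sol.
have N_ge0 t : (0 <= N t)%E by rewrite expe_ge0 ?L2norm_ge0.
have N0E : N 0 = (L2norm (gibbsXV phi psi) h0 ^+ 2)%E := energy0 sol h0_L2.
have N0_lty : (N 0%R < +oo)%E by rewrite N0E L2norm_sqr; have [] := (LfunP2 _ _).1 h0_L2.
have N_le (s t : R) (s0 : 0 <= s) (st : s <= t) : (N t <= N s)%E := energy_le sol xi_ge0 s0 st.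
have l_ge0 : 0 <= 2 * lambda_bar by rewrite mulr_ge0// ltW.
have N_drop t : 0 <= t ->
    ((2 * lambda_bar)%:E * (\int[lebesgue_measure]_(s in `[t, (t + tau)%R]) N s) + N (t + tau)%R <= N t)%E.
  move=> t_ge0; have tt : t <= t + tau by rewrite lerDl ltW.
  have amean := translated_avg_mean tau_gt0 sol phi_L2 psi_L2 h0_L2 h0_mean t_ge0.
  have key := Hcal_le sol t_ge0 (ltW C_gt0) Kavg_ge0 c_psi_gt0 hL Havg Hpoincare amean.
  rewrite addeC [leRHS](esym (vou_energy sol t_ge0 tt)); apply: leeD2l.
  have l0E : (0 <= (2 * lambda_bar)%:E)%E by rewrite lee_fin.
  apply: le_trans (lee_wpmul2l l0E key) _; rewrite muleA -EFinM.
  (* Since [1 / c_psi + xi^2 = xi (1 / (xi c_psi) + xi)], multiplying the constant of [Hcal_le] by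
     [2 lambda_bar] leaves exactly the factor [2 xi] of the energy identity. *)
  rewrite (_ : 2 * lambda_bar * _ = 2 * xi)// /lambda_bar.
  rewrite (_ : c_psi^-1 + xi ^+ 2 = xi * ((xi * c_psi)^-1 + xi)); last by field; rewrite !gt_eqF.
  move: ((xi * c_psi)^-1 + xi) (1 + C * Kavg) e_gt0 k_gt0 => a b a0 b0.
  by field; rewrite !gt_eqF.
split=> t t_ge0.
- have := averaged_decay mN N_ge0 N0_lty tau_gt0 l_ge0 N_le N_drop t_ge0.
  by rewrite /Hcal add0r.
- have := pointwise_decay mN N_ge0 N0_lty tau_gt0 l_ge0 N_le N_drop t_ge0.
  by rewrite -N0E (_ : 2 * lambda_bar / 2 = lambda_bar)//; field.
Qed.
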